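(* Let $\mu$ be a centered probability measure on $\mathbb{R}$ with unit variance and subexponential tails, i.e. there exist constants $\alpha,\beta>0$ such that, if $X\sim\mu$, then $\mathbb{P}(|X|\ge t^\alpha)\le\beta e^{-t}$ for all $t>0$. Let $W_N$ be a real symmetric $N\times N$ Wigner matrix associated with $\mu$. Then for every $E\in\mathbb{R}$, $$\lim_{N\to\infty}\frac1N\log\mathbb{E}[|\det(W_N-E)|]=\int_{\mathbb{R}}\log|\lambda-E|\,\rho_{\mathrm{sc}}(\lambda)\,d\lambda.$$
   Context: A Wigner matrix associated with $\mu$ is a real symmetric random matrix $W_N$ such that the entries of $\sqrt N W_N$ are independent up to symmetry and each distributed according to $\mu$. $W_N-E$ means $W_N-E\,\mathrm{Id}$. $\rho_{\mathrm{sc}}(x)=\frac{\sqrt{4-x^2}}{2\pi}\mathbf{1}_{x\in[-2,2]}$ is the semicircle density. *)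

(* Defs.v *)
From HB Require Import structures.
From mathcomp Require Import all_boot all_order all_algebra.
From mathcomp Require Import all_classical all_reals all_analysis.

Set Implicit Arguments.
Unset Strict Implicit.
Unset Printing Implicit Defensive.

Import Order.TTheory GRing.Theory Num.Theory.
Import numFieldNormedType.Exports.

Local Open Scope classical_set_scope.
Local Open Scope ring_scope.

Definition mutually_independent d (T : measurableType d) (R : realType)
    (P : probability T R) (I : finType) (D : {set I}) (X : I -> T -> R) : Prop :=
  forall (J : {set I}) (A : I -> set R), J \subset D ->
    (forall i, i \in J -> measurable (A i)) ->
    P (\bigcap_(i in [set` J]) X i @^-1` A i) =
    (\prod_(i in J) P (X i @^-1` A i))%E.

(* "Independent up to symmetry": the family indexed by the pairs i <= j is
   mutually independent. *)
Definition is_wigner (R : realType) (mu : probability R R)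
    d (T : measurableType d) (P : probability T R) (N : nat)
    (W : T -> 'M[R]_N) : Prop :=
  let X (p : 'I_N * 'I_N) (w : T) : R := Num.sqrt N%:R * W w p.1 p.2 in
  [/\ forall i j, measurable_fun [set: T] (fun w => W w i j),
      forall w, (W w)^T = W w,
      forall p (A : set R), measurable A -> P (X p @^-1` A) = mu A
    & mutually_independent P [set p : 'I_N * 'I_N | (p.1 <= p.2)%N] X ].

(* This implies integrability: an undefined integral oo - oo is -oo in \bar R. *)
Definition centered (R : realType) (mu : probability R R) : Prop :=
  ('E_mu[idfun] = 0)%E.

Definition unit_variance (R : realType) (mu : probability R R) : Prop :=
  ('V_mu[idfun] = 1)%E.

Definition subexponential_tails (R : realType) (mu : probability R R) : Prop :=
  exists alpha beta : R, [/\ 0 < alpha, 0 < beta &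
    forall t : R, 0 < t ->
      (mu [set x : R | (t `^ alpha <= `|x|)%R] <= (beta * expR (- t))%:E)%E].

Definition rho_sc (R : realType) (x : R) : R :=
  Num.sqrt (4 - x ^+ 2) / (2 * pi) * \1_(`[-2, 2] : set R) x.

(* Main.v *)
(** The determinant has degree at most 2 in every independent entry, so its mean
    and its mean square depend on mu only through its first four moments, and mu
    may be replaced by a signed weight on the five points 0, ..., 4.  Expanding
    along the first row then gives closed recursions.  The mean K_n of
    det (M_n - x), M_n having entries of law mu, satisfies the Hermite recursion.
    The mean square F_n, with the means of products of minors, satisfies a linear
    system, which turns into a differential inequality for the generating function
    of F_n / n!: this bounds sqrt F_N, hence u = E |det (M_N - x)|, from above.

    From below, u >= |K_N|, and testing the determinant against the sign of its
    (0,0) entry gives u >= c |K_(N-1)|.  For |E| >= 2 the bound u >= |K_N| is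
    enough.  For |E| < 2 the polynomial K_N may vanish, but u^2 dominates, up to a
    factor O(N), the Turan form He_N^2 - x He_N He_(N-1) + N He_(N-1)^2, which is at
    least ((N-1)! / k!) He_k^2 for k < N; the choice k = N E^2 / 4 is sharp.

    Both bounds are matched with the potential of the semicircle law, which is
    E^2 / 4 - 1 / 2 inside [-2, 2] and ln a + 1 / (2 a^2) for |E| = a + 1 / a, a > 1,
    by the Chebyshev expansion of ln |1 - r e^(i t)|. *)

Require Import Defs.
From HB Require Import structures.
From mathcomp Require Import all_boot all_order all_algebra perm.
From mathcomp Require Import all_classical all_reals all_analysis.
From mathcomp Require Import measurable_realfun ring lra zify.

Set Implicit Arguments.
Unset Strict Implicit.
Unset Printing Implicit Defensive.

Import Order.TTheory GRing.Theory Num.Theory.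
Import numFieldNormedType.Exports.

Local Open Scope ring_scope.

(** * Bordered determinants and discrete expectations *)

(** An absolute value is not a polynomial, so moments reach [E |det|] only through inequalities; the
    rate is nevertheless exact because both bounds lose only subexponential factors. Running the
    algebra on finite signed sums turns independence into distributivity and avoids integrability;
    the price is positivity, which has to be recovered from the true integral of the square. Four
    families close the second-moment recursion: the squared determinant, a determinant times a
    principal minor, two distinct principal minors, and a squared off-diagonal cofactor.
    Conditioning on a smaller block leads back to the same list. The coefficient bound at radius [r]
    has rate [E^2 r / (1 + r) - ln r - 1]. Its derivative vanishes when [|E| = r^(1/2) + r^(-1/2)],
    hence [r = a^(-2)] outside [-2, 2]; inside, the rate decreases on (0, 1), hence [r] tends to 1.
    The infimum is twice the potential in both regimes. From below, consecutive Hermite values never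
    vanish together, and the sign test is what makes the second of them visible to [E |det|]. *)

Lemma det_bordered_mul (R : comNzRingType) n (a : R) (u : 'rV[R]_n) (v : 'cV[R]_n) (M : 'M[R]_n) :
  \det (block_mx a%:M u v M) * \det M =
  (a * \det M - (u *m \adj M *m v) 0 0) * \det M.
Proof.
have := det_mulmx (block_mx a%:M u v M)
  (block_mx (\det M)%:M 0 (- (\adj M *m v)) 1%:M).
rewrite det_lblock det1 mulr1 det_scalar1 => <-.
rewrite mulmx_block !mulmx0 !add0r !mulmx1 !mulmxN !mulmxA mul_mx_adj.
rewrite mul_scalar_mx mul_mx_scalar mul_scalar_mx subrr det_ublock.
by rewrite [X in \det X]mx11_scalar det_scalar1 !mxE mulr1n.
Qed.

(** [det M] may vanish, so the previous identity cannot be cancelled directly. Replacing [M] by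
    ['X + M] makes the determinant a monic polynomial, hence cancellable, and evaluation at 0
    returns to [M]. *)
Lemma det_bordered (R : idomainType) n (a : R) (u : 'rV[R]_n) (v : 'cV[R]_n) (M : 'M[R]_n) :
  \det (block_mx a%:M u v M) = a * \det M - (u *m \adj M *m v) 0 0.
Proof.
pose N : 'M[{poly R}]_n := char_poly_mx (- M).
have N0 : map_mx (horner_eval (0 : R)) N = M.
  apply/matrixP => i j; rewrite !mxE /horner_eval !hornerE.
  by rewrite hornerMn hornerX mul0rn add0r opprK.
have cK k l (B : 'M[R]_(k, l)) : map_mx (horner_eval (0 : R)) (map_mx polyC B) = B.
  by apply/matrixP => i j; rewrite !mxE /horner_eval hornerC.
have dN : \det N != 0.
  by rewrite -/(char_poly (- M)) monic_neq0 // char_poly_monic.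
have := mulIf dN (det_bordered_mul a%:P (map_mx polyC u) (map_mx polyC v) N).
move/(congr1 (horner_eval (0 : R))).
rewrite rmorphB rmorphM /= -!det_map_mx map_block_mx !cK N0 map_scalar_mx /=.
rewrite {1 2}/horner_eval !hornerC => ->; congr (_ - _).
have -> : forall B : 'M[{poly R}]_1, horner_eval 0 (B 0 0) = (map_mx (horner_eval (0 : R)) B) 0 0.
  by move=> B; rewrite mxE.
by rewrite !map_mxM /= map_mx_adj N0 !cK.
Qed.

Section discrete_expectation.
Variables (R : comNzRingType) (A : finType).

(* The weights may be negative, so this need not be a genuine expectation. *)
Definition dexp (I : finType) (w : I -> A -> R) (F : {ffun I -> A} -> R) : R :=
  \sum_(f : {ffun I -> A}) (\prod_i w i (f i)) * F f.

Lemma eq_dexp (I : finType) (w : I -> A -> R) F G : F =1 G -> dexp w F = dexp w G.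
Proof. by move=> FG; apply: eq_bigr => f _; rewrite FG. Qed.

Lemma eq_dexpw (I : finType) (w w' : I -> A -> R) F : w =2 w' -> dexp w F = dexp w' F.
Proof.
by move=> FG; apply: eq_bigr => f _; congr (_ * _); apply: eq_bigr => i _; rewrite FG.
Qed.

Lemma dexpD (I : finType) (w : I -> A -> R) F G :
  dexp w (fun f => F f + G f) = dexp w F + dexp w G.
Proof. by rewrite -big_split /=; apply: eq_bigr => f _; rewrite mulrDr. Qed.

Lemma dexpZ (I : finType) (w : I -> A -> R) c F :
  dexp w (fun f => c * F f) = c * dexp w F.
Proof. by rewrite mulr_sumr; apply: eq_bigr => f _; rewrite mulrCA. Qed.

Lemma dexpN (I : finType) (w : I -> A -> R) F :
  dexp w (fun f => - F f) = - dexp w F.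
Proof. by rewrite -mulN1r -dexpZ; apply: eq_dexp => f; rewrite mulN1r. Qed.

Lemma dexpB (I : finType) (w : I -> A -> R) F G :
  dexp w (fun f => F f - G f) = dexp w F - dexp w G.
Proof. by rewrite dexpD dexpN. Qed.

Lemma dexp_sum (I : finType) (w : I -> A -> R) (K : Type) (r : seq K) (Q : pred K) F :
  dexp w (fun f => \sum_(k <- r | Q k) F k f) = \sum_(k <- r | Q k) dexp w (F k).
Proof.
rewrite exchange_big /=; apply: eq_bigr => f _.
by rewrite mulr_sumr.
Qed.

Lemma dexp_prod (I : finType) (w : I -> A -> R) (h : I -> A -> R) :
  dexp w (fun f => \prod_i h i (f i)) = \prod_i \sum_a w i a * h i a.
Proof.
rewrite bigA_distr_bigA /=; apply: eq_bigr => f _.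
by rewrite -big_split.
Qed.

Lemma dexp_cst (I : finType) (w : I -> A -> R) c :
  (forall i, \sum_a w i a = 1) -> dexp w (fun=> c) = c.
Proof.
move=> w1; rewrite /dexp -mulr_suml -(bigA_distr_bigA w).
by rewrite big1 ?mul1r.
Qed.

(** Marginalization. Only the weights off the image of [phi] must have total mass 1; those on the
    image may be arbitrary signed weights. *)
Lemma dexp_pull (I J : finType) (phi : I -> J) (w : J -> A -> R) F :
  injective phi -> (forall j, j \notin codom phi -> \sum_a w j a = 1) ->
  dexp w (fun f => F [ffun i => f (phi i)]) = dexp (fun i => w (phi i)) F.
Proof.
move=> phiI w1.
rewrite /dexp (partition_big (fun f : {ffun J -> A} => [ffun i => f (phi i)]) xpredT) //=.
apply: eq_bigr => g _.
rewrite (eq_bigr (fun f : {ffun J -> A} => (\prod_j w j (f j)) * F g)); last by move=> f /eqP ->.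
rewrite -mulr_suml; congr (_ * _).
(* The fibre over [g] is a product set: coordinate [j] is forced to [g i] when [j = phi i] and is
   free otherwise, so its total weight factors over [j]. *)
pose Q j a := [forall i, (phi i == j) ==> (a == g i)].
rewrite (eq_bigl (fun f : {ffun J -> A} => f \in family Q)); last first.
  move=> f; apply/eqP/familyP => [fg j|H].
    rewrite /in_mem /= /Q; apply/forallP => i; apply/implyP => /eqP <-.
    by rewrite -fg ffunE.
  apply/ffunP => i; rewrite ffunE.
  by have := H (phi i); rewrite /in_mem /= => /forallP/(_ i); rewrite eqxx => /eqP.
rewrite -bigA_distr_big_dep /=.
rewrite (bigID (mem (codom phi))) /= [X in _ * X]big1 ?mulr1; last first.
  move=> j jn; rewrite -(w1 j jn); apply: eq_bigl => a; rewrite /Q.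
  apply/forallP => i; apply/implyP => /eqP e; move: jn; by rewrite -e codom_f.
rewrite -big_uniq /=; last by rewrite map_inj_uniq ?enum_uniq.
rewrite big_map big_enum /=; apply: eq_bigr => i _.
rewrite (big_pred1 (g i)) // => a; rewrite /Q /=.
apply/forallP/eqP => [/(_ i)|-> k]; first by rewrite eqxx => /eqP.
by apply/implyP => /eqP/phiI ->.
Qed.

(** Fubini for two disjoint blocks of coordinates; merging the index maps into one on [I + J]
    reduces it to marginalization. *)
Lemma dexp_pull2 (I J K : finType) (phi : I -> K) (psi : J -> K) (w : K -> A -> R) F :
  injective phi -> injective psi -> (forall i j, phi i != psi j) ->
  (forall k, k \notin codom phi -> k \notin codom psi -> \sum_a w k a = 1) ->
  dexp w (fun f => F [ffun i => f (phi i)] [ffun j => f (psi j)]) =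
  dexp (fun i => w (phi i)) (fun g => dexp (fun j => w (psi j)) (F g)).
Proof.
move=> phiI psiI dis w1.
pose chi (s : I + J) := match s with inl i => phi i | inr j => psi j end.
have chiI : injective chi.
  move=> [i|j] [i'|j'] //= => [/phiI->|e|e|/psiI->] //.
    by have := dis i j'; rewrite e eqxx.
  by have := dis i' j; rewrite e eqxx.
have -> : dexp w (fun f => F [ffun i => f (phi i)] [ffun j => f (psi j)]) =
   dexp (fun s => w (chi s)) (fun f => F [ffun i => f (inl i)] [ffun j => f (inr j)]).
  rewrite -(dexp_pull _ chiI) => [|k kn]; last first.
    by apply: w1; apply: contra kn => /codomP[i ->]; [exact: (codom_f chi (inl i))|exact: (codom_f chi (inr i))].
  apply: eq_dexp => f.
  by congr F; apply/ffunP => i; rewrite !ffunE.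
pose mrg (p : {ffun I -> A} * {ffun J -> A}) : {ffun (I + J) -> A} :=
  [ffun s => match s with inl i => p.1 i | inr j => p.2 j end].
rewrite /dexp (reindex mrg) /=; last first.
  exists (fun f => ([ffun i => f (inl i)], [ffun j => f (inr j)])).
    by move=> [g h] _; congr pair; apply/ffunP => i; rewrite !ffunE.
  by move=> f _; apply/ffunP => [[i|j]]; rewrite !ffunE.
rewrite -(pair_big xpredT xpredT (fun g h => (\prod_s w (chi s) (mrg (g, h) s)) *
   F [ffun i => mrg (g, h) (inl i)] [ffun j => mrg (g, h) (inr j)])) /=.
apply: eq_bigr => g _; rewrite mulr_sumr; apply: eq_bigr => h _.
rewrite mulrA; congr (_ * _).
  rewrite big_sumType /=; congr (_ * _); apply: eq_bigr => i _; by rewrite ffunE.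
by congr F; apply/ffunP => i; rewrite !ffunE.
Qed.

End discrete_expectation.

(** Conjugation by [t] preserves signs and turns the permutations sending [i] to [j] into those
    sending [t i] to [t j]. *)
Lemma cofactor_perm (R : comNzRingType) n (M : 'M[R]_n) (t : 'S_n) i j :
  cofactor (\matrix_(k, l) M (t k) (t l)) i j = cofactor M (t i) (t j).
Proof.
rewrite !expand_cofactor.
rewrite [RHS](reindex_inj (conjg_inj t)) /=.
apply: eq_big => [s|s _]; first by rewrite conjgE !permM permK (inj_eq perm_inj).
rewrite odd_permJ; congr (_ * _).
rewrite [RHS](reindex_inj (@perm_inj _ t)) /=.
apply: eq_big => [k|k _]; first by rewrite (inj_eq perm_inj).
by rewrite mxE conjgE !permM permK.
Qed.

(** * Moments of monomials and quadratic forms in independent centered variables *)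

Section words.
Variables (R : comNzRingType) (A : finType) (w node : A -> R).
Hypotheses (w0 : \sum_a w a = 1) (w1 : \sum_a w a * node a = 0)
  (w2 : \sum_a w a * node a ^+ 2 = 1).
Let mom k := \sum_a w a * node a ^+ k.

Lemma dexp_word (I : finType) (s : seq I) :
  dexp (fun=> w) (fun u => \prod_(i <- s) node (u i)) = \prod_i mom (count_mem i s).
Proof.
rewrite -(dexp_prod (fun=> w) (fun i a => node a ^+ count_mem i s)).
apply: eq_dexp => u; rewrite -prodr_undup_exp_count [RHS](bigID (mem s)) /=.
rewrite [X in _ = _ * X]big1 ?mulr1.
  rewrite big_uniq ?undup_uniq //=; apply: eq_bigl => i; by rewrite mem_undup.
by move=> i /count_memPn ->; rewrite expr0.
Qed.

Lemma dexp_word_single (I : finType) (s : seq I) i : count_mem i s = 1%N ->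
  dexp (fun=> w) (fun u => \prod_(i <- s) node (u i)) = 0.
Proof.
by move=> si; rewrite dexp_word (bigD1 i) //= si [mom 1]w1 mul0r.
Qed.

Let mom0 : mom 0 = 1.
Proof. by rewrite /mom -[RHS]w0; apply: eq_bigr => a _; rewrite mulr1. Qed.

Lemma dexp_node1 (I : finType) (i : I) : dexp (fun=> w) (fun u => node (u i)) = 0.
Proof.
rewrite -[RHS](@dexp_word_single _ [:: i] i) /= ?eqxx //.
by apply: eq_dexp => u; rewrite big_seq1.
Qed.

Lemma dexp_node2 (I : finType) (i j : I) :
  dexp (fun=> w) (fun u => node (u i) * node (u j)) = (i == j)%:R.
Proof.
have -> : dexp (fun=> w) (fun u => node (u i) * node (u j)) =
  dexp (fun=> w) (fun u => \prod_(k <- [:: i; j]) node (u k)).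
  by apply: eq_dexp => u; rewrite big_cons big_seq1.
case: (eqVneq i j) => [<-|ij]; last first.
  by apply: (dexp_word_single (i := i)); rewrite /= eqxx eq_sym (negbTE ij).
rewrite dexp_word (bigD1 i) //= eqxx big1 ?mulr1 //.
by move=> k ki; rewrite eq_sym (negbTE ki) mom0.
Qed.

(** Wick's formula, with the fourth cumulant [mom 4 - 3] as correction on the full diagonal. No
    third moment enters: the pattern 3 + 1 contains a letter of multiplicity one, whose mean is
    0. *)
Lemma dexp_node4 (I : finType) (i j k l : I) :
  dexp (fun=> w) (fun u => (node (u i) * node (u j)) * (node (u k) * node (u l))) =
  (i == j)%:R * (k == l)%:R + (i == k)%:R * (j == l)%:R + (i == l)%:R * (j == k)%:R
  + (mom 4 - 3%:R) * ((i == j)%:R * (j == k)%:R * (k == l)%:R).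
Proof.
have -> : dexp (fun=> w) (fun u => (node (u i) * node (u j)) * (node (u k) * node (u l))) =
  dexp (fun=> w) (fun u => \prod_(k <- [:: i; j; k; l]) node (u k)).
  by apply: eq_dexp => u; rewrite !big_cons big_nil mulr1 !mulrA.
have pairs a b (s : seq I) : a != b ->
    (forall t, count_mem t s = ((a == t) * 2 + (b == t) * 2)%N) ->
    dexp (fun=> w) (fun u => \prod_(k <- s) node (u k)) = 1.
  move=> ab cs; rewrite dexp_word big1 // => t _; rewrite cs.
  case: (eqVneq a t) => [<-|_]; first by rewrite eq_sym (negbTE ab).
  by case: (b == t); rewrite ?mom0.
have [<-{j}|ij] := eqVneq i j.
  have [<-{k}|ik] := eqVneq i k.
    have [<-{l}|il] := eqVneq i l.
      rewrite dexp_word (bigD1 i) //= eqxx big1 ?mulr1 /=; first by ring.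
      by move=> k ki; rewrite eq_sym (negbTE ki) mom0.
    rewrite (dexp_word_single (i := l)) /=; first by ring.
    by rewrite eqxx (negbTE il).
  have [<-{l}|kl] := eqVneq k l.
    rewrite (pairs _ _ _ ik) => [|t]; first by rewrite /=; ring.
    by rewrite /=; case: (i == t); case: (k == t).
  rewrite (dexp_word_single (i := k)) /=; first by ring.
  by rewrite eqxx (negbTE ik) eq_sym (negbTE kl).
have [<-{k}|ik] := eqVneq i k.
  rewrite [j == i]eq_sym (negbTE ij).
  have [<-{l}|jl] := eqVneq j l.
    rewrite (pairs _ _ _ ij) => [|t]; first by rewrite /=; ring.
    by rewrite /=; case: (i == t); case: (j == t).
  rewrite (dexp_word_single (i := j)) /=; first by ring.
  by rewrite eqxx (negbTE ij) eq_sym (negbTE jl).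
have [<-{l}|il] := eqVneq i l.
  have [<-{k ik}|jk] := eqVneq j k.
    rewrite (pairs _ _ _ ij) => [|t]; first by rewrite /=; ring.
    by rewrite /=; case: (i == t); case: (j == t).
  rewrite (dexp_word_single (i := j)) /=; first by ring.
  by rewrite eqxx (negbTE ij) eq_sym (negbTE jk).
rewrite (dexp_word_single (i := i)) /=; first by ring.
by rewrite eqxx eq_sym (negbTE ij) eq_sym (negbTE ik) eq_sym (negbTE il).
Qed.

Lemma dexp_linear_sq (I : finType) (c : I -> R) :
  dexp (fun=> w) (fun u => (\sum_i c i * node (u i)) ^+ 2) = \sum_i c i ^+ 2.
Proof.
transitivity (\sum_i \sum_j c i * c j * (i == j)%:R).
  transitivity (dexp (fun=> w) (fun u => \sum_i \sum_j c i * c j * (node (u i) * node (u j)))).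
    apply: eq_dexp => u; rewrite expr2 mulr_suml; apply: eq_bigr => i _.
    by rewrite mulr_sumr; apply: eq_bigr => j _; ring.
  rewrite dexp_sum; apply: eq_bigr => i _; rewrite dexp_sum; apply: eq_bigr => j _.
  by rewrite dexpZ dexp_node2.
apply: eq_bigr => i _; rewrite (bigD1 i) //= eqxx mulr1 big1 ?addr0 ?expr2 // => j ji.
by rewrite eq_sym (negbTE ji) mulr0.
Qed.

Lemma dexp_quad (I : finType) (p : I -> I -> R) :
  dexp (fun=> w) (fun u => \sum_i \sum_j p i j * (node (u i) * node (u j))) = \sum_i p i i.
Proof.
rewrite dexp_sum; apply: eq_bigr => i _.
transitivity (\sum_j p i j * (i == j)%:R).
  by rewrite dexp_sum; apply: eq_bigr => j _; rewrite dexpZ dexp_node2.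
rewrite (bigD1 i) //= eqxx mulr1 big1 ?addr0 // => j ji.
by rewrite eq_sym (negbTE ji) mulr0.
Qed.

Lemma sum_delta (I : finType) (F : I -> R) i : \sum_j F j * (i == j)%:R = F i.
Proof.
rewrite (bigD1 i) //= eqxx mulr1 big1 ?addr0 // => j ji.
by rewrite eq_sym (negbTE ji) mulr0.
Qed.

(** The three pairings of the four indices give the squared trace, the sum of squares and the trace
    of [p^2]; the fourth cumulant weights the diagonal. *)
Lemma dexp_quad_sq (I : finType) (p : I -> I -> R) :
  dexp (fun=> w) (fun u => (\sum_i \sum_j p i j * (node (u i) * node (u j))) ^+ 2) =
  (\sum_i p i i) ^+ 2 + \sum_i \sum_j p i j ^+ 2 + \sum_i \sum_j p i j * p j i
  + (mom 4 - 3%:R) * \sum_i p i i ^+ 2.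
Proof.
transitivity (\sum_i \sum_j \sum_k \sum_l p i j * p k l *
   ((i == j)%:R * (k == l)%:R + (i == k)%:R * (j == l)%:R + (i == l)%:R * (j == k)%:R
  + (mom 4 - 3%:R) * ((i == j)%:R * (j == k)%:R * (k == l)%:R))).
  transitivity (dexp (fun=> w) (fun u => \sum_i \sum_j \sum_k \sum_l
     p i j * p k l * ((node (u i) * node (u j)) * (node (u k) * node (u l))))).
    apply: eq_dexp => u; rewrite expr2 mulr_suml; apply: eq_bigr => i _.
    rewrite mulr_suml; apply: eq_bigr => j _.
    rewrite mulr_sumr; apply: eq_bigr => k _.
    rewrite mulr_sumr; apply: eq_bigr => l _; ring.
  do 4 (rewrite dexp_sum; apply: eq_bigr => ? _).
  by rewrite dexpZ dexp_node4.
transitivity (\sum_i \sum_j (p i j * (i == j)%:R * (\sum_k p k k) + p i j ^+ 2 + p i j * p j i +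
   (mom 4 - 3%:R) * (p i j ^+ 2 * (i == j)%:R))).
  apply: eq_bigr => i _; apply: eq_bigr => j _.
  transitivity (\sum_k (p i j * (i == j)%:R * p k k + p i j * p k j * (i == k)%:R
     + p i j * p k i * (j == k)%:R + (mom 4 - 3%:R) * p i j * (i == j)%:R * p k k * (j == k)%:R)).
    apply: eq_bigr => k _.
    rewrite -(sum_delta (fun l => p i j * (i == j)%:R * p k l)).
    rewrite -(sum_delta (fun l => p i j * p k l * (i == k)%:R) j).
    rewrite -(sum_delta (fun l => p i j * p k l * (j == k)%:R) i).
    rewrite -[X in _ = _ + _ + _ + X](sum_delta (fun l =>
      (mom 4 - 3%:R) * p i j * (i == j)%:R * p k l * (j == k)%:R) k).
    by rewrite -!big_split /=; apply: eq_bigr => l _; ring.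
  rewrite !big_split /= -mulr_sumr !sum_delta.
  have -> : (mom 4 - 3%:R) * p i j * (i == j)%:R * p j j =
     (mom 4 - 3%:R) * (p i j ^+ 2 * (i == j)%:R).
    by have [<-|_] := eqVneq i j; rewrite /=; ring.
  by rewrite !expr2.
under eq_bigr => i _.
  rewrite !big_split /= -mulr_suml sum_delta -mulr_sumr sum_delta; over.
by rewrite !big_split /= -mulr_suml -mulr_sumr expr2.
Qed.

End words.

Section model.
Variables (R : idomainType) (A : finType) (w node : A -> R).
Hypotheses (w0 : \sum_a w a = 1) (w1 : \sum_a w a * node a = 0)
  (w2 : \sum_a w a * node a ^+ 2 = 1).
Let m4 := \sum_a w a * node a ^+ 4.
Local Notation EE := (dexp (fun=> w)).

(* One independent variable per unordered pair {i, j}: f assigns a node to each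
   set [set i; j], and its values on the other sets play no role. *)
Definition edge_mx n (x : R) (f : {ffun {set 'I_n} -> A}) : 'M[R]_n :=
  \matrix_(i, j) (node (f [set i; j]) - x *+ (i == j)).

Definition restr n (f : {ffun {set 'I_n.+1} -> A}) : {ffun {set 'I_n} -> A} :=
  [ffun B : {set 'I_n} => f (lift ord0 @: B)].

(** The pairs containing index 0, that is, the variables of the first row: [None] stands for the
    diagonal entry, [Some j] for the edge to [lift ord0 j]. *)
Definition edge0 n (o : option 'I_n) : {set 'I_n.+1} :=
  if o is Some j then [set ord0; lift ord0 j] else [set ord0].

Definition row0 n (f : {ffun {set 'I_n.+1} -> A}) : {ffun option 'I_n -> A} :=
  [ffun o => f (edge0 o)].

Definition border n (x : R) (u : {ffun option 'I_n -> A}) (M : 'M[R]_n) : 'M[R]_(1 + n) :=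
  block_mx (node (u None) - x)%:M (\row_j node (u (Some j)))
   (\col_j node (u (Some j))) M.

Lemma lift_imset2 n (h : 'I_n.+1) (i j : 'I_n) :
  [set lift h i; lift h j] = lift h @: [set i; j].
Proof. by rewrite imsetU1 imset_set1. Qed.

Lemma edge_mx_border n x (f : {ffun {set 'I_n.+1} -> A}) :
  edge_mx x f = border x (row0 f) (edge_mx x (restr f)).
Proof.
have l0 (k : 'I_1) : lshift n k = ord0 :> 'I_n.+1 by apply: ord_inj; rewrite /= ord1.
have r1 (k : 'I_n) : rshift 1 k = lift ord0 k :> 'I_n.+1 by apply: ord_inj.
apply/matrixP => i j; rewrite -[i](@splitK 1 n) -[j](@splitK 1 n).
case: (@fintype.split 1 n i) => {}i; case: (@fintype.split 1 n j) => {}j; rewrite /unsplit /border.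
- by rewrite [RHS]block_mxEul !ord1 !l0 !mxE eqxx ffunE /= finset.setUid mulr1n.
- by rewrite [RHS]block_mxEur l0 r1 !mxE ffunE /= subr0.
- by rewrite [RHS]block_mxEdl l0 r1 !mxE ffunE /= subr0 finset.setUC.
- by rewrite [RHS]block_mxEdr !r1 !mxE ffunE lift_imset2 (inj_eq lift_inj).
Qed.

Lemma ord0_notin_lift n (B : {set 'I_n}) : ord0 \notin lift ord0 @: B.
Proof. by apply/imsetP => -[j _ /eqP]; rewrite eq_liftF. Qed.

Lemma edge0_inj n : injective (@edge0 n).
Proof.
have no (j : 'I_n) : [set ord0; lift ord0 j] != [set ord0].
  apply/eqP/setP => /(_ (lift ord0 j)).
  by rewrite !inE eqxx orbT eq_sym eq_liftF.
move=> [i|] [j|] //= => [|/eqP|/esym/eqP]; rewrite ?(negbTE (no _)) //.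
move/setP/(_ (lift ord0 i)); rewrite !inE eqxx orbT [X in X || _]eq_sym eq_liftF /=.
by move/esym/eqP/lift_inj => ->.
Qed.

Lemma ord0_edge0 n (o : option 'I_n) : ord0 \in edge0 o.
Proof. by case: o => [j|]; rewrite !inE eqxx. Qed.

Lemma lift_imset_inj n (h : 'I_n.+1) :
  injective (fun B : {set 'I_n} => lift h @: B).
Proof. exact: imset_inj lift_inj. Qed.

(** The first row uses sets containing 0 and the remaining block sets avoiding 0, so the two are
    independent. *)
Lemma dexp_split n (F : {ffun {set 'I_n} -> A} -> {ffun option 'I_n -> A} -> R) :
  EE (fun f => F (restr f) (row0 f)) = EE (fun g => EE (F g)).
Proof.
rewrite -(dexp_pull2 (w := fun=> w) F (@lift_imset_inj _ ord0) (@edge0_inj n)) // => B o.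
by apply: contraNneq (ord0_notin_lift B) => ->; exact: ord0_edge0.
Qed.

Lemma det_border n x (u : {ffun option 'I_n -> A}) (M : 'M[R]_n) :
  \det (border x u M) = (node (u None) - x) * \det M -
    \sum_i \sum_j \adj M i j * (node (u (Some i)) * node (u (Some j))).
Proof.
rewrite det_bordered; congr (_ - _); rewrite mxE exchange_big /=.
apply: eq_bigr => j _; rewrite !mxE mulr_suml; apply: eq_bigr => i _.
by rewrite !mxE; ring.
Qed.

(** The adjugate padded by zeros at [None], so that the quadratic form of the border lives on the
    index type of the row variables and the moment formulas above apply to it. *)
Let padj n (M : 'M[R]_n) (o o' : option 'I_n) : R :=
  if o is Some i then if o' is Some j then \adj M i j else 0 else 0.

Let sum_opt n (F : option 'I_n -> R) : \sum_o F o = F None + \sum_i F (Some i).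
Proof.
rewrite (bigD1 None) //=; congr (_ + _).
rewrite (reindex_omap Some id) => [|[]] //=.
by apply: eq_bigl => i; rewrite eqxx.
Qed.

Let quad_opt n (M : 'M[R]_n) (G : R -> R) (u : option 'I_n -> option 'I_n -> R) : G 0 = 0 ->
  \sum_o \sum_o' G (padj M o o') * u o o' =
  \sum_i \sum_j G (\adj M i j) * u (Some i) (Some j).
Proof.
move=> G0; rewrite sum_opt big1 ?add0r => [|o _]; last by rewrite /= G0 mul0r.
by apply: eq_bigr => i _; rewrite sum_opt /= G0 mul0r add0r.
Qed.

Lemma dexp_det_border n x (M : 'M[R]_n) :
  EE (fun u => \det (border x u M)) = - x * \det M - \tr (\adj M).
Proof.
transitivity (EE (fun u : {ffun option 'I_n -> A} => \det M * node (u None) -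
   x * \det M - \sum_o \sum_o' padj M o o' * (node (u o) * node (u o')))).
  by apply: eq_dexp => u; rewrite det_border (quad_opt M (G := id)) //; ring.
rewrite !dexpB dexpZ dexp_node1 // mulr0 sub0r dexp_cst // dexp_quad //.
by rewrite sum_opt /= add0r mulNr.
Qed.

Lemma dexp_det_border_sq n x (M : 'M[R]_n) :
  EE (fun u => \det (border x u M) ^+ 2) =
  (x ^+ 2 + 1) * \det M ^+ 2 + 2%:R * x * (\det M * \tr (\adj M)) +
  (\tr (\adj M)) ^+ 2 + \sum_i \sum_j \adj M i j ^+ 2 +
  \sum_i \sum_j \adj M i j * \adj M j i +
  (m4 - 3%:R) * \sum_i \adj M i i ^+ 2.
Proof.
pose S (u : {ffun option 'I_n -> A}) :=
  \sum_o \sum_o' padj M o o' * (node (u o) * node (u o')).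
transitivity (EE (fun u : {ffun option 'I_n -> A} => \det M ^+ 2 * (node (u None) * node (u None))
  - (2%:R * x * \det M ^+ 2 * node (u None)) - 2%:R * \det M * (node (u None) * S u)
  + x ^+ 2 * \det M ^+ 2 + 2%:R * x * \det M * S u + S u ^+ 2)).
  by apply: eq_dexp => u; rewrite det_border /S (quad_opt M (G := id)) //; ring.
rewrite !dexpD !dexpN !dexpZ dexp_node1 // dexp_node2 // eqxx dexp_cst //.
(* The diagonal variable occurs exactly once in each word, so its cross term with the quadratic form
   has mean 0. *)
have -> : EE (fun u => node (u None) * S u) = 0.
  transitivity (EE (fun u : {ffun option 'I_n -> A} => \sum_i \sum_j \adj M i j *
      (node (u None) * (node (u (Some i)) * node (u (Some j)))))).
    apply: eq_dexp => u; rewrite /S (quad_opt M (G := id)) // mulr_sumr.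
    by apply: eq_bigr => i _; rewrite mulr_sumr; apply: eq_bigr => j _; ring.
  rewrite dexp_sum big1 // => i _; rewrite dexp_sum big1 // => j _; rewrite dexpZ.
  have -> : EE (fun u : {ffun option 'I_n -> A} => node (u None) * (node (u (Some i)) * node (u (Some j)))) =
    EE (fun u => \prod_(o <- [:: None; Some i; Some j]) node (u o)).
    by apply: eq_dexp => u; rewrite !big_cons big_nil mulr1.
  by rewrite (dexp_word_single w1 (i := None)) ?mulr0.
rewrite /S dexp_quad // dexp_quad_sq //.
have E1 : \sum_o \sum_o' padj M o o' ^+ 2 = \sum_i \sum_j \adj M i j ^+ 2.
  rewrite sum_opt big1 ?add0r => [|o _]; last by rewrite expr0n.
  by apply: eq_bigr => i _; rewrite sum_opt /= expr0n add0r.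
have E2 : \sum_o \sum_o' padj M o o' * padj M o' o = \sum_i \sum_j \adj M i j * \adj M j i.
  rewrite sum_opt big1 ?add0r => [|o _]; last by rewrite mul0r.
  by apply: eq_bigr => i _; rewrite sum_opt /= mul0r add0r.
rewrite E1 E2 (sum_opt (fun o => padj M o o)) (sum_opt (fun o => padj M o o ^+ 2)) /=.
rewrite /mxtrace -/m4; ring.
Qed.

End model.

(** * Recursions for the first two determinant moments *)

Section recursion.
Variables (R : idomainType) (A : finType) (w node : A -> R).
Hypotheses (w0 : \sum_a w a = 1) (w1 : \sum_a w a * node a = 0)
  (w2 : \sum_a w a * node a ^+ 2 = 1).
Let m4 := \sum_a w a * node a ^+ 4.
Variable x : R.
Local Notation EE := (dexp (fun=> w)).
Local Notation emx := (edge_mx node x).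
Local Notation bmx := (border node x).

Lemma edge_mx_pull m n (h : 'I_m -> 'I_n) (f : {ffun {set 'I_n} -> A}) : injective h ->
  emx [ffun B : {set 'I_m} => f (h @: B)] = \matrix_(i, j) emx f (h i) (h j).
Proof.
move=> hI; apply/matrixP => i j; rewrite !mxE ffunE (inj_eq hI).
by rewrite imsetU1 imset_set1.
Qed.

(** Exchangeability: relabelling the indices permutes identically weighted edge variables. A mean
    involving one index, or two distinct ones, is therefore independent of the choice, which is why
    finitely many sequences close the recursion. *)
Lemma dexp_edge_mx_perm n (t : 'S_n) (F : 'M[R]_n -> R) :
  EE (fun f : {ffun {set 'I_n} -> A} => F (emx f)) =
  EE (fun f : {ffun {set 'I_n} -> A} => F (\matrix_(i, j) emx f (t i) (t j))).
Proof.
have tI : injective (fun B : {set 'I_n} => t @: B) by apply: imset_inj; exact: perm_inj.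
rewrite -(dexp_pull (w := fun=> w) (fun f => F (emx f)) tI) //.
by apply: eq_dexp => f; rewrite edge_mx_pull //; exact: perm_inj.
Qed.

Lemma adj_edge_mx_sym n (f : {ffun {set 'I_n} -> A}) i j : \adj (emx f) i j = \adj (emx f) j i.
Proof.
have e : (emx f)^T = emx f by apply/matrixP => k l; rewrite !mxE finset.setUC eq_sym.
by rewrite -{1}e -trmx_adj [LHS]mxE.
Qed.

Lemma adj_perm n (M : 'M[R]_n) (t : 'S_n) i j :
  \adj (\matrix_(k, l) M (t k) (t l)) i j = \adj M (t i) (t j).
Proof. by rewrite !mxE cofactor_perm. Qed.

Lemma det_conj_perm n (M : 'M[R]_n) (t : 'S_n) :
  \det (\matrix_(k, l) M (t k) (t l)) = \det M.
Proof.
have -> : \matrix_(k, l) M (t k) (t l) = row_perm t (col_perm t M).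
  by apply/matrixP => k l; rewrite !mxE.
by rewrite row_permE col_permE !det_mulmx !det_perm odd_permV mulrCA -signr_addb addbb mulr1.
Qed.

Definition mean_det n := EE (fun f : {ffun {set 'I_n} -> A} => \det (emx f)).
Definition mean_det_sqr n := EE (fun f : {ffun {set 'I_n} -> A} => \det (emx f) ^+ 2).
(* The values 0 at small n are harmless: the recursions multiply them by n or
   n (n - 1). *)
Definition mean_det_minor n := if n is n'.+1 then
  EE (fun f : {ffun {set 'I_n'.+1} -> A} => \det (emx f) * \adj (emx f) ord0 ord0) else 0.
Definition mean_minor_minor n := if n is n'.+2 then
  EE (fun f : {ffun {set 'I_n'.+2} -> A} =>
    \adj (emx f) ord0 ord0 * \adj (emx f) (lift ord0 ord0) (lift ord0 ord0)) else 0.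
Definition mean_offdiag_sqr n := if n is n'.+2 then
  EE (fun f : {ffun {set 'I_n'.+2} -> A} => \adj (emx f) (lift ord0 ord0) ord0 ^+ 2) else 0.

Lemma adj00 n (f : {ffun {set 'I_n.+1} -> A}) : \adj (emx f) ord0 ord0 = \det (emx (restr f)).
Proof.
rewrite mxE /cofactor addn0 mul1r; congr (\det _).
by rewrite edge_mx_pull; [apply/matrixP => i j; rewrite !mxE | exact: lift_inj].
Qed.

Lemma dexp_adj n i : EE (fun f : {ffun {set 'I_n} -> A} => \adj (emx f) i i) = mean_det n.-1.
Proof.
case: n i => [[]//|n] i.
rewrite (dexp_edge_mx_perm (tperm ord0 i) (fun M => \adj M i i)).
transitivity (EE (fun f : {ffun {set 'I_n.+1} -> A} => \det (emx (restr f)))).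
  by apply: eq_dexp => f; rewrite adj_perm tpermR adj00.
exact: (dexp_pull (w := fun=> w) (fun g => \det (emx g)) (@lift_imset_inj _ ord0)).
Qed.

Lemma dexp_adj_sq n i : EE (fun f : {ffun {set 'I_n} -> A} => \adj (emx f) i i ^+ 2) = mean_det_sqr n.-1.
Proof.
case: n i => [[]//|n] i.
rewrite (dexp_edge_mx_perm (tperm ord0 i) (fun M => \adj M i i ^+ 2)).
transitivity (EE (fun f : {ffun {set 'I_n.+1} -> A} => \det (emx (restr f)) ^+ 2)).
  by apply: eq_dexp => f; rewrite adj_perm tpermR adj00.
exact: (dexp_pull (w := fun=> w) (fun g => \det (emx g) ^+ 2) (@lift_imset_inj _ ord0)).
Qed.

Lemma dexp_det_adj n i :
  EE (fun f : {ffun {set 'I_n} -> A} => \det (emx f) * \adj (emx f) i i) = mean_det_minor n.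
Proof.
case: n i => [[]//|n] i.
rewrite (dexp_edge_mx_perm (tperm ord0 i) (fun M => \det M * \adj M i i)).
by apply: eq_dexp => f; rewrite adj_perm tpermR det_conj_perm.
Qed.

Lemma perm2 n (i j : 'I_n.+2) : i != j ->
  exists t : 'S_n.+2, t i = ord0 /\ t j = lift ord0 ord0.
Proof.
move=> ij; pose k := tperm i ord0 j.
have k0 : k != ord0 by rewrite -(tpermL i ord0) (inj_eq perm_inj) eq_sym.
exists (tperm i ord0 * tperm k (lift ord0 ord0))%g; rewrite !permM tpermL tpermL.
by split=> //; rewrite tpermD.
Qed.

Lemma dexp_adj_adj n i j : i != j ->
  EE (fun f : {ffun {set 'I_n} -> A} => \adj (emx f) i i * \adj (emx f) j j) = mean_minor_minor n.
Proof.
case: n i j => [[]//|[|n]] i j; first by rewrite !ord1.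
move=> /perm2[t [ti tj]].
rewrite (dexp_edge_mx_perm t (fun M => \adj M i i * \adj M j j)).
by apply: eq_dexp => f; rewrite !adj_perm ti tj.
Qed.

Lemma dexp_adj_off n i j : i != j ->
  EE (fun f : {ffun {set 'I_n} -> A} => \adj (emx f) i j ^+ 2) = mean_offdiag_sqr n.
Proof.
case: n i j => [[]//|[|n]] i j; first by rewrite !ord1.
move=> /perm2[t [ti tj]].
rewrite (dexp_edge_mx_perm t (fun M => \adj M i j ^+ 2)).
by apply: eq_dexp => f; rewrite !adj_perm ti tj adj_edge_mx_sym.
Qed.

Lemma sum_offdiag n (F : 'I_n -> 'I_n -> R) a b :
  (forall i, F i i = a) -> (forall i j, i != j -> F i j = b) ->
  \sum_i \sum_j F i j = n%:R * a + n%:R * (n.-1)%:R * b.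
Proof.
move=> Fa Fb; rewrite (eq_bigr (fun=> a + (n.-1)%:R * b)) => [|i _]; last first.
  rewrite (bigD1 i) //= Fa; congr (_ + _).
  rewrite (eq_bigr (fun=> b)) => [|j]; last by rewrite eq_sym; exact: Fb.
  by rewrite sumr_const cardC1 card_ord mulr_natl.
by rewrite sumr_const card_ord -[LHS]mulr_natl mulrDr mulrA.
Qed.

Lemma dexp_tr n : EE (fun f : {ffun {set 'I_n} -> A} => \tr (\adj (emx f))) = n%:R * mean_det n.-1.
Proof.
rewrite dexp_sum (eq_bigr (fun=> mean_det n.-1)) => [|i _]; last exact: dexp_adj.
by rewrite sumr_const card_ord mulr_natl.
Qed.

Lemma dexp_sum_adj_sq n :
  EE (fun f : {ffun {set 'I_n} -> A} => \sum_i \adj (emx f) i i ^+ 2) = n%:R * mean_det_sqr n.-1.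
Proof.
rewrite dexp_sum (eq_bigr (fun=> mean_det_sqr n.-1)) => [|i _]; last exact: dexp_adj_sq.
by rewrite sumr_const card_ord mulr_natl.
Qed.

Lemma dexp_det_tr n : EE (fun f : {ffun {set 'I_n} -> A} =>
  \det (emx f) * \tr (\adj (emx f))) = n%:R * mean_det_minor n.
Proof.
transitivity (EE (fun f : {ffun {set 'I_n} -> A} => \sum_i \det (emx f) * \adj (emx f) i i)).
  by apply: eq_dexp => f; rewrite mulr_sumr.
rewrite dexp_sum (eq_bigr (fun=> mean_det_minor n)) => [|i _]; last exact: dexp_det_adj.
by rewrite sumr_const card_ord mulr_natl.
Qed.

Lemma dexp_tr_sq n : EE (fun f : {ffun {set 'I_n} -> A} => \tr (\adj (emx f)) ^+ 2) =
  n%:R * mean_det_sqr n.-1 + n%:R * (n.-1)%:R * mean_minor_minor n.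
Proof.
transitivity (\sum_i \sum_j EE (fun f : {ffun {set 'I_n} -> A} =>
   \adj (emx f) i i * \adj (emx f) j j)).
  under [RHS]eq_bigr do rewrite -dexp_sum.
  rewrite -dexp_sum; apply: eq_dexp => f; rewrite expr2 mulr_suml.
  by apply: eq_bigr => i _; rewrite mulr_sumr.
apply: sum_offdiag => [i|i j ij]; last exact: dexp_adj_adj.
by rewrite -(dexp_adj_sq i); apply: eq_dexp => f; rewrite expr2.
Qed.

Lemma dexp_adj_frob n : EE (fun f : {ffun {set 'I_n} -> A} => \sum_i \sum_j \adj (emx f) i j ^+ 2) =
  n%:R * mean_det_sqr n.-1 + n%:R * (n.-1)%:R * mean_offdiag_sqr n.
Proof.
rewrite dexp_sum; under eq_bigr do rewrite dexp_sum.
by apply: sum_offdiag => [i|i j ij]; [exact: dexp_adj_sq|exact: dexp_adj_off].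
Qed.

Lemma mean_det_rec n : mean_det n.+1 = - x * mean_det n - n%:R * mean_det n.-1.
Proof.
transitivity (EE (fun f : {ffun {set 'I_n.+1} -> A} => \det (bmx (row0 f) (emx (restr f))))).
  by apply: eq_dexp => f; rewrite -edge_mx_border.
rewrite (dexp_split w0 (fun g u => \det (bmx u (emx g)))).
under eq_dexp do rewrite dexp_det_border //.
by rewrite dexpB dexpZ dexp_tr.
Qed.

(** The minor without index 0 does not involve the first row, so the determinant may be replaced by
    its mean given the minor, [- x * det - tr adj]. *)
Lemma mean_det_minor_rec n : mean_det_minor n.+1 = - x * mean_det_sqr n - n%:R * mean_det_minor n.
Proof.
transitivity (EE (fun f : {ffun {set 'I_n.+1} -> A} =>
   \det (emx (restr f)) * \det (bmx (row0 f) (emx (restr f))))).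
  by apply: eq_dexp => f; rewrite adj00 -edge_mx_border mulrC.
rewrite (dexp_split w0 (fun g u => \det (emx g) * \det (bmx u (emx g)))).
transitivity (EE (fun g : {ffun {set 'I_n} -> A} => - x * \det (emx g) ^+ 2 -
   \det (emx g) * \tr (\adj (emx g)))).
  by apply: eq_dexp => g; rewrite dexpZ dexp_det_border //; ring.
by rewrite dexpB dexpZ dexp_det_tr.
Qed.

(** Symmetry of the adjugate merges the two double sums. Its diagonal squares come once from the
    squared trace, twice from the merged sum and [m4 - 3] times from the cumulant, hence the total
    coefficient [m4]. *)
Lemma mean_det_sqr_rec n : mean_det_sqr n.+1 = (x ^+ 2 + 1) * mean_det_sqr n + 2%:R * x * (n%:R * mean_det_minor n) +
  m4 * n%:R * mean_det_sqr n.-1 + n%:R * (n.-1)%:R * (mean_minor_minor n + 2%:R * mean_offdiag_sqr n).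
Proof.
transitivity (EE (fun f : {ffun {set 'I_n.+1} -> A} =>
   \det (bmx (row0 f) (emx (restr f))) ^+ 2)).
  by apply: eq_dexp => f; rewrite -edge_mx_border.
rewrite (dexp_split w0 (fun g u => \det (bmx u (emx g)) ^+ 2)).
under eq_dexp do rewrite dexp_det_border_sq //.
transitivity (EE (fun g : {ffun {set 'I_n} -> A} =>
  (x ^+ 2 + 1) * \det (emx g) ^+ 2 + 2%:R * x * (\det (emx g) * \tr (\adj (emx g))) +
  (\tr (\adj (emx g))) ^+ 2 + 2%:R * (\sum_i \sum_j \adj (emx g) i j ^+ 2) +
  (m4 - 3%:R) * \sum_i \adj (emx g) i i ^+ 2)).
  apply: eq_dexp => g.
  have -> : \sum_i \sum_j \adj (emx g) i j * \adj (emx g) j i =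
     \sum_i \sum_j \adj (emx g) i j ^+ 2.
    by apply: eq_bigr => i _; apply: eq_bigr => j _; rewrite (adj_edge_mx_sym g j i) expr2.
  rewrite -/m4; ring.
rewrite !dexpD !dexpZ dexp_det_tr dexp_tr_sq dexp_adj_frob dexp_sum_adj_sq -/(mean_det_sqr n).
ring.
Qed.

(** Variables of the first row that remain when index 1 is skipped, with [h] in the corner: the
    diagonal [None] for the principal minor without 1, the edge [Some ord0] between 0 and 1 for the
    minor without row 0 and column 1. *)
Let kap n (h : option 'I_n.+1) (o : option 'I_n) : option 'I_n.+1 :=
  if o is Some j then Some (lift ord0 j) else h.

Let kap_inj n h : h = None \/ h = Some ord0 -> injective (@kap n h).
Proof.
move=> hh [i|] [j|] //=; first by move=> /Some_inj/lift_inj ->.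
  by case: hh => ->// [] /eqP; rewrite eq_sym eq_liftF.
by case: hh => ->// [] /eqP; rewrite eq_liftF.
Qed.

Lemma adj11 n (f : {ffun {set 'I_n.+2} -> A}) :
  \adj (emx f) (lift ord0 ord0) (lift ord0 ord0) =
  \det (bmx [ffun o => row0 f (kap None o)] (emx (restr (restr f)))).
Proof.
pose l : 'I_n.+2 := lift ord0 ord0.
have lE j : lift l (lift ord0 j) = lift ord0 (lift ord0 j) by exact: ord_inj.
have lE0 : lift l ord0 = ord0 by exact: ord_inj.
rewrite mxE /cofactor -signr_odd addnn odd_double mul1r.
have -> : row' l (col' l (emx f)) = emx [ffun B : {set 'I_n.+1} => f (lift l @: B)].
  by rewrite edge_mx_pull; [apply/matrixP => i j; rewrite !mxE | exact: lift_inj].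
rewrite edge_mx_border; congr (\det (border _ _ _ _)).
  apply/ffunP => -[j|]; rewrite !ffunE /=; congr (f _).
    by rewrite imsetU1 imset_set1 lE lE0.
  by rewrite imset_set1 lE0.
congr edge_mx; apply/ffunP => B; rewrite !ffunE; congr (f _).
by rewrite -!imset_comp; apply: eq_imset => j /=; rewrite lE.
Qed.

(** Given the block of indices at least 2, the two minors are independent: one borders it with row
    1, the other with row 0, and the entry (0,1) occurs in neither. The mean is therefore that of
    the square of [- x * det - tr adj] of this block. *)
Lemma mean_minor_minor_rec n : mean_minor_minor n.+2 = x ^+ 2 * mean_det_sqr n + 2%:R * x * (n%:R * mean_det_minor n) +
  n%:R * mean_det_sqr n.-1 + n%:R * (n.-1)%:R * mean_minor_minor n.
Proof.
transitivity (EE (fun f : {ffun {set 'I_n.+2} -> A} =>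
   \det (emx (restr f)) * \det (bmx [ffun o => row0 f (kap None o)] (emx (restr (restr f)))))).
  by apply: eq_dexp => f; rewrite adj11 adj00.
rewrite (dexp_split w0 (fun g u => \det (emx g) *
  \det (bmx [ffun o => u (kap None o)] (emx (restr g))))).
transitivity (EE (fun g : {ffun {set 'I_n.+1} -> A} =>
   (- x * \det (emx (restr g)) - \tr (\adj (emx (restr g)))) *
   \det (bmx (row0 g) (emx (restr g))))).
  apply: eq_dexp => g; rewrite dexpZ mulrC -edge_mx_border; congr (_ * _).
  rewrite (dexp_pull (w := fun=> w) (fun u => \det (bmx u (emx (restr g)))) (kap_inj _)) //.
    by rewrite dexp_det_border.
  by left.
rewrite (dexp_split w0 (fun g u => (- x * \det (emx g) - \tr (\adj (emx g))) *
   \det (bmx u (emx g)))).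
transitivity (EE (fun g : {ffun {set 'I_n} -> A} => x ^+ 2 * \det (emx g) ^+ 2 +
   2%:R * x * (\det (emx g) * \tr (\adj (emx g))) + (\tr (\adj (emx g))) ^+ 2)).
  by apply: eq_dexp => g; rewrite dexpZ dexp_det_border //; ring.
rewrite !dexpD !dexpZ dexp_det_tr dexp_tr_sq; rewrite /mean_det_sqr; ring.
Qed.

Lemma adj10 n (f : {ffun {set 'I_n.+2} -> A}) :
  let u := [ffun o => row0 f (kap (Some ord0) o)] in
  let B := \adj (emx (restr (restr f))) in
  \adj (emx f) (lift ord0 ord0) ord0 ^+ 2 =
  (\det (emx (restr (restr f))) * node (u None) -
   \sum_j (\sum_i node (row0 (restr f) (Some i)) * B i j) * node (u (Some j))) ^+ 2.
Proof.
move=> u B; pose l : 'I_n.+2 := lift ord0 ord0.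
have lE j : lift l (lift ord0 j) = lift ord0 (lift ord0 j) by exact: ord_inj.
have lE0 : lift l ord0 = ord0 by exact: ord_inj.
rewrite mxE /cofactor exprMn sqrr_sign mul1r.
have -> : row' ord0 (col' l (emx f)) = block_mx (node (u None))%:M
    (\row_j node (row0 (restr f) (Some j))) (\col_j node (u (Some j)))
    (emx (restr (restr f))).
  have l0 (k : 'I_1) : lshift n k = ord0 :> 'I_n.+1 by apply: ord_inj; rewrite /= ord1.
  have r1 (k : 'I_n) : rshift 1 k = lift ord0 k :> 'I_n.+1 by apply: ord_inj.
  have ll : [set l] = lift ord0 @: [set ord0] by rewrite imset_set1.
  apply/matrixP => i j; rewrite -[i](@splitK 1 n) -[j](@splitK 1 n).
  case: (@fintype.split 1 n i) => {}i; case: (@fintype.split 1 n j) => {}j; rewrite /unsplit.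
  - rewrite [RHS]block_mxEul !ord1 !l0 !mxE lE0 !ffunE /= mulr1n finset.setUC.
    by rewrite subr0.
  - rewrite [RHS]block_mxEur l0 r1 !mxE !ffunE /= lE lift_imset2.
    by rewrite mulr0n subr0.
  - by rewrite [RHS]block_mxEdl l0 r1 !mxE !ffunE /= lE0 subr0 finset.setUC.
  - rewrite [RHS]block_mxEdr !r1 !mxE !ffunE lE.
    by rewrite !(inj_eq lift_inj) !lift_imset2.
rewrite det_bordered; congr ((_ - _) ^+ 2); first by rewrite mulrC.
rewrite mxE; apply: eq_bigr => j _; rewrite !mxE; congr (_ * _).
by apply: eq_bigr => i _; rewrite !mxE.
Qed.

(** This minor is the block [M] of indices at least 2 bordered by two independent rows, with the
    edge between 0 and 1 in the corner. Averaging squares of linear forms, over row 0 and then over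
    row 1, leaves [det M ^+ 2] plus the squared Frobenius norm of [\adj M]. *)
Lemma mean_offdiag_sqr_rec n : mean_offdiag_sqr n.+2 = mean_det_sqr n + n%:R * mean_det_sqr n.-1 + n%:R * (n.-1)%:R * mean_offdiag_sqr n.
Proof.
pose T (u : {ffun option 'I_n -> A}) (v : {ffun option 'I_n -> A}) (M : 'M[R]_n) :=
  (\det M * node (u None) -
   \sum_j (\sum_i node (v (Some i)) * \adj M i j) * node (u (Some j))) ^+ 2.
have sum_opt (F : option 'I_n -> R) : \sum_o F o = F None + \sum_i F (Some i).
  rewrite (bigD1 None) //=; congr (_ + _).
  rewrite (reindex_omap Some id) => [|[]] //=.
  by apply: eq_bigl => i; rewrite eqxx.
transitivity (EE (fun f : {ffun {set 'I_n.+2} -> A} =>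
   T [ffun o => row0 f (kap (Some ord0) o)] (row0 (restr f)) (emx (restr (restr f))))).
  by apply: eq_dexp => f; rewrite adj10.
rewrite (dexp_split w0 (fun g u => T [ffun o => u (kap (Some ord0) o)] (row0 g) (emx (restr g)))).
transitivity (EE (fun g : {ffun {set 'I_n.+1} -> A} => \det (emx (restr g)) ^+ 2 +
    \sum_j (\sum_i node (row0 g (Some i)) * \adj (emx (restr g)) i j) ^+ 2)).
  apply: eq_dexp => g.
  rewrite (dexp_pull (w := fun=> w) (fun u => T u (row0 g) (emx (restr g))) (kap_inj _)) //.
    pose c (o : option 'I_n) := if o is Some j then
       - (\sum_i node (row0 g (Some i)) * \adj (emx (restr g)) i j) else \det (emx (restr g)).
    transitivity (EE (fun u : {ffun option 'I_n -> A} => (\sum_o c o * node (u o)) ^+ 2)).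
      apply: eq_dexp => u; rewrite sum_opt /T /= -sumrN; congr ((_ + _) ^+ 2).
      by apply: eq_bigr => j _; rewrite mulNr.
    rewrite dexp_linear_sq // sum_opt /=; congr (_ + _).
    by apply: eq_bigr => j _; rewrite sqrrN.
  by right.
rewrite (dexp_split w0 (fun g u => \det (emx g) ^+ 2 +
    \sum_j (\sum_i node (u (Some i)) * \adj (emx g) i j) ^+ 2)).
transitivity (EE (fun g : {ffun {set 'I_n} -> A} => \det (emx g) ^+ 2 +
    \sum_j \sum_i \adj (emx g) i j ^+ 2)).
  apply: eq_dexp => g; rewrite dexpD dexp_cst //; congr (_ + _).
  rewrite dexp_sum; apply: eq_bigr => j _.
  pose c (o : option 'I_n) := if o is Some i then \adj (emx g) i j else 0.
  transitivity (EE (fun u : {ffun option 'I_n -> A} => (\sum_o c o * node (u o)) ^+ 2)).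
    apply: eq_dexp => u; rewrite sum_opt /= mul0r add0r; congr (_ ^+ 2).
    by apply: eq_bigr => i _; rewrite mulrC.
  by rewrite dexp_linear_sq // sum_opt /= expr0n add0r.
rewrite dexpD -addrA -dexp_adj_frob; congr (_ + _).
by apply: eq_dexp => g; rewrite exchange_big.
Qed.

End recursion.

(** * Mean determinant when the (0,0) entry carries another weight *)

Section marked.
Variables (R : idomainType) (A : finType) (w node : A -> R).
Hypotheses (w0 : \sum_a w a = 1) (w1 : \sum_a w a * node a = 0)
  (w2 : \sum_a w a * node a ^+ 2 = 1).
Variables (x : R) (w' : A -> R).
Let gamma := \sum_a w' a.
Let kappa := \sum_a w' a * node a.

Lemma dexp_affine (I : finType) (i : I) (a b : R) : #|I| = 1%N ->
  dexp (fun=> w') (fun g : {ffun I -> A} => node (g i) * a + b) = kappa * a + gamma * b.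
Proof.
move=> I1; have Ii j : j = i.
  by have /card_le1_eqP H : (#|I| <= 1)%N; [rewrite I1 | apply: H].
have prod1 (F : I -> R) : \prod_j F j = F i.
  by rewrite (bigD1 i) //= big1 ?mulr1 // => j; rewrite (Ii j) eqxx.
rewrite dexpD; congr (_ + _).
  transitivity (dexp (fun=> w') (fun g : {ffun I -> A} => a * \prod_j node (g j))).
    by apply: eq_dexp => g; rewrite prod1 mulrC.
  by rewrite dexpZ (dexp_prod (fun=> w') (fun _ a => node a)) prod1 mulrC.
transitivity (dexp (fun=> w') (fun g : {ffun I -> A} => b * \prod_(j : I) 1)).
  by apply: eq_dexp => g; rewrite big1 ?mulr1.
rewrite dexpZ (dexp_prod (fun=> w') (fun _ a => 1)) prod1 mulrC; congr (_ * _).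
by apply: eq_bigr => j _; rewrite mulr1.
Qed.

Lemma dexp_det_border_marked n (M : 'M[R]_n) :
  dexp (fun o => if o is None then w' else w)
    (fun u : {ffun option 'I_n -> A} => \det (border node x u M)) =
  kappa * \det M + gamma * (- x * \det M - \tr (\adj M)).
Proof.
pose F (g : {ffun unit -> A}) (h : {ffun 'I_n -> A}) := (node (g tt) - x) * \det M -
  \sum_i \sum_j \adj M i j * (node (h i) * node (h j)).
transitivity (dexp (fun o => if o is None then w' else w)
  (fun u : {ffun option 'I_n -> A} => F [ffun i => u None] [ffun i => u (Some i)])).
  apply: eq_dexp => u; rewrite det_border /F ffunE; congr (_ - _).
  by apply: eq_bigr => i _; apply: eq_bigr => j _; rewrite !ffunE.
rewrite (dexp_pull2 (phi := fun _ : unit => None) (psi := Some)) //; first last.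
- case=> [i _|]; first by rewrite codom_f.
  by move/negP; case; apply/codomP; exists tt.
- by case; case.
rewrite -(dexp_affine tt) ?card_unit //; apply: eq_dexp => g.
rewrite /F dexpB dexp_cst // dexp_quad // /mxtrace; ring.
Qed.

(** The determinant is affine in the (0,0) entry, with slope the minor, so a signed weight on that
    entry acts only through its mass [gamma] and first moment [kappa]. The weight used later encodes
    the sign of the entry, and [kappa] is then a mean absolute value. *)
Lemma dexp_marked n :
  dexp (fun B => if B == [set ord0] then w' else w)
    (fun f : {ffun {set 'I_n.+1} -> A} => \det (edge_mx node x f)) =
  kappa * mean_det w node x n + gamma * mean_det w node x n.+1.
Proof.
pose W (B : {set 'I_n.+1}) := if B == [set ord0] then w' else w.
transitivity (dexp W (fun f : {ffun {set 'I_n.+1} -> A} =>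
    \det (border node x [ffun o => f (edge0 o)] (edge_mx node x [ffun B : {set 'I_n} => f (lift ord0 @: B)])))).
  by apply: eq_dexp => f; rewrite -edge_mx_border.
rewrite (dexp_pull2 (w := W) (fun g u => \det (border node x u (edge_mx node x g)))
  (@lift_imset_inj _ ord0) (@edge0_inj n)); first last.
- move=> k _ kn; rewrite /W ifN //.
  by apply: contraNneq kn => ->; apply/codomP; exists None.
- move=> B o; by apply: contraNneq (ord0_notin_lift B) => ->; exact: ord0_edge0.
rewrite mean_det_rec // -(dexp_tr node w0 x) /mean_det -!dexpZ -dexpB -!dexpZ -dexpD.
rewrite (@eq_dexpw _ _ _ _ (fun=> w)) => [|B a]; last first.
  rewrite /W ifN //; apply/eqP => e.
  by have := ord0_notin_lift B; rewrite e inE eqxx.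
apply: eq_dexp => g; rewrite -dexp_det_border_marked.
apply: eq_dexpw => -[j|] a; rewrite /W ?eqxx //=.
rewrite ifN //; apply/eqP/setP => /(_ (lift ord0 j)).
by rewrite !inE eqxx orbT eq_sym eq_liftF.
Qed.

End marked.

Local Open Scope classical_set_scope.
Local Open Scope ring_scope.

(** * Generating functions *)

Section power_series.
Variable R : realType.
Implicit Types (c : R^nat) (t : R).

(** Radius of convergence at least 1, in a form without limits that a recursion on coefficients can
    propagate term by term. *)
Definition subgeometric c := forall rho : R, 0 < rho -> rho < 1 ->
  exists K, forall n, `|c n| * rho ^+ n <= K.

(** Multiplication of the generating function by its variable. *)
Definition shift_seq c : R^nat := fun n => if n is n'.+1 then c n' else 0.

Definition psum c t : R := limn (pseries c t).

Lemma subgeometric_cvg c t : subgeometric c -> `|t| < 1 -> cvgn (pseries c t).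
Proof.
move=> sc t1.
have [r /andP[tr r1]] : exists r : R, `|t| < r < 1.
  by exists ((`|t| + 1) / 2); lra.
have r0 : 0 < r by apply: le_lt_trans tr; exact: normr_ge0.
have [K HK] := sc r r0 r1.
apply: normed_cvg.
apply: (@series_le_cvg _ _ (fun n => K * (`|t| / r) ^+ n)) => [n|n|n|].
- exact: normr_ge0.
- have K0 : 0 <= K by apply: le_trans (HK 0%N); rewrite mulr_ge0.
  by rewrite mulr_ge0 // exprn_ge0 // divr_ge0 // ltW.
- rewrite /= normrM normrX expr_div_n mulrA ler_pdivlMr ?exprn_gt0 //.
  by rewrite mulrAC ler_wpM2r ?exprn_ge0.
- apply: is_cvg_geometric_series.
  by rewrite ger0_norm ?divr_ge0 ?(ltW r0) // ltr_pdivrMr // mul1r.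
Qed.

Lemma bernoulli_ineq (d : R) n : 0 <= d -> 1 + n%:R * d <= (1 + d) ^+ n.
Proof.
move=> d0; elim: n => [|n IH]; first by rewrite mul0r addr0 expr0.
rewrite exprS; apply: (@le_trans _ _ ((1 + d) * (1 + n%:R * d))); last first.
  by rewrite ler_wpM2l // addr_ge0.
have : 0 <= n%:R * (d * d) by rewrite mulr_ge0 // mulr_ge0.
rewrite -natr1; nra.
Qed.

Lemma subgeometric_diffs c : subgeometric c -> subgeometric (pseries_diffs c).
Proof.
move=> sc rho rho0 rho1.
pose r := (rho + 1) / 2.
have r0 : 0 < r by rewrite /r; lra.
have r1 : r < 1 by rewrite /r; lra.
have [K HK] := sc r r0 r1.
pose d := r / rho - 1.
have d0 : 0 < d by rewrite /d subr_gt0 ltr_pdivlMr // mul1r /r; lra.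
exists (K / r * (1 + d^-1)) => n.
have K0 : 0 <= K by apply: le_trans (HK 0%N); rewrite mulr_ge0.
have e : rho * (1 + d) = r by rewrite /d addrC subrK mulrC divfK ?gt_eqF.
(* The factor [n + 1] brought by differentiation is absorbed by the larger radius
   [r = rho * (1 + d)], through Bernoulli's inequality. *)
have B : n.+1%:R <= (1 + d^-1) * (1 + d) ^+ n.
  have := bernoulli_ineq n (ltW d0) => B.
  apply: (@le_trans _ _ ((1 + d^-1) * (1 + n%:R * d))); last first.
    by rewrite ler_wpM2l // addr_ge0 // invr_ge0 ltW.
  have -> : (1 + d^-1) * (1 + n%:R * d) = 1 + n%:R * d + d^-1 + n%:R.
    by field; rewrite gt_eqF.
  rewrite -nat1r.
  have : 0 <= n%:R * d by rewrite mulr_ge0 // ltW.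
  have : 0 <= d^-1 by rewrite invr_ge0 ltW.
  lra.
rewrite /pseries_diffs normrM normr_nat.
apply: (@le_trans _ _ ((1 + d^-1) * (1 + d) ^+ n * `|c n.+1| * rho ^+ n)).
  by rewrite !ler_wpM2r // ?exprn_ge0 // ltW.
have -> : (1 + d^-1) * (1 + d) ^+ n * `|c n.+1| * rho ^+ n =
  (1 + d^-1) * (`|c n.+1| * r ^+ n).
  by rewrite -e exprMn; ring.
rewrite [leRHS]mulrC ler_wpM2l ?addr_ge0 ?invr_ge0 ?(ltW d0) //.
rewrite ler_pdivlMr // -mulrA -exprSr; exact: HK.
Qed.

Lemma subgeometric_shift c : subgeometric c -> subgeometric (shift_seq c).
Proof.
move=> sc r r0 r1; have [K HK] := sc r r0 r1.
have K0 : 0 <= K by apply: le_trans (HK 0%N); rewrite mulr_ge0.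
exists K => -[|n] /=; first by rewrite normr0 mul0r.
rewrite exprSr mulrA (le_trans _ (HK n)) // ler_piMr ?mulr_ge0 ?exprn_ge0 ?(ltW r0) //.
exact: ltW.
Qed.

Lemma psum_shift c t : cvgn (pseries c t) -> psum (shift_seq c) t = t * psum c t.
Proof.
move=> ct; apply/cvg_lim => //; rewrite -cvg_shiftS.
rewrite (_ : (fun n => _) = (fun n => t * pseries c t n)); last first.
  apply/funext => n; rewrite /pseries /series /= big_nat_recl //= mul0r add0r mulr_sumr.
  by apply: eq_bigr => i _; rewrite exprS; ring.
exact: cvgMr.
Qed.

Lemma psumD a b t : cvgn (pseries a t) -> cvgn (pseries b t) ->
  psum (fun n => a n + b n) t = psum a t + psum b t.
Proof.
move=> ca cb; apply/cvg_lim => //.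
rewrite (_ : pseries _ t = pseries a t \+ pseries b t); first exact: cvgD.
apply/funext => n; rewrite /pseries /series /= -big_split /=.
by apply: eq_bigr => i _; rewrite mulrDl.
Qed.

Lemma psumZ k a t : cvgn (pseries a t) -> psum (fun n => k * a n) t = k * psum a t.
Proof.
move=> ca; apply/cvg_lim => //.
rewrite (_ : pseries _ t = (fun n => k * pseries a t n)); first exact: cvgMr.
apply/funext => n; rewrite /pseries /series /= mulr_sumr.
by apply: eq_bigr => i _; rewrite mulrA.
Qed.

Lemma subgeometricD a b : subgeometric a -> subgeometric b -> subgeometric (fun n => a n + b n).
Proof.
move=> sa sb r r0 r1; have [K HK] := sa r r0 r1; have [L HL] := sb r r0 r1.
exists (K + L) => n; rewrite (le_trans _ (lerD (HK n) (HL n))) // -mulrDl.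
by rewrite ler_wpM2r ?ler_normD // exprn_ge0 // ltW.
Qed.

Lemma subgeometricZ k a : subgeometric a -> subgeometric (fun n => k * a n).
Proof.
move=> sa r r0 r1; have [K HK] := sa r r0 r1.
by exists (`|k| * K) => n; rewrite normrM -mulrA ler_wpM2l.
Qed.

Lemma is_derive_psum c t : subgeometric c -> `|t| < 1 ->
  is_derive t (1 : R) (psum c) (psum (pseries_diffs c) t).
Proof.
move=> sc t1; pose k := (`|t| + 1) / 2.
have k1 : `|k| < 1 by rewrite ger0_norm /k; have := normr_ge0 t; lra.
apply: (@pseries_snd_diffs _ c k).
- exact: subgeometric_cvg.
- by apply: subgeometric_cvg => //; exact: subgeometric_diffs.
- by apply: subgeometric_cvg => //; do 2 apply: subgeometric_diffs.
- by rewrite [ltRHS]ger0_norm /k; have := normr_ge0 t; lra.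
Qed.

Lemma psum_term_le c t n : (forall n, 0 <= c n) -> 0 <= t -> cvgn (pseries c t) ->
  c n * t ^+ n <= psum c t.
Proof.
move=> c0 t0 ct.
apply: (@le_trans _ _ (pseries c t n.+1)).
  rewrite /pseries /series /= big_nat_recr //= lerDr sumr_ge0 // => i _.
  by rewrite mulr_ge0 // exprn_ge0.
apply: nondecreasing_cvgn_le => //; apply/nondecreasing_seqP => k.
by rewrite /pseries /series /= big_nat_recr //= lerDl mulr_ge0 // exprn_ge0.
Qed.

Lemma psum0 c : psum c 0 = c 0%N.
Proof.
apply/cvg_lim => //; rewrite -cvg_shiftS.
rewrite (_ : (fun n => _) = cst (c 0%N)); first exact: cvg_cst.
apply/funext => n; rewrite /pseries /series /= big_nat_recl //= mulr1.
by rewrite big1 ?addr0 // => i _; rewrite exprS mul0r mulr0.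
Qed.

End power_series.

Lemma is_derive_continuous_segment (R : realType) (f df : R -> R) (a b : R) :
  (forall t, a <= t <= b -> is_derive t (1 : R) f (df t)) ->
  {within `[a, b], continuous f}.
Proof.
move=> fd; apply: continuous_in_subspaceT => t; rewrite inE /= in_itv /= => tab.
apply: differentiable_continuous; apply/derivable1_diffP.
by have [] := fd _ tab.
Qed.

Lemma le_of_derive_le0 (R : realType) (f df : R -> R) (a b : R) : a <= b ->
  (forall t, a <= t <= b -> is_derive t (1 : R) f (df t)) ->
  (forall t, a <= t <= b -> df t <= 0) -> f b <= f a.
Proof.
move=> ab fd dle.
have [|c cab e] := @MVT_segment R f df a b ab _ (is_derive_continuous_segment fd).
  by move=> t; rewrite in_itv /= => /andP[/ltW ? /ltW ?]; apply: fd; apply/andP.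
by rewrite -subr_le0 e mulr_le0_ge0 ?subr_ge0 // dle.
Qed.

(* [f n], [p n], [q n], [h n] stand for [mean_det_sqr n], [mean_det_minor n.+1],
   [mean_minor_minor n.+2], [mean_offdiag_sqr n.+2] divided by n!.  After eliminating
   [p], [q] and [h], the generating function G of [f] satisfies
   G' t <= (x ^+ 2 / (1 + t) ^+ 2 + C) * G t on [0, r]. *)
Section coefficient_bound.
Variables (R : realType) (x m : R) (f p q h : R^nat).
Hypothesis f_ge0 : forall n, 0 <= f n.
Hypothesis pE : forall n, p n = - x * f n - shift_seq p n.
Hypothesis qE : forall n, q n = x ^+ 2 * f n + 2 * x * shift_seq p n +
  shift_seq f n + shift_seq (shift_seq q) n.
Hypothesis hE : forall n, h n = f n + shift_seq f n + shift_seq (shift_seq h) n.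
Hypothesis fE : forall n, pseries_diffs f n =
  q n + 2 * h n - f n + (m - 3) * shift_seq f n.

Let bounded_by (K rho : R) (N : nat) (c : R^nat) := forall k, (k <= N)%N -> `|c k| * rho ^+ k <= K.

Let bb_shift (K rho : R) N c : 0 <= rho -> 0 <= K ->
  bounded_by K rho N c -> bounded_by (rho * K) rho N.+1 (shift_seq c).
Proof.
move=> r0 K0 cK [|k] kN /=; first by rewrite normr0 mul0r mulr_ge0.
by rewrite exprS mulrCA ler_wpM2l // cK.
Qed.

Let cp (rho : R) := `|x| / (1 - rho).
Let cq (rho : R) := (x ^+ 2 + 2 * `|x| * cp rho + 1) / (1 - rho).
Let ch (rho : R) : R := 2 / (1 - rho).

(** A shift contributes a factor [rho < 1], so a recursion adding a source of size [B] at each step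
    stays below [B / (1 - rho)]. *)
Let affine_iter (rho B K : R) : 0 < rho < 1 -> B <= K * (1 - rho) -> rho * K + B <= K.
Proof. by move=> /andP[r0 r1]; rewrite mulrBr mulr1; lra. Qed.

Let p_bound (rho K : R) N : 0 < rho < 1 -> 0 <= K -> bounded_by K rho N f ->
  bounded_by (cp rho * K) rho N p.
Proof.
move=> r01 K0 fK; have [r0 r1] := andP r01.
have c0 : 0 <= cp rho * K by rewrite mulr_ge0 // divr_ge0 // subr_ge0 ltW.
elim=> [|k IH] kN; rewrite pE /=.
  rewrite subr0 mulr1 normrM normrN /cp mulrAC ler_pdivlMr ?subr_gt0 //.
  have := fK _ kN; rewrite mulr1 => fk.
  rewrite (@le_trans _ _ (`|x| * `|f 0%N|)) ?ler_wpM2l //.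
  by rewrite ler_piMr ?mulr_ge0 // gerBl ltW.
apply: (@le_trans _ _ (rho * (cp rho * K) + `|x| * K)); last first.
  apply: affine_iter => //; rewrite /cp mulrAC divfK // subr_eq0.
  by rewrite gt_eqF.
apply: (@le_trans _ _ ((`|x| * `|f k.+1| + `|p k|) * rho ^+ k.+1)).
  rewrite ler_wpM2r ?exprn_ge0 ?(ltW r0) // (le_trans (ler_normB _ _)) //.
  by rewrite normrM normrN.
rewrite mulrDl addrC lerD //; last by rewrite -mulrA ler_wpM2l // fK.
by rewrite exprS mulrCA ler_wpM2l ?(ltW r0) // IH // ltnW.
Qed.

Let two_step (rho K B : R) N (c g : R^nat) : 0 < rho < 1 -> 0 <= K -> 0 <= B ->
  (forall n, c n = g n + shift_seq (shift_seq c) n) ->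
  bounded_by (B * K) rho N g -> bounded_by (B / (1 - rho) * K) rho N c.
Proof.
move=> r01 K0 B0 cE gB; have [r0 r1] := andP r01.
have BK : B * K <= B / (1 - rho) * K.
  rewrite ler_wpM2r // ler_pdivlMr ?subr_gt0 // ler_piMr // gerBl; exact: ltW.
have C0 : 0 <= B / (1 - rho) * K by rewrite (le_trans _ BK) // mulr_ge0.
(* The recursion has step two, so the induction carries two consecutive indices. *)
suff H k : (k <= N)%N -> `|c k| * rho ^+ k <= B / (1 - rho) * K /\
   ((k.+1 <= N)%N -> `|c k.+1| * rho ^+ k.+1 <= B / (1 - rho) * K).
  by move=> k /H[].
elim: k => [|k IH] kN.
  split=> [|k1]; rewrite cE /= addr0; apply: le_trans BK; exact: gB.
have [H1 H2] := IH (ltnW kN); split; first exact: H2.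
move=> k2; rewrite cE /=.
apply: (@le_trans _ _ (rho * (B / (1 - rho) * K) + B * K)); last first.
  by apply: affine_iter => //; rewrite mulrAC divfK // subr_eq0 gt_eqF.
apply: (@le_trans _ _ ((`|g k.+2| + `|c k|) * rho ^+ k.+2)).
  by rewrite ler_wpM2r ?exprn_ge0 ?(ltW r0) // ler_normD.
rewrite mulrDl addrC lerD //; last exact: gB.
rewrite exprS mulrCA ler_wpM2l ?(ltW r0) // exprS mulrCA.
by rewrite (le_trans _ H1) // ler_piMl ?mulr_ge0 ?exprn_ge0 ?(ltW r0) // ltW.
Qed.

Let shift_bound (rho K : R) N c : 0 < rho < 1 -> 0 <= K -> bounded_by K rho N c ->
  bounded_by K rho N (shift_seq c).
Proof.
move=> /andP[r0 r1] K0 cK k kN.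
apply: (@le_trans _ _ (rho * K)); last by rewrite ler_piMl // ltW.
exact: (bb_shift (ltW r0) K0 cK (leqW kN)).
Qed.

Let q_bound (rho K : R) N : 0 < rho < 1 -> 0 <= K -> bounded_by K rho N f ->
  bounded_by (cq rho * K) rho N q.
Proof.
move=> r01 K0 fK; have [r0 r1] := andP r01.
have cp0 : 0 <= cp rho by rewrite divr_ge0 // subr_ge0 ltW.
have B0 : 0 <= x ^+ 2 + 2 * `|x| * cp rho + 1.
  by rewrite addr_ge0 // addr_ge0 ?sqr_ge0 // mulr_ge0 // mulr_ge0.
apply: (two_step r01 K0 B0 qE).
move=> k kN.
have pk := shift_bound r01 (mulr_ge0 cp0 K0) (p_bound r01 K0 fK) kN.
have fk := shift_bound r01 K0 fK kN.
apply: (@le_trans _ _ ((x ^+ 2 * `|f k| + 2 * `|x| * `|shift_seq p k| + `|shift_seq f k|) * rho ^+ k)).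
  rewrite ler_wpM2r ?exprn_ge0 ?(ltW r0) // (le_trans (ler_normD _ _)) // lerD2r.
  rewrite (le_trans (ler_normD _ _)) //; apply: lerD.
    by rewrite normrM ger0_norm ?sqr_ge0.
  by rewrite !normrM [`|2|]ger0_norm.
have D3 (a b c d : R) : (a + b + c) * d = a * d + b * d + c * d by ring.
rewrite !D3 mul1r; apply: lerD => //; apply: lerD.
  by rewrite -mulrA ler_wpM2l ?sqr_ge0 // fK.
by rewrite -[leLHS]mulrA -[leRHS]mulrA ler_wpM2l ?mulr_ge0.
Qed.

Let h_bound (rho K : R) N : 0 < rho < 1 -> 0 <= K -> bounded_by K rho N f ->
  bounded_by (ch rho * K) rho N h.
Proof.
move=> r01 K0 fK; have [r0 r1] := andP r01.
apply: (two_step r01 K0 _ hE) => // k kN.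
have fk := shift_bound r01 K0 fK kN.
apply: (@le_trans _ _ ((`|f k| + `|shift_seq f k|) * rho ^+ k)).
  by rewrite ler_wpM2r ?exprn_ge0 ?(ltW r0) // ler_normD.
rewrite mulrDl mulr2n mulrDl mul1r lerD //; exact: fK.
Qed.

(** The right side of [fE] at rank [N] is at most [C * K] in the weighted norm, with [C] independent
    of [N], while the left side carries the factor [N + 1]. Past [n0 > C] a bound [K] reproduces
    itself, so [K] only has to dominate the first [n0 + 1] terms. *)
Let f_subgeo : subgeometric f.
Proof.
move=> rho r0 r1.
have r01 : 0 < rho < 1 by rewrite r0.
pose C := cq rho + 2 * ch rho + 1 + `|m - 3|.
have C0 : 0 <= C.
  have h1 : 0 <= 1 - rho by rewrite subr_ge0 ltW.
  have cp0 : 0 <= cp rho by rewrite divr_ge0.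
  have ch0 : 0 <= ch rho by rewrite divr_ge0.
  have cq0 : 0 <= cq rho by rewrite divr_ge0 // addr_ge0 // addr_ge0 ?sqr_ge0 // mulr_ge0 // mulr_ge0.
  by rewrite !addr_ge0 // mulr_ge0.
pose n0 := Num.bound C.
have Cn0 : C < n0%:R by have := archi_boundP C0.
pose K := \sum_(k < n0.+1) `|f k| * rho ^+ k.
have K0 : 0 <= K by rewrite sumr_ge0 // => k _; rewrite mulr_ge0 // exprn_ge0 // ltW.
exists K => n.
suff H N : bounded_by K rho N f by exact: (H n n).
elim: N => [|N IH] k.
  rewrite leqn0 => /eqP ->; rewrite /K big_ord_recl /= lerDl sumr_ge0 // => i _.
  by rewrite mulr_ge0 // exprn_ge0 // ltW.
rewrite leq_eqVlt => /predU1P[->{k}|]; last by rewrite ltnS; exact: IH.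
have [Nn|nN] := leqP N.+1 n0.
  rewrite /K (bigD1 (Ordinal (_ : (N.+1 < n0.+1)%N))) //= lerDl sumr_ge0 // => i _.
  by rewrite mulr_ge0 // exprn_ge0 // ltW.
have N1 : (0 : R) < N.+1%:R by [].
rewrite -(ler_pM2l N1) mulrA.
have -> : N.+1%:R * `|f N.+1| = `|pseries_diffs f N|.
  by rewrite /pseries_diffs normrM normr_nat.
rewrite fE.
have hN := h_bound r01 K0 IH (leqnn N).
have qN := q_bound r01 K0 IH (leqnn N).
have fN := IH _ (leqnn N).
have sN := shift_bound r01 K0 IH (leqnn N).
have rN : 0 <= rho ^+ N by rewrite exprn_ge0 // ltW.
apply: (@le_trans _ _ ((`|q N| + 2 * `|h N| + `|f N| + `|m - 3| * `|shift_seq f N|) * rho ^+ N)).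
  rewrite exprS mulrCA -[leRHS]mul1r; apply: ler_pM => //; rewrite ?mulr_ge0 ?(ltW r0) ?(ltW r1) //.
  rewrite ler_wpM2r // (le_trans (ler_normD _ _)) // normrM lerD2r.
  rewrite (le_trans (ler_normB _ _)) // lerD2r (le_trans (ler_normD _ _)) //.
  by rewrite normrM [`|2|]ger0_norm.
apply: (@le_trans _ _ (C * K)); last first.
  rewrite ler_wpM2r // (le_trans (ltW Cn0)) // ler_nat ltnW //.
have D4 (a b c d e : R) : (a + b + c + d) * e = a * e + b * e + c * e + d * e by ring.
rewrite /C !D4 mul1r; apply: lerD; last by rewrite -mulrA ler_wpM2l.
apply: lerD => //; apply: lerD => //.
by rewrite -[leLHS]mulrA -[leRHS]mulrA ler_wpM2l.
Qed.

Let sub_of_bound (c : R^nat) (C : R -> R) :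
  (forall rho K N, 0 < rho < 1 -> 0 <= K -> bounded_by K rho N f ->
  bounded_by (C rho * K) rho N c) -> subgeometric c.
Proof.
move=> H rho r0 r1; have [K HK] := f_subgeo r0 r1.
have K0 : 0 <= K by apply: le_trans (HK 0%N); rewrite mulr_ge0.
by exists (C rho * K) => n; apply: (H _ _ n) => //; rewrite r0.
Qed.

(** Gronwall: the product of [G] and [expR \o phi] is nonincreasing on [0, r], so [G r] is at most
    the exponential of the integrated rate, and a nonnegative series dominates each of its terms. *)
Lemma coefficient_bound r n : f 0%N = 1 -> 0 < r < 1 ->
  f n * r ^+ n <= expR (x ^+ 2 * (r / (1 + r)) +
     (r / (1 - r ^+ 2) + 2 / (1 - r) + `|m - 3|) * r).
Proof.
move=> f0 /andP[r0 r1].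
have fg := f_subgeo; have pg := sub_of_bound p_bound.
have qg := sub_of_bound q_bound; have hg := sub_of_bound h_bound.
have cv c t : subgeometric c -> 0 <= t <= r -> cvgn (pseries c t).
  move=> sc /andP[t0 tr]; apply: subgeometric_cvg => //.
  by rewrite ger0_norm // (le_lt_trans tr).
set C := _ + _ + _.
pose G := psum f.
(* Minus the primitive, vanishing at 0, of the rate [x^2 / (1 + t)^2 + C]. *)
pose phi (t : R) := - (x ^+ 2 * (1 - (1 + t)^-1) + C * t).
have G0 t : 0 <= t <= r -> 0 <= G t.
  move=> tr; have t0 : 0 <= t by case/andP: tr.
  by rewrite (le_trans _ (psum_term_le 0 f_ge0 t0 (cv _ _ fg tr))) // mulr_ge0.
have dG t : 0 <= t <= r -> psum (pseries_diffs f) t <=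
    (x ^+ 2 / (1 + t) ^+ 2 + C) * G t.
  move=> tr; have [t0 tr'] := andP tr.
  have t1 : t < 1 by exact: le_lt_trans tr' r1.
  have cf := cv _ _ fg tr. have cpp := cv _ _ pg tr.
  have cqq := cv _ _ qg tr. have chh := cv _ _ hg tr.
  have csf := cv _ _ (subgeometric_shift fg) tr. have csp := cv _ _ (subgeometric_shift pg) tr.
  have csq := cv _ _ (subgeometric_shift qg) tr. have csh := cv _ _ (subgeometric_shift hg) tr.
  have csq2 := cv _ _ (subgeometric_shift (subgeometric_shift qg)) tr.
  have csh2 := cv _ _ (subgeometric_shift (subgeometric_shift hg)) tr.
  have eP : psum p t = - x * G t - t * psum p t.
    rewrite -(psum_shift cpp) -psumZ // -[- psum _ _]mulN1r -psumZ // -psumD.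
    - by congr (psum _ t); apply/funext => k; rewrite pE mulN1r.
    - by apply: cv tr; exact: subgeometricZ.
    - by apply: cv tr; apply: subgeometricZ; exact: subgeometric_shift.
  have eQ : psum q t = x ^+ 2 * G t + 2 * x * (t * psum p t) + t * G t + t * (t * psum q t).
    rewrite -(psum_shift cpp) -(psum_shift cf) -(psum_shift cqq) -(psum_shift csq).
    rewrite -!psumZ // -!psumD //.
    - by congr (psum _ t); apply/funext => k; rewrite qE.
    all: try by apply: cv tr; repeat first [assumption | apply: subgeometricD | apply: subgeometricZ | apply: subgeometric_shift].
  have eH : psum h t = G t + t * G t + t * (t * psum h t).
    rewrite -(psum_shift cf) -(psum_shift chh) -(psum_shift csh).
    rewrite -!psumD //.
    - by congr (psum _ t); apply/funext => k; rewrite hE.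
    all: try by apply: cv tr; repeat first [assumption | apply: subgeometricD | apply: subgeometricZ | apply: subgeometric_shift].
  have eF : psum (pseries_diffs f) t = psum q t + 2 * psum h t + (-1) * G t + (m - 3) * (t * G t).
    rewrite -(psum_shift cf) -!psumZ // -!psumD //.
    - by congr (psum _ t); apply/funext => k; rewrite fE mulN1r.
    all: try by apply: cv tr; repeat first [assumption | apply: subgeometricD | apply: subgeometricZ | apply: subgeometric_shift].
  have n1 : 1 + t != 0 by rewrite gt_eqF // ltr_wpDr.
  have n2 : 1 - t != 0 by rewrite subr_eq0 gt_eqF.
  have eP' : psum p t = - x * G t / (1 + t).
    by apply: (mulIf n1); rewrite divfK // mulrDr mulr1 {1}eP; ring.
  have eH' : psum h t = G t / (1 - t).
    apply: (mulIf n2); rewrite divfK //; apply: (mulIf n1).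
    have -> : psum h t * (1 - t) * (1 + t) = psum h t - t * (t * psum h t) by ring.
    by rewrite {1}eH; ring.
  (* With [p] eliminated, [(1 - t^2) Q = x^2 G (1 - t) / (1 + t) + t G], and the factor [1 - t]
     cancels in the first term. Only that term carries [x^2], of order [n] in the application; all
     others go into the constant [C]. *)
  have eQ' : psum q t = x ^+ 2 / (1 + t) ^+ 2 * G t + t / (1 - t ^+ 2) * G t.
    have n3 : 1 - t ^+ 2 != 0.
      by rewrite (_ : 1 - t ^+ 2 = (1 - t) * (1 + t)) ?mulf_neq0 //; ring.
    apply: (mulIf n3).
    have -> : psum q t * (1 - t ^+ 2) = psum q t - t * (t * psum q t) by ring.
    rewrite {1}eQ eP'; field.
    by rewrite ?n1 ?n3 ?n2.
  rewrite eF eQ' eH' [leRHS]mulrDl -!addrA lerD2l.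
  have -> : t / (1 - t ^+ 2) * G t + (2 * (G t / (1 - t)) + (-1 * G t + (m - 3) * (t * G t))) =
     (t / (1 - t ^+ 2) + 2 / (1 - t) - 1 + (m - 3) * t) * G t by ring.
  rewrite ler_wpM2r ?G0 // /C.
  have p1 : 0 < 1 - t by rewrite subr_gt0.
  have p1' : 0 < 1 - r by rewrite subr_gt0.
  have p2 : 0 < 1 - r ^+ 2 by rewrite subr_gt0 expr_lt1 // ltW.
  have p2' : 0 < 1 - t ^+ 2 by rewrite subr_gt0 expr_lt1.
  have h1 : t / (1 - t ^+ 2) <= r / (1 - r ^+ 2).
    apply: ler_pM => //; first by rewrite invr_ge0 ltW.
    by rewrite lef_pV2 ?posrE // lerD2l lerN2 lerXn2r ?nnegrE // ltW.
  have h2 : 2 / (1 - t) <= 2 / (1 - r).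
    by rewrite ler_wpM2l // lef_pV2 ?posrE // lerD2l lerN2.
  have h3 : (m - 3) * t <= `|m - 3|.
    rewrite (le_trans (ler_norm _)) // normrM ler_piMr // ger0_norm // ltW //.
  lra.
have der t : 0 <= t <= r -> is_derive t (1 : R) (G * (expR \o phi))
    (expR (phi t) * (psum (pseries_diffs f) t - (x ^+ 2 / (1 + t) ^+ 2 + C) * G t)).
  move=> tr; have [t0 tr'] := andP tr.
  have n1 : 1 + t != 0 by rewrite gt_eqF // ltr_wpDr.
  have dg : is_derive t (1 : R) G (psum (pseries_diffs f) t).
    by apply: is_derive_psum => //; rewrite ger0_norm // (le_lt_trans tr').
  have dphi : is_derive t (1 : R) phi (- (x ^+ 2 / (1 + t) ^+ 2 + C)).
    have di : is_derive t (1 : R) (fun y : R => (1 + y)^-1) (- (1 + t) ^- 2 *: (1 : R)).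
      have da : is_derive t (1 : R) (cst 1 + id : R -> R) 1.
        by apply: is_derive_eq; rewrite add0r.
      exact: (is_deriveV n1 da).
    have -> : phi = - (((x ^+ 2) \*: (cst 1 - (fun y : R => (1 + y)^-1))) + (C \*: id)).
      by apply/funext => y.
    apply: is_derive_eq; rewrite /GRing.scale /= !mulr1 sub0r opprK.
    by rewrite -exprVn.
  have de : is_derive t (1 : R) (expR \o phi) (expR (phi t) * - (x ^+ 2 / (1 + t) ^+ 2 + C)).
    exact: is_derive1_comp.
  apply: is_derive_eq; rewrite /GRing.scale /=; ring.
have r01 : 0 <= r <= r by rewrite (ltW r0) lexx.
have := @le_of_derive_le0 R (G * (expR \o phi)) _ 0 r (ltW r0) der.
have dle : forall t, 0 <= t <= r ->
  expR (phi t) * (psum (pseries_diffs f) t - (x ^+ 2 / (1 + t) ^+ 2 + C) * G t) <= 0.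
  by move=> t tr; rewrite mulr_ge0_le0 ?expR_ge0 // subr_le0 dG.
move=> /(_ dle) /=.
have -> : (G * (expR \o phi)) r = G r * expR (phi r) by [].
have -> : (G * (expR \o phi)) 0 = 1.
  have -> : (G * (expR \o phi)) 0 = G 0 * expR (phi 0) by [].
  by rewrite /G psum0 f0 /phi addr0 invr1 subrr !mulr0 addr0 oppr0 expR0 mulr1.
rewrite /phi expRN -ler_pdivlMr ?invr_gt0 ?expR_gt0 // mul1r invrK => Gle.
rewrite (le_trans (psum_term_le n f_ge0 (ltW r0) (cv _ _ fg r01))) //.
rewrite (le_trans Gle) //.
have -> // : 1 - (1 + r)^-1 = r / (1 + r).
by field; rewrite gt_eqF // addr_gt0.
Qed.

End coefficient_bound.

(** * The Hermite recursion *)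

Section elementary.
Variable R : realType.

(** The derivative of [(1 + t) * expR (t^2 / 2 - t)] is [t^2 * expR (t^2 / 2 - t)], which is
    nonnegative. *)
Lemma expR_quad_le1D (y : R) : 0 <= y -> expR (y - y ^+ 2 / 2) <= 1 + y.
Proof.
move=> y0.
pose phi (t : R) := t ^+ 2 / 2 - t.
pose f : R -> R := - ((cst 1 + id) * (expR \o phi)).
have der t : 0 <= t <= y -> is_derive t (1 : R) f (- (t ^+ 2 * expR (phi t))).
  move=> _.
  have dp : is_derive t (1 : R) phi (t - 1).
    have -> : phi = ((2^-1 : R) \*: (id ^+ 2)) - id.
      by apply/funext => z; rewrite /phi /= mulrC.
    apply: is_derive_eq; rewrite /GRing.scale /= expr1.
    by field.
  have de : is_derive t (1 : R) (expR \o phi) (expR (phi t) * (t - 1)).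
    exact: is_derive1_comp.
  rewrite /f; apply: is_derive_eq; rewrite /GRing.scale /= -[(cst 1 + id) t]/(1 + t).
  rewrite add0r; ring.
have := @le_of_derive_le0 R f _ 0 y y0 der.
have H t : 0 <= t <= y -> - (t ^+ 2 * expR (phi t)) <= 0.
  by move=> _; rewrite oppr_le0 mulr_ge0 ?sqr_ge0 ?expR_ge0.
move=> /(_ H).
have -> : f y = - ((1 + y) * expR (phi y)) by [].
have -> : f 0 = - 1.
  have -> : f 0 = - ((1 + 0) * expR (phi 0)) by [].
  by rewrite /phi expr2 !mul0r subr0 expR0 mulr1 addr0.
rewrite lerN2 => le1.
have -> : y - y ^+ 2 / 2 = - phi y by rewrite /phi opprB.
by rewrite expRN -[_^-1]mul1r ler_pdivrMr ?expR_gt0.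
Qed.

(** Stirling's formula up to a factor [O(n)], which the division by [N] erases. The induction rests
    on [1 / (n + 2) <= ln (n + 2) - ln (n + 1) <= 1 / (n + 1)]. *)
Lemma ln_fact_bounds n :
  n.+1%:R * ln n.+1%:R - n.+1%:R <= ln (n.+1)`!%:R :> R /\
  ln (n.+1)`!%:R <= n.+1%:R * ln n.+1%:R - n.+1%:R + ln n.+1%:R + 1 :> R.
Proof.
elim: n => [|n [IH1 IH2]].
  by rewrite (_ : 1`! = 1%N) // ln1; split; lra.
have p1 : (0 : R) < n.+1%:R by [].
have p2 : (0 : R) < n.+2%:R by [].
rewrite factS natrM lnM ?posrE ?ltr0n ?fact_gt0 //.
have d1 : ln (n.+2%:R) - ln (n.+1%:R) <= n.+1%:R^-1 :> R.
  rewrite -ln_div ?posrE //.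
  have -> : n.+2%:R / n.+1%:R = 1 + n.+1%:R^-1 :> R.
    by rewrite -[n.+2%:R]natr1 mulrDl mul1r divff // gt_eqF.
  by rewrite le_ln1Dx // (lt_trans (ltrN10 _)) // invr_gt0.
have d2 : n.+2%:R^-1 <= ln (n.+2%:R) - ln (n.+1%:R) :> R.
  rewrite -lerN2 opprB -ln_div ?posrE //.
  have -> : n.+1%:R / n.+2%:R = 1 + (- n.+2%:R^-1) :> R.
    by apply: (mulIf (lt0r_neq0 p2)); rewrite divfK ?gt_eqF // mulrDl mulNr mulVf ?gt_eqF // mul1r -[n.+2%:R]natr1 addrK.
  by rewrite le_ln1Dx // ltrN2 invf_lt1 // ltr1n.
have e1 : n.+1%:R * (ln (n.+2%:R) - ln (n.+1%:R)) <= 1 :> R.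
  by rewrite -ler_pdivlMl // mulr1.
have e2 : 1 <= n.+2%:R * (ln (n.+2%:R) - ln (n.+1%:R)) :> R.
  by rewrite -ler_pdivrMl // mulr1.
move: e1 e2 IH1 IH2; rewrite -[n.+2%:R]natr1; split; lra.
Qed.

End elementary.

Section hermite.
Variables (R : realType) (x : R) (He : R^nat).
Hypotheses (He0 : He 0%N = 1) (HeS : forall n, He n.+1 = x * He n - n%:R * He n.-1).

(** The determinant [He_(n+1)^2 - He_n He_(n+2)], with [He_(n+2)] eliminated by the recursion so
    that two consecutive values suffice. *)
Definition turan n := He n.+1 ^+ 2 - x * He n.+1 * He n + n.+1%:R * He n ^+ 2.

Lemma turanS n : turan n.+1 = n.+1%:R * turan n + He n.+1 ^+ 2.
Proof. by rewrite /turan HeS /= -[n.+2%:R]natr1; ring. Qed.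

Lemma turan0 : turan 0 = 1.
Proof. by rewrite /turan HeS He0; ring. Qed.

(** By [turanS], [turan n] is the sum over [k <= n] of the terms [n! / k! * He k ^+ 2], all
    nonnegative; one of them is kept. *)
Lemma turan_ge k n : (k <= n)%N -> (n`!%:R / k`!%:R) * He k ^+ 2 <= turan n.
Proof.
have t0 m : 0 <= turan m.
  elim: m => [|m IH]; first by rewrite turan0.
  by rewrite turanS addr_ge0 ?sqr_ge0 // mulr_ge0.
elim: n => [|n IH].
  by rewrite leqn0 => /eqP ->; rewrite turan0 He0 divff ?pnatr_eq0 // expr1n mulr1.
rewrite leq_eqVlt => /predU1P[->|].
  by rewrite divff ?pnatr_eq0 -?lt0n ?fact_gt0 // mul1r turanS lerDr mulr_ge0.
rewrite ltnS => kn; rewrite turanS (le_trans (_ : _ <= n.+1%:R * turan n)) ?lerDl ?sqr_ge0 //.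
by rewrite factS natrM -!mulrA ler_wpM2l // mulrA IH.
Qed.

(** For [x] of order [sqrt n] the cross term is comparable to the two squares, by the
    arithmetic-geometric mean inequality. *)
Lemma turan_le n c : 0 <= c -> `|x| <= c * Num.sqrt n.+1%:R ->
  turan n <= (1 + c / 2) * (He n.+1 ^+ 2 + n.+1%:R * He n ^+ 2).
Proof.
move=> c0 xc; set s := Num.sqrt n.+1%:R in xc.
have s2 : n.+1%:R = s ^+ 2 by rewrite sqr_sqrtr.
rewrite /turan s2; set a := He n.+1; set b := He n.
have s0 : 0 <= s by exact: sqrtr_ge0.
have : - (x * a * b) <= c * s * (`|a| * `|b|).
  rewrite (le_trans (ler_norm _)) // normrN !normrM -[leLHS]mulrA.
  by rewrite ler_wpM2r ?mulr_ge0.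
have : c * (2 * (s * (`|a| * `|b|))) <= c * (a ^+ 2 + s ^+ 2 * b ^+ 2).
  rewrite ler_wpM2l // -(real_normK (num_real a)) -(real_normK (num_real b)).
  have := sqr_ge0 (`|a| - s * `|b|); nra.
nra.
Qed.

(* Larger root of z ^+ 2 - x * z + n, the characteristic equation of the recursion. *)
Definition hermite_root (n : nat) : R := (x + Num.sqrt (x ^+ 2 - 4 * n%:R)) / 2.

Hypothesis x_gt0 : 0 < x.

Lemma hermite_root_gt0 n : 0 < hermite_root n.
Proof. by rewrite divr_gt0 // ltr_wpDr ?sqrtr_ge0. Qed.

Lemma hermite_root_eq n : 4 * n%:R <= x ^+ 2 -> hermite_root n * (x - hermite_root n) = n%:R.
Proof.
move=> h; have : Num.sqrt (x ^+ 2 - 4 * n%:R) ^+ 2 = x ^+ 2 - 4 * n%:R.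
  by rewrite sqr_sqrtr // subr_ge0.
rewrite /hermite_root; set s := Num.sqrt _ => e.
have -> : (x + s) / 2 * (x - (x + s) / 2) = (x ^+ 2 - s ^+ 2) / 4 by field.
by rewrite e; field.
Qed.

Lemma hermite_root_le n : hermite_root n.+1 <= hermite_root n.
Proof.
rewrite /hermite_root ler_wpM2r // lerD2l ler_wsqrtr // lerD2l lerN2 ler_wpM2l //.
by rewrite ler_nat.
Qed.

(** Let [z] be the root at [n + 1]. Roots decrease, so the bound at [n] gives [z * He n <= He n.+1];
    then [(n + 1) * He n = z * (x - z) * He n <= (x - z) * He n.+1], and the recursion yields
    [He n.+2 >= z * He n.+1]. The condition [4 n <= x^2] keeps the roots real. *)
Lemma hermite_ratio n : 4 * n%:R <= x ^+ 2 -> 0 < He n /\ hermite_root n * He n <= He n.+1.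
Proof.
elim: n => [|n IH] h.
  rewrite HeS He0 /hermite_root !mulr0 subr0 sqrtr_sqr (ger0_norm (ltW x_gt0)) mul0r subr0 !mulr1.
  split; [exact: ltr01|lra].
have h' : 4 * n%:R <= x ^+ 2.
  by apply: le_trans h; rewrite ler_wpM2l // ler_nat.
have [Hp Hr] := IH h'.
have Hp1 : 0 < He n.+1 by apply: lt_le_trans Hr; rewrite mulr_gt0 ?hermite_root_gt0.
split=> //; rewrite [leRHS]HeS /= -(hermite_root_eq h).
have : hermite_root n.+1 * He n <= He n.+1.
  by rewrite (le_trans _ Hr) // ler_wpM2r ?(ltW Hp) // hermite_root_le.
have xr : 0 <= x - hermite_root n.+1.
  by rewrite -(pmulr_rge0 _ (hermite_root_gt0 n.+1)) hermite_root_eq.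
move=> /(ler_wpM2l xr); nra.
Qed.

(** The ratio bound multiplied up; [n / hermite_root n] is the smaller root [x - hermite_root n].
    With [b], [a] the roots at [n], [n + 1], the step compares [b^(n+1) * expR ((x - b)^2 / 2)] with
    its value at [a], using [n + 1 = a * (x - a)]. The second-order loss in [(b / a)^(n+1)] is
    [(x - a) / a * (b - a)^2 / 2], affordable because [x - a <= a]. *)
Lemma hermite_ge n : 4 * n%:R <= x ^+ 2 ->
  hermite_root n ^+ n * expR ((n%:R / hermite_root n) ^+ 2 / 2) <= He n.
Proof.
elim: n => [|n IH] h; first by rewrite He0 mul0r expr2 !mul0r expR0 mulr1 expr0.
have h' : 4 * n%:R <= x ^+ 2.
  by apply: le_trans h; rewrite ler_wpM2l // ler_nat.
have [Hp Hr] := hermite_ratio h'; apply: le_trans Hr.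
apply: (@le_trans _ _ (hermite_root n * (hermite_root n ^+ n * expR ((n%:R / hermite_root n) ^+ 2 / 2)))); last first.
  by rewrite ler_wpM2l ?IH // ltW ?hermite_root_gt0.
rewrite mulrA -exprS.
have a0 := hermite_root_gt0 n.+1; have b0 := hermite_root_gt0 n; have ab := hermite_root_le n.
have ua : n.+1%:R / hermite_root n.+1 = x - hermite_root n.+1.
  by rewrite -(hermite_root_eq h) mulrAC divff ?gt_eqF // mul1r.
have vb : n%:R / hermite_root n = x - hermite_root n.
  by rewrite -(hermite_root_eq h') mulrAC divff ?gt_eqF // mul1r.
rewrite ua vb; have eN := hermite_root_eq h; move: a0 b0 ab eN.
have xa : x - hermite_root n.+1 <= hermite_root n.+1.
  by rewrite lerBlDr /hermite_root; have := sqrtr_ge0 (x ^+ 2 - 4 * n.+1%:R); lra.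
move: xa; set a := hermite_root n.+1; set b := hermite_root n => xa a0 b0 ab eN.
have y0 : 0 <= (b - a) / a by rewrite divr_ge0 ?subr_ge0 // ltW.
have := expR_quad_le1D y0.
have -> : 1 + (b - a) / a = b / a by field; rewrite gt_eqF.
move=> le1.
have le2 : expR (n.+1%:R * ((b - a) / a - ((b - a) / a) ^+ 2 / 2)) <= (b / a) ^+ n.+1.
  by rewrite expRM_natl lerXn2r // ?nnegrE ?expR_ge0 // divr_ge0 ?ltW.
have -> : b ^+ n.+1 = a ^+ n.+1 * (b / a) ^+ n.+1.
  by rewrite -exprMn mulrC divfK // gt_eqF.
rewrite -mulrA ler_wpM2l ?exprn_ge0 ?(ltW a0) //.
apply: (@le_trans _ _ (expR (n.+1%:R * ((b - a) / a - ((b - a) / a) ^+ 2 / 2)) * expR ((x - b) ^+ 2 / 2))); last first.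
  by rewrite ler_wpM2r ?expR_ge0.
rewrite -expRD ler_expR -eN.
have -> : a * (x - a) * ((b - a) / a - ((b - a) / a) ^+ 2 / 2) =
   (x - a) * (b - a) - ((x - a) / a) * ((b - a) ^+ 2 / 2).
  by field; rewrite gt_eqF.
have : (x - a) / a <= 1 by rewrite ler_pdivrMr // mul1r.
have : 0 <= (b - a) ^+ 2 / 2 by rewrite divr_ge0 ?sqr_ge0.
nra.
Qed.

(** With [a] the root and [y = k / a^2], the squared bound is [(k * expR y / y)^k], and
    [expR (y - 1) >= y] removes the root. Nothing is lost there at [y = 1], the turning point
    [4 k = x^2]. *)
Lemma hermite_sq_ge k : (0 < k)%N -> 4 * k%:R <= x ^+ 2 ->
  k%:R ^+ k * expR k%:R <= He k ^+ 2.
Proof.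
move=> k0 h; have kp : (0 : R) < k%:R by rewrite ltr0n.
have a0 := hermite_root_gt0 k; have L := hermite_ge h.
move: (hermite_root k) a0 L => a a0 L.
apply: (@le_trans _ _ ((a ^+ k * expR ((k%:R / a) ^+ 2 / 2)) ^+ 2)); last first.
  by rewrite lerXn2r // nnegrE ?mulr_ge0 ?exprn_ge0 ?expR_ge0 ?(ltW a0) // (le_trans _ L) // mulr_ge0 ?exprn_ge0 ?expR_ge0 ?(ltW a0).
have -> : (a ^+ k * expR ((k%:R / a) ^+ 2 / 2)) ^+ 2 = (a ^+ 2 * expR (k%:R / a ^+ 2)) ^+ k.
  rewrite !exprMn -!expRM_natl; congr (_ * expR _).
  by field; rewrite gt_eqF.
rewrite -[X in expR X]mulr1 expRM_natl -exprMn lerXn2r ?nnegrE ?mulr_ge0 ?expR_ge0 ?(ltW a0) //.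
have := expR_ge1Dx (k%:R / a ^+ 2 - 1).
have -> : 1 + (k%:R / a ^+ 2 - 1) = k%:R / a ^+ 2 by ring.
rewrite expRD expRN => /(ler_wpM2r (ltW (expR_gt0 1))).
rewrite divfK ?gt_eqF ?expR_gt0 // => /(ler_wpM2l (sqr_ge0 a)).
rewrite (_ : a ^+ 2 * (k%:R / a ^+ 2 * expR 1) = k%:R * expR 1) //.
by field; rewrite gt_eqF.
Qed.

End hermite.

(** * Independent families and five-point quadrature *)

Section one_coordinate.
Context d (T : measurableType d) (R : realType) (P : probability T R)
  (mu : probability R R).
Variables (X : T -> R) (Y : T -> R) (c : R).
Hypotheses (mX : measurable_fun setT X) (mY : measurable_fun setT Y)
  (Y0 : forall w, 0 <= Y w).
Hypothesis indicE : forall A : set R, measurable A ->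
  (\int[P]_w (\1_A (X w) * Y w)%:E = mu A * c%:E)%E.

Import HBNNSimple.

Lemma integral_nnsfun_coordinate (g : {nnsfun R >-> R}) :
  (\int[P]_w (g (X w) * Y w)%:E = (\int[mu]_x (g x)%:E) * c%:E)%E.
Proof.
have mA k : measurable (g @^-1` [set k]) by exact: measurable_sfunP.
rewrite integralT_nnsfun sintegralE ge0_mule_fsuml; last first.
  by move=> k; exact: nnsfun_mulemu_ge0.
transitivity (\int[P]_w \sum_(k \in range g) (k * \1_(g @^-1` [set k]) (X w) * Y w)%:E)%E.
  apply: eq_integral => w _; rewrite fimfunE EFinM -fsumEFin // ge0_mule_fsuml //.
  by move=> k; rewrite lee_fin; exact: nnfun_muleindic_ge0.
rewrite ge0_integral_fsum //; first last.
- move=> k w _; rewrite lee_fin mulr_ge0 //; exact: nnfun_muleindic_ge0.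
- move=> k; apply/measurable_EFinP; apply: measurable_funM => //.
  apply: measurable_funM => //.
  by apply: (measurableT_comp _ mX); exact: measurable_indic.
apply: eq_fsbigr => k; rewrite inE => -[x _ <-].
transitivity (\int[P]_w ((g x)%:E * (\1_(g @^-1` [set g x]) (X w) * Y w)%:E))%E.
  by apply: eq_integral => w _; rewrite -EFinM mulrA.
rewrite ge0_integralZl_EFin //.
- by rewrite indicE // muleA.
- by move=> w _; rewrite lee_fin mulr_ge0.
- apply/measurable_EFinP; apply: measurable_funM => //.
  by apply: (measurableT_comp _ mX); exact: measurable_indic.
Qed.

(** Factorization is assumed on indicators only; simple functions and monotone convergence extend it
    to a nonnegative [f], the other coordinates being frozen in [Y]. *)
Lemma integral_ge0_coordinate (f : R -> R) : measurable_fun setT f ->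
  (forall x, 0 <= f x) ->
  (\int[P]_w (f (X w) * Y w)%:E = (\int[mu]_x (f x)%:E) * c%:E)%E.
Proof.
move=> mf f0.
have mEf : measurable_fun setT (EFin \o f) by exact/measurable_EFinP.
pose f_ := nnsfun_approx measurableT mEf.
have f_cvg x : (f_ n x)%:E @[n --> \oo] --> (f x)%:E.
  by apply: (@cvg_nnsfun_approx _ _ _ _ measurableT _ mEf) => // y _; rewrite lee_fin.
have f_nd x : {homo (fun n => (f_ n x)%:E) : n m / (n <= m)%N >-> (n <= m)%E}.
  by move=> m n mn; rewrite lee_fin; exact/lefP/nd_nnsfun_approx.
have c1 : (\int[mu]_x (f_ n x)%:E * c%:E)%E @[n --> \oo] --> ((\int[mu]_x (f x)%:E) * c%:E)%E.
  apply: cvgeZr => //.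
  have := @cvg_monotone_convergence _ _ _ mu setT measurableT (fun n x => (f_ n x)%:E).
  have -> : (\int[mu]_x limn (fun n => (f_ n x)%:E) = \int[mu]_x (f x)%:E)%E.
    by apply: eq_integral => x _; exact/cvg_lim.
  apply.
  - by move=> n; exact/measurable_EFinP.
  - by move=> n x _; rewrite lee_fin.
  - by move=> x _; exact: f_nd.
have c2 : (\int[P]_w (f_ n (X w) * Y w)%:E)%E @[n --> \oo] --> (\int[P]_w (f (X w) * Y w)%:E)%E.
  have := @cvg_monotone_convergence _ _ _ P setT measurableT (fun n w => (f_ n (X w) * Y w)%:E).
  have -> : (\int[P]_w limn (fun n => (f_ n (X w) * Y w)%:E) = \int[P]_w (f (X w) * Y w)%:E)%E.
    apply: eq_integral => w _; apply/cvg_lim => //.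
    rewrite EFinM; under eq_fun do rewrite EFinM.
    exact: cvgeZr.
  apply.
  - move=> n; apply/measurable_EFinP; apply: measurable_funM => //.
    exact: measurableT_comp.
  - by move=> n w _; rewrite lee_fin mulr_ge0.
  - move=> w _ m n mn; rewrite lee_fin ler_wpM2r //.
    by rewrite -lee_fin; exact: f_nd.
apply: (cvg_unique _ c2) => //.
have -> : (fun n => \int[P]_w (f_ n (X w) * Y w)%:E)%E = (fun n => (\int[mu]_x (f_ n x)%:E) * c%:E)%E.
  by apply/funext => n; rewrite integral_nnsfun_coordinate.
exact: c1.
Qed.

End one_coordinate.

Section independent_family.
Context d (T : measurableType d) (R : realType) (P : probability T R)
  (mu : probability R R).
Variables (I : finType) (D : {set I}) (X : I -> T -> R).
Hypotheses (mX : forall i, measurable_fun setT (X i))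
  (lawX : forall i (A : set R), measurable A -> P (X i @^-1` A) = mu A)
  (indX : mutually_independent P D X).

Definition mean (f : R -> R) : R := fine (\int[mu]_x (f x)%:E)%E.

Let admissible (h : I -> R -> R) := forall i, measurable_fun setT (h i) /\
   mu.-integrable setT (EFin \o h i).

Let meanE (f : R -> R) : mu.-integrable setT (EFin \o f) ->
  (\int[mu]_x (f x)%:E = (mean f)%:E)%E.
Proof. by move=> fi; rewrite /mean fineK //; exact: integrable_fin_num. Qed.

Let indic_admissible (A : set R) : measurable A ->
  measurable_fun setT (\1_A : R -> R) /\ mu.-integrable setT (EFin \o (\1_A : R -> R)).
Proof.
move=> mA; split; first exact: measurable_indic.
by apply: integrable_indic => //; exact: probability_fin_num.
Qed.

Let mean_indic (A : set R) : measurable A -> (mu A = (mean \1_A)%:E)%E.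
Proof.
move=> mA; rewrite -meanE; last by case: (indic_admissible mA).
by rewrite integral_indic // setIT.
Qed.

Let mprod (h : I -> R -> R) (Q : pred I) : admissible h ->
  measurable_fun setT (fun w => \prod_(i | Q i) h i (X i w)).
Proof.
move=> ah; under eq_fun do rewrite -big_filter.
elim: (seq.filter _ _) => [|i s IH].
  by under eq_fun do rewrite big_nil; exact: measurable_cst.
under eq_fun do rewrite big_cons.
apply: measurable_funM => //; apply: measurableT_comp => //.
by have [] := ah i.
Qed.

Let prod_upd (h : I -> R -> R) j (f : R -> R) w : j \in D ->
  \prod_(i in D) (if i == j then f else h i) (X i w) =
  f (X j w) * \prod_(i in D | i != j) h i (X i w).
Proof.
move=> jD; rewrite (bigD1 j) //= eqxx; congr (_ * _).
by apply: eq_bigr => i /andP[_ /negbTE ->].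
Qed.

Let mean_upd (h : I -> R -> R) j (f : R -> R) : j \in D ->
  \prod_(i in D) mean (if i == j then f else h i) =
  mean f * \prod_(i in D | i != j) mean (h i).
Proof.
move=> jD; rewrite (bigD1 j) //= eqxx; congr (_ * _).
by apply: eq_bigr => i /andP[_ /negbTE ->].
Qed.

Let upd_id (h : I -> R -> R) j : (fun i => if i == j then h j else h i) = h.
Proof. by apply/funext => i; case: eqP => [->|]. Qed.

Let admissible_upd h j f : admissible h ->
  measurable_fun setT f /\ mu.-integrable setT (EFin \o f) ->
  admissible (fun i => if i == j then f else h i).
Proof. by move=> ah af i; case: eqP => // _; exact: ah. Qed.

Let indep_indic (A : I -> set R) : (forall i, measurable (A i)) ->
  (\int[P]_w (\prod_(i in D) \1_(A i) (X i w))%:E = (\prod_(i in D) mean \1_(A i))%:E)%E.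
Proof.
move=> mA; have mB i : measurable (X i @^-1` A i).
  by rewrite -[X in measurable X]setTI; exact: mX.
have mcap : measurable (\bigcap_(i in [set` D]) X i @^-1` A i).
  by apply: fin_bigcap_measurable => //; exact: finite_finset.
transitivity (\int[P]_w (\1_(\bigcap_(i in [set` D]) X i @^-1` A i) w)%:E)%E.
  apply: eq_integral => w _; congr (_%:E).
  rewrite indicE; case: (boolP (w \in _)) => [|wn].
    rewrite inE => wA; rewrite big1 // => i iD.
    by rewrite indicE mem_set //; exact: wA.
  apply/eqP; rewrite prodf_seq_eq0; apply/hasP.
  have [i iD iA] : exists2 i, i \in D & ~ A i (X i w).
    apply: contrapT => H; move/negP: wn; apply; rewrite inE => i /= iD.
    by apply: contrapT => iA; apply: H; exists i.
  exists i; first by rewrite mem_index_enum.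
  by rewrite iD /= indicE memNset.
rewrite integral_indic // setIT.
transitivity (\prod_(i in D) P (X i @^-1` A i))%E; first by apply: indX.
rewrite [RHS](big_morph EFin (@EFinM R) (erefl _)).
by apply: eq_bigr => i _; rewrite lawX // mean_indic.
Qed.

(** Functions are freed one coordinate at a time: outside [s] they are still indicators, and the
    step applies the one-coordinate result with [Y] the product of the others. *)
Let indep_ge0 (s : seq I) (h : I -> R -> R) : admissible h ->
  (forall i x, 0 <= h i x) ->
  (forall i, i \notin s -> exists2 A, measurable A & h i = \1_A) ->
  (\int[P]_w (\prod_(i in D) h i (X i w))%:E = (\prod_(i in D) mean (h i))%:E)%E.
Proof.
elim: s h => [|j s IH] h ah h0 hi.
  have [A AE] : {A : I -> set R & forall i, measurable (A i) /\ h i = \1_(A i)}.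
    apply: (@boolp.choice _ _ (fun i A => measurable A /\ h i = \1_A)).
    by move=> i; have [A mA AE] := hi i isT; exists A.
  have -> : h = fun i => \1_(A i) by apply/funext => i; have [] := AE i.
  by apply: indep_indic => i; have [] := AE i.
pose hA (A : set R) := fun i => if i == j then \1_A else h i.
have HA A : measurable A ->
   (\int[P]_w (\prod_(i in D) hA A i (X i w))%:E = (\prod_(i in D) mean (hA A i))%:E)%E.
  move=> mA; apply: IH.
  - by apply: admissible_upd => //; exact: indic_admissible.
  - by move=> i x; rewrite /hA; case: ifP.
  - move=> i is_; rewrite /hA; case: eqP => [_|ij]; first by exists A.
    by apply: hi; rewrite inE negb_or is_ andbT; apply/eqP.
case: (boolP (j \in D)) => jD; last first.
  have Dj i : i \in D -> (i == j) = false.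
    by move=> iD; apply/eqP => ij; move: jD; rewrite -ij iD.
  have := HA setT measurableT.
  have -> : \prod_(i in D) mean (hA setT i) = \prod_(i in D) mean (h i).
    by apply: eq_bigr => i iD; rewrite /hA Dj.
  move=> <-; apply: eq_integral => w _; congr (_%:E).
  by apply: eq_bigr => i iD; rewrite /hA Dj.
rewrite -(upd_id h j) mean_upd // EFinM -meanE; last by have [] := ah j.
rewrite -(@integral_ge0_coordinate _ _ _ P mu (X j) (fun w => \prod_(i in D | i != j) h i (X i w))) //.
- by apply: eq_integral => w _; rewrite prod_upd.
- exact: mprod.
- by move=> w; rewrite prodr_ge0.
- move=> A mA; have := HA A mA; rewrite mean_upd // EFinM -mean_indic // => <-.
  by apply: eq_integral => w _; rewrite prod_upd.
- by have [] := ah j.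
Qed.

(** The same scheme for signs: outside [s] the functions are nonnegative, and freeing [j] splits
    [h j] into the parts [hp] and [hn], to which the induction applies separately. *)
Let indep_all (s : seq I) (h : I -> R -> R) : admissible h ->
  (forall i, i \notin s -> forall x, 0 <= h i x) ->
  P.-integrable setT (fun w => (\prod_(i in D) h i (X i w))%:E) /\
  (\int[P]_w (\prod_(i in D) h i (X i w))%:E = (\prod_(i in D) mean (h i))%:E)%E.
Proof.
elim: s h => [|j s IH] h ah h0.
  have e : (\int[P]_w (\prod_(i in D) h i (X i w))%:E = (\prod_(i in D) mean (h i))%:E)%E.
    apply: (@indep_ge0 (enum I)) => // [i x|i]; first exact: h0.
    by rewrite mem_enum.
  split => //; apply/integrableP; split; first by apply/measurable_EFinP; exact: mprod.
  rewrite (eq_integral (fun w => (\prod_(i in D) h i (X i w))%:E)) => [|w _].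
    by rewrite e ltry.
  by rewrite gee0_abs // lee_fin prodr_ge0 // => i _; exact: h0.
case: (boolP (j \in D)) => jD; last first.
  have Dj i : i \in D -> (i == j) = false.
    by move=> iD; apply/eqP => ij; move: jD; rewrite -ij iD.
  have [] := IH (fun i => if i == j then \1_setT else h i).
  - by apply: admissible_upd => //; exact: indic_admissible.
  - move=> i is_ x; case: eqP => // /eqP ij; apply: h0.
    by rewrite inE negb_or ij.
  have -> : (fun w => (\prod_(i in D) (if i == j then \1_setT else h i) (X i w))%:E) =
     (fun w => (\prod_(i in D) h i (X i w))%:E).
    by apply/funext => w; congr (_%:E); apply: eq_bigr => i /Dj ->.
  have -> // : \prod_(i in D) mean (if i == j then \1_setT else h i) = \prod_(i in D) mean (h i).
  by apply: eq_bigr => i /Dj ->.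
pose hp x := (`|h j x| + h j x) / 2.
pose hn x := (`|h j x| - h j x) / 2.
have [mh ih] := ah j.
have mnh : measurable_fun setT (fun x => `|h j x|) by exact: measurableT_comp.
have ip : mu.-integrable setT (EFin \o hp).
  rewrite (_ : EFin \o hp = (fun x => (2^-1)%:E * (`|(h j x)%:E| + (h j x)%:E))%E).
    apply: integrableZl => //; apply: integrableD => //; exact: integrable_abse.
  by apply/funext => x; rewrite /hp /= -EFinD -EFinM mulrC.
have in_ : mu.-integrable setT (EFin \o hn).
  rewrite (_ : EFin \o hn = (fun x => (2^-1)%:E * (`|(h j x)%:E| - (h j x)%:E))%E).
    apply: integrableZl => //; apply: integrableB => //; exact: integrable_abse.
  by apply/funext => x; rewrite /hn /= -EFinB -EFinM mulrC.
have mp : measurable_fun setT hp by apply: measurable_funM => //; exact: measurable_funD.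
have mn : measurable_fun setT hn by apply: measurable_funM => //; exact: measurable_funB.
have hE x : h j x = hp x - hn x by rewrite /hp /hn; field.
have hp0 x : 0 <= hp x by rewrite /hp; have := ler_norm (- h j x); rewrite normrN; lra.
have hn0 x : 0 <= hn x by rewrite /hn; have := ler_norm (h j x); lra.
have [||Ip Ep] := IH (fun i => if i == j then hp else h i).
- exact: admissible_upd.
- move=> i is_ x; case: eqP => // /eqP ij; apply: h0.
  by rewrite inE negb_or ij.
have [||In En] := IH (fun i => if i == j then hn else h i).
- exact: admissible_upd.
- move=> i is_ x; case: eqP => // /eqP ij; apply: h0.
  by rewrite inE negb_or ij.
have e : (fun w => (\prod_(i in D) h i (X i w))%:E) =
  (fun w => (\prod_(i in D) (if i == j then hp else h i) (X i w))%:E -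
            (\prod_(i in D) (if i == j then hn else h i) (X i w))%:E)%E.
  apply/funext => w; rewrite -EFinB !prod_upd // -mulrBl -hE -(prod_upd h (h j)) //.
  by congr (_%:E); apply: eq_bigr => i _; case: eqP => [->|].
rewrite e; split; first exact: integrableB.
rewrite integralB // Ep En -EFinB !mean_upd // -mulrBl.
have -> : mean hp - mean hn = mean (h j).
  apply/eqP; rewrite -eqe EFinB -!meanE // -integralB //; apply/eqP.
  by apply: eq_integral => x _; rewrite -EFinB -hE.
by congr (_%:E); rewrite -mean_upd //; apply: eq_bigr => i _; case: eqP => [->|].
Qed.

Lemma integral_prod_independent (h : I -> R -> R) :
  (forall i, measurable_fun setT (h i)) ->
  (forall i, mu.-integrable setT (EFin \o h i)) ->
  P.-integrable setT (fun w => (\prod_(i in D) h i (X i w))%:E) /\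
  (\int[P]_w (\prod_(i in D) h i (X i w))%:E = (\prod_(i in D) mean (h i))%:E)%E.
Proof.
move=> mh ih; apply: (@indep_all (enum I)) => i; first by split.
by rewrite mem_enum.
Qed.

End independent_family.

(** * Finiteness of the fourth moment under subexponential tails *)

Section fourth_moment.
Variables (R : realType) (mu : probability R R).

Lemma sum_geometric_le (q : R) n : 0 <= q < 1 -> \sum_(0 <= i < n) q ^+ i <= (1 - q)^-1.
Proof.
move=> /andP[q0 q1]; rewrite -[leRHS]mul1r ler_pdivlMr ?subr_gt0 //.
have -> : (\sum_(0 <= i < n) q ^+ i) * (1 - q) = 1 - q ^+ n.
  elim: n => [|n IH]; first by rewrite big_nil mul0r expr0 subrr.
  by rewrite big_nat_recr //= mulrDl IH exprS; ring.
by rewrite gerBl exprn_ge0.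
Qed.

(** [y^(K+1) / (K+1)! <= expR y] at [y = (n + 2) / 2]; half of the exponential decay survives as a
    geometric ratio. *)
Lemma pow_le_expR (K n : nat) :
  n.+2%:R ^+ K.+1 * expR (- n.+1%:R) <= (K.+1)`!%:R * 2 ^+ K.+1 * expR (- 2^-1) ^+ n :> R.
Proof.
have h : 0 <= n.+2%:R / 2 :> R by rewrite divr_ge0.
have := expR_ge1Dxn K h; set f := (K.+1)`!%:R.
have f0 : 0 < f :> R by rewrite /f ltr0n fact_gt0.
move=> le1; have {}le1 : (n.+2%:R / 2) ^+ K.+1 <= f * expR (n.+2%:R / 2) :> R.
  rewrite -ler_pdivrMl // mulrC (le_trans _ le1) // lerDr //.
rewrite (_ : n.+2%:R ^+ K.+1 = 2 ^+ K.+1 * (n.+2%:R / 2) ^+ K.+1); last first.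
  by rewrite -exprMn mulrC divfK.
rewrite mulrAC [f * _]mulrC -!mulrA ler_wpM2l ?exprn_ge0 // mulrC.
apply: le_trans (ler_wpM2r (expR_ge0 _) le1) _.
rewrite -mulrA ler_wpM2l ?(ltW f0) // -expRD -expRM_natl ler_expR.
by rewrite -[n.+2%:R]natr1 -[n.+1%:R]natr1; lra.
Qed.

(** If [n + 1] is the integer part of [|x|^(1 / al)], then [(n + 1)^al <= |x| < (n + 2)^al], so
    [x^4 <= (n + 2)^(K + 1)] once [K + 1 >= 4 al]. Summing these terms over all [n] gives a majorant
    whose integral the tail bound makes finite; integer part 0 accounts for the constant 1. *)
Lemma integrable_pow4 : subexponential_tails mu ->
  mu.-integrable setT (fun x : R => (x ^+ 4)%:E).
Proof.
move=> [al [be [al0 be0 tail]]].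
pose K := (Num.bound (al * 4)).
have HK : al * 4 <= K.+1%:R.
  apply: (@le_trans _ _ K%:R); last by rewrite ler_nat.
  by apply: ltW; apply: archi_boundP; rewrite mulr_ge0 // ltW.
pose S (n : nat) := [set x : R | n.+1%:R `^ al <= `|x|].
have mS n : measurable (S n).
  have -> : S n = (fun x : R => `|x|) @^-1` `[n.+1%:R `^ al, +oo[.
    by apply/seteqP; split => x /=; rewrite in_itv /= andbT.
  by rewrite -[X in measurable X]setTI; exact: normr_measurable.
pose u (n : nat) (x : R) : \bar R := (n.+2%:R ^+ K.+1 * \1_(S n) x)%:E.
have u0 n x : (0 <= u n x)%E by rewrite lee_fin mulr_ge0 // exprn_ge0.
have mu_ n : measurable_fun setT (u n).
  by apply/measurable_EFinP; apply: measurable_funM => //; exact: measurable_indic.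
have pw x : ((x ^+ 4)%:E <= 1%:E + \sum_(n <oo) u n x)%E.
  pose y := `|x|; have y0 : 0 <= y by exact: normr_ge0.
  have -> : x ^+ 4 = y ^+ 4 by rewrite /y -normrX ger0_norm // exprn_even_ge0.
  have p0 : 0 <= y `^ al^-1 by exact: powR_ge0.
  have /andP[m1 m2] := truncn_itv p0.
  have yE : y = (y `^ al^-1) `^ al by rewrite -powRrM mulVf ?gt_eqF // powRr1.
  have y4 : y ^+ 4 <= (Num.truncn (y `^ al^-1)).+1%:R ^+ K.+1.
    apply: (@le_trans _ _ (((Num.truncn (y `^ al^-1)).+1%:R `^ al) ^+ 4)).
      rewrite lerXn2r ?nnegrE ?powR_ge0 // yE.
      by apply: ge0_ler_powR; rewrite ?nnegrE ?(ltW al0) // -?yE ltW.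
    rewrite -powR_mulrn ?powR_ge0 // -powRrM -[leRHS]powR_mulrn //.
    by rewrite ler_powR // ler1n.
  move: m1 m2 y4; set m := Num.truncn _; case: m => [|n] m1 m2 y4.
    rewrite expr1n in y4; rewrite -[leLHS]adde0; apply: leeD.
      by rewrite lee_fin.
    by apply: nneseries_ge0 => n _ _; exact: u0.
  rewrite -[leLHS]add0e; apply: leeD; first by rewrite lee_fin.
  apply: (@le_trans _ _ (\sum_(0 <= i < n.+1) u i x)%E); last first.
    by apply: nneseries_lim_ge => i _ _; exact: u0.
  rewrite big_nat_recr //=; apply: (@le_trans _ _ (u n x)).
    have Sx : S n x.
      by rewrite /S /= -/y yE; apply: ge0_ler_powR; rewrite ?nnegrE ?(ltW al0).
    by rewrite lee_fin indicE mem_set // mulr1.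
  by rewrite leeDr // sume_ge0 // => i _; exact: u0.
have msum : measurable_fun setT (fun x => \sum_(n <oo) u n x)%E.
  exact: (@ge0_emeasurable_sum _ _ _ setT u xpredT).
apply/integrableP; split.
  by apply/measurable_EFinP; exact: measurable_funX.
pose C := be * (K.+1)`!%:R * 2 ^+ K.+1.
have C0 : 0 <= C by rewrite /C mulr_ge0 ?exprn_ge0 // mulr_ge0 // ltW.
pose q : R := expR (- 2^-1).
have q01 : 0 <= q < 1.
  rewrite /q expR_ge0 expR_lt1 oppr_lt0 invr_gt0.
  by rewrite ltr0n.
apply: (@le_lt_trans _ _ (1%:E + (C / (1 - q))%:E)%E); last by rewrite -EFinD ltry.
apply: (@le_trans _ _ (\int[mu]_x (1%:E + \sum_(n <oo) u n x))%E).
  apply: ge0_le_integral => //.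
  - by apply/measurable_EFinP; apply: measurableT_comp => //; exact: measurable_funX.
  - exact: (emeasurable_funD (measurable_cst (1%:E : \bar R)) msum).
  - by move=> x _; rewrite /= ger0_norm ?exprn_even_ge0 //; exact: pw.
rewrite ge0_integralD //; first last.
- by move=> x _; exact: nneseries_ge0.
apply: leeD.
  by rewrite integral_cst // mul1e; exact: probability_le1.
rewrite integral_nneseries //.
apply: lime_le.
  apply: is_cvg_nneseries => n _ _; exact: integral_ge0.
apply: nearW => n; apply: (@le_trans _ _ (\sum_(0 <= i < n) (C * q ^+ i)%:E)%E).
  apply: lee_sum => i _; rewrite /u.
  under eq_integral do rewrite EFinM.
  rewrite ge0_integralZl_EFin //; first last.
    by apply/measurable_EFinP; exact: measurable_indic.
  rewrite integral_indic // setIT.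
  apply: (@le_trans _ _ ((i.+2%:R ^+ K.+1)%:E * (be * expR (- i.+1%:R))%:E)%E).
    by rewrite lee_wpmul2l ?lee_fin ?exprn_ge0 //; exact: tail.
  have -> : C * q ^+ i = be * ((K.+1)`!%:R * 2 ^+ K.+1 * q ^+ i) by rewrite /C; ring.
  by rewrite -EFinM lee_fin mulrCA ler_wpM2l ?(ltW be0) // pow_le_expR.
rewrite sumEFin lee_fin -mulr_sumr ler_wpM2l //; exact: sum_geometric_le.
Qed.

End fourth_moment.

(** * Lagrange interpolation, the source of the quadrature weights *)

Section lagrange.
Variable F : fieldType.
Variables (n : nat) (node : 'I_n -> F).
Hypothesis node_inj : injective node.

Definition lagrange_poly (a : 'I_n) : {poly F} :=
  \prod_(b | b != a) ((node a - node b)^-1 *: ('X - (node b)%:P)).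

Lemma lagrange_poly_node a b : (lagrange_poly a).[node b] = (a == b)%:R.
Proof.
rewrite /lagrange_poly horner_prod; case: eqVneq => [<-|ab].
  rewrite big1 // => c ca; rewrite hornerZ hornerXsubC mulVf //.
  by rewrite subr_eq0 (inj_eq node_inj) eq_sym.
by rewrite (bigD1 b) 1?eq_sym //= hornerZ hornerXsubC subrr mulr0 mul0r.
Qed.

Lemma size_lagrange_poly a : (size (lagrange_poly a) <= n)%N.
Proof.
rewrite /lagrange_poly; apply: leq_trans (size_poly_prod_leq _ _) _.
rewrite leq_subLR.
apply: (@leq_trans (\sum_(b | b != a) 2 + 1)%N).
  rewrite -addn1 leq_add2r; apply: leq_sum => b _.
  by rewrite (leq_trans (size_scale_leq _ _)) // size_XsubC.
rewrite sum_nat_const cardC1 card_ord; case: n a => [[]//|m] a; lia.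
Qed.

Lemma lagrange_interp (p : {poly F}) : (size p <= n)%N ->
  p = \sum_a p.[node a] *: lagrange_poly a.
Proof.
move=> sp; apply/eqP; rewrite -subr_eq0; apply/eqP.
apply: (@roots_geq_poly_eq0 _ _ [seq node a | a <- enum 'I_n]).
- apply/allP => y /mapP[b _ ->]; rewrite /root hornerD hornerN horner_sum.
  rewrite (bigD1 b) //= hornerZ lagrange_poly_node eqxx mulr1 big1 ?addr0 ?subrr // => a ab.
  by rewrite hornerZ lagrange_poly_node (negbTE ab) mulr0.
- by rewrite map_inj_uniq ?enum_uniq.
- rewrite size_map size_enum_ord (leq_trans (size_polyD _ _)) // geq_max sp size_polyN.
  apply: leq_trans (size_sum _ _ _) _; apply/bigmax_leqP => a _.
  by rewrite (leq_trans (size_scale_leq _ _)) // size_lagrange_poly.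
Qed.

End lagrange.

Section moments.
Variables (R : realType) (mu : probability R R).
Hypotheses (hcent : centered mu) (hvar : unit_variance mu)
    (htail : subexponential_tails mu).

Lemma integrable_pow k : (k <= 4)%N -> mu.-integrable setT (fun x : R => (x ^+ k)%:E).
Proof.
move=> k4; apply: (@le_integrable _ _ _ mu setT measurableT _ (fun x => (1 + x ^+ 4)%:E)).
- by apply/measurable_EFinP; exact: measurable_funX.
- move=> x _; rewrite lee_fin [leRHS]ger0_norm ?addr_ge0 ?exprn_even_ge0 // normrX.
  have -> : x ^+ 4 = `|x| ^+ 4 by rewrite -normrX ger0_norm // exprn_even_ge0.
  have [x1|x1] := leP `|x| 1.
    by rewrite (le_trans (exprn_ile1 _ _ _)) // lerDl exprn_ge0.
  rewrite (le_trans (_ : _ <= `|x| ^+ 4)) ?lerDr //.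
  by rewrite ler_weXn2l // ltW.
- rewrite (_ : (fun x : R => (1 + x ^+ 4)%:E) = (cst 1%:E \+ (fun x : R => (x ^+ 4)%:E))%E) //.
  apply: integrableD => //; first exact: finite_measure_integrable_cst.
  exact: integrable_pow4.
Qed.

(** Test functions against which polynomials are integrated: the constant 1 for plain moments, the
    sign for the marked entry. *)
Definition bounded1 (h : R -> R) := measurable_fun setT h /\ forall x, `|h x| <= 1.

Lemma integrable_poly (p : {poly R}) h : (size p <= 5)%N -> bounded1 h ->
  mu.-integrable setT (fun x : R => (p.[x] * h x)%:E).
Proof.
move=> sp [mh h1].
have mp : measurable_fun setT (fun x : R => p.[x]).
  by apply: continuous_measurable_fun; exact: continuous_horner.
apply: (@le_integrable _ _ _ mu setT measurableT _ (fun x => (p.[x])%:E)).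
- by apply/measurable_EFinP; exact: measurable_funM.
- by move=> x _; rewrite lee_fin normrM ler_piMr.
rewrite (_ : (fun x : R => _) = (fun x => \sum_(i < size p) (p`_i)%:E * (x ^+ i)%:E)%E); last first.
  by apply/funext => x; rewrite horner_coef -sumEFin; apply: eq_bigr => i _; rewrite EFinM.
apply: integrable_sum => // i _; apply: integrableZl => //; apply: integrable_pow.
by rewrite -ltnS (leq_trans (ltn_ord i)).
Qed.

Definition node (a : 'I_5) : R := (a : nat)%:R.

Lemma node_inj : injective node.
Proof. by move=> a b /eqP; rewrite eqr_nat => /eqP/val_inj. Qed.

(* Quadrature weights reproducing the integral of p * h for every polynomial p of
   degree at most 4. *)
Definition quad_weight (h : R -> R) (a : 'I_5) : R := mean mu (fun x => (lagrange_poly node a).[x] * h x).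

Lemma mean_poly (p : {poly R}) h : (size p <= 5)%N -> bounded1 h ->
  mean mu (fun x => p.[x] * h x) = \sum_a quad_weight h a * p.[node a].
Proof.
move=> sp bh; rewrite [in LHS](lagrange_interp node_inj sp) /mean.
have il a : mu.-integrable setT (fun x : R => ((lagrange_poly node a).[x] * h x)%:E).
  by apply: integrable_poly => //; exact: size_lagrange_poly.
rewrite (eq_integral (fun x => \sum_a (p.[node a])%:E * ((lagrange_poly node a).[x] * h x)%:E)%E); last first.
  move=> x _; rewrite horner_sum mulr_suml -sumEFin; apply: eq_bigr => a _.
  by rewrite -EFinM hornerZ mulrA.
rewrite integral_sum // => [|a]; last exact: integrableZl.
rewrite (eq_bigr (fun a => (quad_weight h a * p.[node a])%:E)) => [|a _]; first by rewrite sumEFin.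
rewrite integralZl // EFinM muleC /quad_weight /mean fineK //; exact: integrable_fin_num.
Qed.

Lemma bounded1_cst : bounded1 (cst 1).
Proof. by split=> [|x]; [exact: measurable_cst | rewrite normr1]. Qed.

Definition sgn1 (x : R) : R := 2 * \1_(`[0, +oo[ : set R) x - 1.

Lemma bounded1_sgn1 : bounded1 sgn1.
Proof.
split=> [|x]; last first.
  by rewrite /sgn1 indicE; case: (_ \in _); rewrite /= ?mulr1 ?mulr0 ?sub0r ?normrN ?normr1 // (_ : 2 - 1 = 1) ?normr1 //; ring.
apply: measurable_funB => //; apply: measurable_funM => //; exact: measurable_indic.
Qed.

Lemma sgn1M x : x * sgn1 x = `|x|.
Proof.
rewrite /sgn1 indicE; have [x0|x0] := leP 0 x.
  by rewrite mem_set /= ?in_itv /= ?x0 // ger0_norm //; ring.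
by rewrite memNset /= ?in_itv /= ?andbT; [rewrite ltr0_norm //; ring | apply/negP; rewrite -ltNge].
Qed.

Lemma mean_id : mean mu (fun x => x) = 0.
Proof. by move: hcent; rewrite /centered unlock /mean => ->. Qed.

Lemma mean_sqr : mean mu (fun x => x ^+ 2) = 1.
Proof.
move: hvar; rewrite /unit_variance /variance covariance.unlock /=.
have -> : ('E_mu[idfun])%E = 0%E by exact: hcent.
rewrite unlock /mean /= => e; rewrite -[RHS](_ : fine 1%E = 1) // -e; congr fine.
apply: eq_integral => x _.
by rewrite !fctE /= subr0 expr2.
Qed.

Lemma mean1 : mean mu (fun x => 1) = 1.
Proof. rewrite /mean integral_cst // mul1e.
exact: (congr1 fine (@probability_setT _ _ _ mu)). Qed.

Lemma quad_weight_sum : \sum_a quad_weight (cst 1) a = 1.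
Proof.
have /(_ 1) := mean_poly _ bounded1_cst; rewrite size_poly1 => /(_ isT).
under eq_bigr do rewrite hornerC mulr1.
by move=> <-; rewrite -[RHS]mean1; congr mean; apply/funext => x; rewrite hornerC mulr1.
Qed.

Lemma quad_weight_mean : \sum_a quad_weight (cst 1) a * node a = 0.
Proof.
have /(_ 'X) := mean_poly _ bounded1_cst; rewrite size_polyX => /(_ isT).
under eq_bigr do rewrite hornerX.
by move=> <-; rewrite -[RHS]mean_id; congr mean; apply/funext => x; rewrite hornerX mulr1.
Qed.

Lemma quad_weight_var : \sum_a quad_weight (cst 1) a * node a ^+ 2 = 1.
Proof.
have /(_ 'X^2) := mean_poly _ bounded1_cst; rewrite size_polyXn => /(_ isT).
under eq_bigr do rewrite hornerXn.
by move=> <-; rewrite -[RHS]mean_sqr; congr mean; apply/funext => x; rewrite hornerXn mulr1.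
Qed.

Lemma quad_weight_sgn1_mean : \sum_a quad_weight sgn1 a * node a = mean mu (fun x => `|x|).
Proof.
have /(_ 'X) := mean_poly _ bounded1_sgn1; rewrite size_polyX => /(_ isT).
under eq_bigr do rewrite hornerX.
by move=> <-; congr mean; apply/funext => x; rewrite hornerX sgn1M.
Qed.

Lemma quad_weight_sgn1_sum : `|\sum_a quad_weight sgn1 a| <= 1.
Proof.
have /(_ 1) := mean_poly _ bounded1_sgn1; rewrite size_poly1 => /(_ isT).
under eq_bigr do rewrite hornerC mulr1.
move=> <-; rewrite /mean.
have i1 : mu.-integrable setT (fun x : R => (1.[x] * sgn1 x)%:E).
  by apply: integrable_poly; rewrite ?size_poly1 //; exact: bounded1_sgn1.
rewrite -lee_fin -abse_EFin fineK ?integrable_fin_num //.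
apply: le_trans (le_abse_integral _ _ _) _ => //; first by case/integrableP: i1.
apply: (@le_trans _ _ (\int[mu]_x (1%:E : \bar R)))%E; last first.
  by rewrite integral_cst // mul1e; exact: probability_le1.
apply: ge0_le_integral => //.
- by apply: measurableT_comp => //; case/integrableP: i1.
- by move=> x _; rewrite lee_fin hornerC mul1r; exact: bounded1_sgn1.2.
Qed.

(** Pointwise [x^2 <= t |x| + t^(-2) x^4]: the first term suffices for [|x| <= t], the second
    beyond. With variance 1, fourth moment [m] and [t = 2 m + 2], the last term integrates to less
    than 1, which leaves a positive share for [|x|]. *)
Lemma mean_abs_gt0 : 0 < mean mu (fun x => `|x|).
Proof.
pose m := mean mu (fun x => x ^+ 4).
have i1 : mu.-integrable setT (fun x : R => `|x|%:E).
  by have := integrable_abse (integrable_pow (isT : (1 <= 4)%N)).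
have i4 := integrable_pow (isT : (4 <= 4)%N).
have i2 := integrable_pow (isT : (2 <= 4)%N).
have m0 : 0 <= m.
  by apply: fine_ge0; apply: integral_ge0 => x _; rewrite lee_fin exprn_even_ge0.
pose t := 2 * m + 2.
have t0 : 0 < t by rewrite /t ltr_wpDl // mulr_ge0.
have : (\int[mu]_x (x ^+ 2)%:E <= \int[mu]_x (t%:E * `|x|%:E + (t ^- 2)%:E * (x ^+ 4)%:E))%E.
  apply: ge0_le_integral => //.
  - by move=> x _; rewrite lee_fin sqr_ge0.
  - by case/integrableP : i2.
  - by apply: emeasurable_funD; apply: measurable_funeM;
      [case/integrableP: i1|case/integrableP: i4].
  - move=> x _; rewrite -!EFinM -EFinD lee_fin.
    have -> : x ^+ 4 = (x ^+ 2) ^+ 2 by rewrite -exprM.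
    rewrite -(real_normK (num_real x)); have := normr_ge0 x; set y := `|x| => y0.
    have [yt|ty] := leP y t.
      rewrite -[leLHS]addr0; apply: lerD; first by rewrite [leLHS]expr2 ler_wpM2r.
      by rewrite mulr_ge0 ?invr_ge0 ?exprn_ge0 // ltW.
    rewrite -[leLHS]add0r; apply: lerD; first by rewrite mulr_ge0 // ltW.
    rewrite ler_pdivlMl ?exprn_gt0 // [in leRHS]expr2 ler_wpM2r ?exprn_ge0 //.
    by rewrite lerXn2r ?nnegrE ?(ltW t0) // ltW.
rewrite integralD //; [|exact: integrableZl..].
rewrite !integralZl //.
have fK f : mu.-integrable setT (EFin \o f) -> (\int[mu]_x (f x)%:E = (mean mu f)%:E)%E.
  by move=> fi; rewrite /mean fineK //; exact: integrable_fin_num.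
rewrite (fK _ i2) (fK _ i1) (fK _ i4) mean_sqr -/m -!EFinM -EFinD lee_fin => le1.
have : t ^- 2 * m < 1.
  rewrite mulrC ltr_pdivrMr ?exprn_gt0 // mul1r /t; nra.
move=> lt1; rewrite -(pmulr_rgt0 _ t0); lra.
Qed.

End moments.

(** * Determinant moments of a Wigner matrix *)

Lemma set2_eq (T : finType) (a b c d : T) :
  [set a; b]%SET = [set c; d]%SET -> (a = c /\ b = d) \/ (a = d /\ b = c).
Proof.
move=> e.
have : a \in [set c; d]%SET by rewrite -e !inE eqxx.
have : b \in [set c; d]%SET by rewrite -e !inE eqxx orbT.
have : c \in [set a; b]%SET by rewrite e !inE eqxx.
have : d \in [set a; b]%SET by rewrite e !inE eqxx orbT.
rewrite !inE => /orP[]/eqP e1 /orP[]/eqP e2 /orP[]/eqP e3 /orP[]/eqP e4;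
  first [by left; split; congruence | by right; split; congruence].
Qed.

Section determinant_expansion.
Variables (R : comNzRingType) (n : nat) (x : R).

Definition pair_mx (y : {set 'I_n} -> R) : 'M[R]_n :=
  \matrix_(i, j) (y [set i; j]%SET - x *+ (i == j)).

(* The factor contributed by the entries labelled [B] to the Leibniz term of [s]. *)
Definition det_factor (s : 'S_n) (B : {set 'I_n}) : {poly R} :=
  \prod_(i | [set i; s i]%SET == B) ('X - (x *+ (i == s i))%:P).

(** The entries (i,j) and (j,i) read the same variable, so the factors of a Leibniz term are grouped
    by unordered pair, each group being a polynomial in one variable. *)
Lemma det_pair_mx (y : {set 'I_n} -> R) :
  \det (pair_mx y) = \sum_(s : 'S_n) (-1) ^+ s * \prod_B (det_factor s B).[y B].
Proof.
apply: eq_bigr => s _; congr (_ * _).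
rewrite (partition_big (fun i => [set i; s i]%SET) xpredT) //=.
apply: eq_bigr => B _; rewrite /det_factor horner_prod.
by apply: eq_bigr => i /eqP <-; rewrite mxE hornerXsubC.
Qed.

(** An index contributing to the label [B] belongs to [B], which has at most two elements; both
    contribute when [s] exchanges them. *)
Lemma size_det_factor s B : (size (det_factor s B) <= 3)%N.
Proof.
rewrite /det_factor -big_filter.
rewrite -(big_map (fun i => x *+ (i == s i)) xpredT (fun z => 'X - z%:P)).
rewrite size_prod_XsubC size_map size_filter ltnS.
have -> : count (fun i => [set i; s i]%SET == B) (index_enum 'I_n) =
  #|[set i | [set i; s i]%SET == B]%SET|.
  by rewrite -sum1_card -sum1_count; apply: eq_bigl => i; rewrite inE.
have [[i0 i0B]|no] := pselect (exists i, [set i; s i]%SET == B).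
  apply: (@leq_trans #|B|); last by rewrite -(eqP i0B) cards2; case: (_ != _).
  apply: subset_leq_card; apply/fintype.subsetP => i; rewrite inE => /eqP <-.
  by rewrite !inE eqxx.
rewrite (_ : [set i | _]%SET = finset.set0) ?cards0 //.
apply/finset.setP => i; rewrite !inE; apply/negP => iB; apply: no; by exists i.
Qed.

Definition edge (p : 'I_n * 'I_n) : {set 'I_n} := [set p.1; p.2]%SET.

Definition sorted_pairs : {set 'I_n * 'I_n} := [set p : 'I_n * 'I_n | (p.1 <= p.2)%N]%SET.

Lemma edge_inj : {in sorted_pairs &, injective edge}.
Proof.
move=> [a b] [c d]; rewrite !inE /= => ab cd /set2_eq /= [[-> ->]//|[ad bc]].
move: ab cd; rewrite ad bc => h1 h2; have := anti_leq (introT andP (conj h1 h2)).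
by move/ord_inj => ->.
Qed.

Lemma edge_sorted i j : [set i; j]%SET \in edge @: sorted_pairs.
Proof.
case: (leqP i j) => ij.
  by apply/imsetP; exists (i, j) => //; rewrite inE.
by apply/imsetP; exists (j, i); [rewrite inE ltnW | exact: finset.setUC].
Qed.

Lemma det_factor1 s B : B \notin edge @: sorted_pairs -> det_factor s B = 1.
Proof.
move=> bmx; rewrite /det_factor big_pred0 // => i; apply/eqP => iB.
by move: bmx; rewrite -iB edge_sorted.
Qed.

Lemma prod_edges (G : {set 'I_n} -> R) :
  (forall B, B \notin edge @: sorted_pairs -> G B = 1) ->
  \prod_B G B = \prod_(p in sorted_pairs) G (edge p).
Proof.
move=> G1; rewrite (bigID (mem (edge @: sorted_pairs))) /=.
by rewrite [X in _ * X]big1 // mulr1 big_imset //; exact: edge_inj.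
Qed.

End determinant_expansion.

Section wigner_expectation.
Context d (T : measurableType d) (R : realType) (P : probability T R)
  (mu : probability R R) (n : nat) (W : T -> 'M[R]_n).
Hypotheses (hcent : centered mu) (hvar : unit_variance mu)
    (htail : subexponential_tails mu) (hW : is_wigner mu P W).
Variable x : R.

Let X (p : 'I_n * 'I_n) (w : T) : R := Num.sqrt n%:R * W w p.1 p.2.

Let mX p : measurable_fun setT (X p).
Proof.
have [mW _ _ _] := hW; apply: measurable_funM => //; exact: mW.
Qed.

(** Reads the variable of a set at its unique sorted pair, where independence is assumed. The
    default 0 is taken on sets that are not edges, which [pair_mx] never reads. *)
Let entry (w : T) (B : {set 'I_n}) : R :=
  if [pick p in sorted_pairs n | edge p == B] is Some p then X p w else 0.

Let entryE w i j : entry w [set i; j]%SET = Num.sqrt n%:R * W w i j.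
Proof.
have [_ symW _ _] := hW.
rewrite /entry; case: pickP => [p /andP[pD /eqP]|no].
  move=> /set2_eq /= [[e1 e2]|[e1 e2]]; rewrite /X e1 e2 //; congr (_ * _).
  by rewrite -[in LHS](symW w) mxE.
by have /imsetP[p pD e] := edge_sorted i j; have := no p; rewrite pD e eqxx.
Qed.

Let entry_edge w p : entry w (edge p) = X p w.
Proof. exact: entryE. Qed.

Lemma scaled_mxE w : Num.sqrt n%:R *: W w - x%:M = pair_mx x (entry w).
Proof. by apply/matrixP => i j; rewrite !mxE entryE. Qed.

(** Each term is a product over sorted pairs of functions of one independent entry, so its mean is a
    product of one-dimensional means, on each of which the quadrature is exact. [H] allows a
    different test function on each entry. *)
Lemma wigner_polynomial_expectation (K : finType) (co : K -> R)
    (C : K -> {set 'I_n} -> {poly R}) (H : {set 'I_n} -> R -> R) :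
  (forall k B, (size (C k B) <= 5)%N) ->
  (forall k B, B \notin @edge n @: sorted_pairs n -> C k B = 1) ->
  (forall B, bounded1 (H B)) ->
  (forall B, B \notin @edge n @: sorted_pairs n -> H B = cst 1) ->
  let F w := (\sum_k co k * \prod_B (C k B).[entry w B]) *
     \prod_(p in sorted_pairs n) H (edge p) (X p w) in
  P.-integrable setT (EFin \o F) /\
  (\int[P]_w (F w)%:E = (dexp (fun B => quad_weight mu (H B))
    (fun f => \sum_k co k * \prod_B (C k B).[node R (f B)]))%:E)%E.
Proof.
move=> sC C1 bH H1 F.
pose h k p (z : R) := (C k (edge p)).[z] * H (edge p) z.
have [_ _ lawX indX] := hW.
have mh k p : measurable_fun setT (h k p).
  apply: measurable_funM; last by have [] := bH (edge p).
  by apply: continuous_measurable_fun; exact: continuous_horner.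
have ih k p : mu.-integrable setT (EFin \o h k p) by exact: integrable_poly.
have IP k := @integral_prod_independent _ _ _ P mu _ (sorted_pairs n) X mX lawX indX
   (h k) (mh k) (ih k).
have FE w : (F w)%:E = (\sum_k (co k)%:E * (\prod_(p in sorted_pairs n) h k p (X p w))%:E)%E.
  rewrite /F mulr_suml -sumEFin; apply: eq_bigr => k _; rewrite -EFinM -mulrA.
  congr ((_ * _)%:E); rewrite (prod_edges (G := fun B => (C k B).[entry w B])); last first.
    by move=> B bmx; rewrite C1 // hornerC.
  by rewrite -big_split /=; apply: eq_bigr => p _; rewrite entry_edge.
have -> : EFin \o F = (fun w => \sum_k (co k)%:E * (\prod_(p in sorted_pairs n) h k p (X p w))%:E)%E.
  by apply/funext => w /=; exact: FE.
split.
  by apply: integrable_sum => // k _; apply: integrableZl => //; have [] := IP k.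
transitivity (\int[P]_w (\sum_k (co k)%:E * (\prod_(p in sorted_pairs n) h k p (X p w))%:E))%E.
  by apply: eq_integral => w _; exact: FE.
rewrite integral_sum // => [|k]; last by apply: integrableZl => //; have [] := IP k.
rewrite dexp_sum -sumEFin; apply: eq_bigr => k _.
have [i1 e1] := IP k; rewrite integralZl // e1 -EFinM dexpZ; congr ((_ * _)%:E).
rewrite (dexp_prod _ (fun B a => (C k B).[node R a])).
rewrite (prod_edges (G := fun B => \sum_a quad_weight mu (H B) a * (C k B).[node R a])); last first.
  move=> B bmx; rewrite C1 // H1 // -[RHS](quad_weight_sum htail).
  by apply: eq_bigr => a _; rewrite hornerC mulr1.
by apply: eq_bigr => p _; rewrite -(mean_poly htail).
Qed.

Let trivial_factor w : \prod_(p in sorted_pairs n) (cst 1 : R -> R) (X p w) = 1.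
Proof. by rewrite big1. Qed.

Lemma wigner_det_mean :
  P.-integrable setT (fun w => (\det (Num.sqrt n%:R *: W w - x%:M))%:E) /\
  (\int[P]_w (\det (Num.sqrt n%:R *: W w - x%:M))%:E =
    (mean_det (quad_weight mu (cst 1)) (node R) x n)%:E)%E.
Proof.
have [||||i e] := @wigner_polynomial_expectation _ (fun s : 'S_n => (-1) ^+ s)
  (det_factor x) (fun=> cst 1).
- by move=> s B; rewrite (leq_trans (size_det_factor _ _ _)).
- by move=> s B; exact: det_factor1.
- by move=> B; exact: bounded1_cst.
- by [].
have FE w : \det (Num.sqrt n%:R *: W w - x%:M) =
   (\sum_(s : 'S_n) (-1) ^+ s * \prod_B (det_factor x s B).[entry w B]) *
     \prod_(p in sorted_pairs n) (cst 1 : R -> R) (X p w).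
  by rewrite scaled_mxE det_pair_mx trivial_factor mulr1.
split; first by under eq_fun do rewrite FE.
under eq_integral do rewrite FE.
rewrite e; congr (_%:E); apply: eq_dexp => f; rewrite -det_pair_mx.
by congr (\det _); apply/matrixP => i' j'; rewrite !mxE.
Qed.

(** The squared Leibniz sum runs over pairs of permutations; an entry then occurs in degree at most
    2 + 2 = 4, the exactness degree of the quadrature. *)
Lemma wigner_det_sqr_mean :
  P.-integrable setT (fun w => (\det (Num.sqrt n%:R *: W w - x%:M) ^+ 2)%:E) /\
  (\int[P]_w (\det (Num.sqrt n%:R *: W w - x%:M) ^+ 2)%:E =
    (mean_det_sqr (quad_weight mu (cst 1)) (node R) x n)%:E)%E.
Proof.
have [||||i e] := @wigner_polynomial_expectation _
  (fun st : 'S_n * 'S_n => (-1) ^+ st.1 * (-1) ^+ st.2)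
  (fun st B => det_factor x st.1 B * det_factor x st.2 B) (fun=> cst 1).
- move=> s B; rewrite (leq_trans (size_polyMleq _ _)) //.
  by rewrite -[5%N]/(3 + 3).-1%N -!subn1 leq_sub2r // leq_add // size_det_factor.
- by move=> s B bmx; rewrite !det_factor1 // mulr1.
- by move=> B; exact: bounded1_cst.
- by [].
have DE (y : {set 'I_n} -> R) : \det (pair_mx x y) ^+ 2 =
   \sum_(st : 'S_n * 'S_n) (-1) ^+ st.1 * (-1) ^+ st.2 * \prod_B (det_factor x st.1 B * det_factor x st.2 B).[y B].
  rewrite expr2 det_pair_mx mulr_suml.
  rewrite -(pair_bigA _ (fun s t : 'S_n => (-1) ^+ s * (-1) ^+ t *
    \prod_B (det_factor x s B * det_factor x t B).[y B])) /=.
  apply: eq_bigr => s _; rewrite mulr_sumr; apply: eq_bigr => t _.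
  have -> : \prod_B (det_factor x s B * det_factor x t B).[y B] =
    (\prod_B (det_factor x s B).[y B]) * \prod_B (det_factor x t B).[y B].
    by rewrite -big_split /=; apply: eq_bigr => B _; rewrite hornerM.
  exact: mulrACA.
have FE w : \det (Num.sqrt n%:R *: W w - x%:M) ^+ 2 =
   (\sum_(st : 'S_n * 'S_n) (-1) ^+ st.1 * (-1) ^+ st.2 * \prod_B (det_factor x st.1 B * det_factor x st.2 B).[entry w B]) *
     \prod_(p in sorted_pairs n) (cst 1 : R -> R) (X p w).
  by rewrite scaled_mxE DE trivial_factor mulr1.
split; first by under eq_fun do rewrite FE.
under eq_integral do rewrite FE.
rewrite e; congr (_%:E); apply: eq_dexp => f; rewrite -DE.
by congr (\det _ ^+ 2); apply/matrixP => i' j'; rewrite !mxE.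
Qed.

End wigner_expectation.

Section wigner_marked.
Context d (T : measurableType d) (R : realType) (P : probability T R)
  (mu : probability R R) (n : nat) (W : T -> 'M[R]_n.+1).
Hypotheses (hcent : centered mu) (hvar : unit_variance mu)
    (htail : subexponential_tails mu) (hW : is_wigner mu P W).
Variable x : R.

(** The test function is the sign on the label of the (0,0) entry and 1 elsewhere, so the formula
    for a marked entry applies with [kappa] the mean absolute value and [gamma] the mean sign. *)
Lemma wigner_det_sgn_mean :
  let F w := \det (Num.sqrt n.+1%:R *: W w - x%:M) *
      sgn1 (Num.sqrt n.+1%:R * W w ord0 ord0) in
  P.-integrable setT (EFin \o F) /\
  (\int[P]_w (F w)%:E =
    (mean mu (fun z => `|z|) * mean_det (quad_weight mu (cst 1)) (node R) x n +
     (\sum_a quad_weight mu (@sgn1 R) a) * mean_det (quad_weight mu (cst 1)) (node R) x n.+1)%:E)%E.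
Proof.
move=> F; pose H (B : {set 'I_n.+1}) : R -> R := if B == [set ord0]%SET then @sgn1 R else cst 1.
have [||||i e] := @wigner_polynomial_expectation _ _ _ P mu n.+1 W htail hW
  _ (fun s : 'S_n.+1 => (-1) ^+ s) (det_factor x) H.
- by move=> s B; rewrite (leq_trans (size_det_factor _ _ _)).
- by move=> s B; exact: det_factor1.
- by move=> B; rewrite /H; case: ifP => _; [exact: bounded1_sgn1|exact: bounded1_cst].
- move=> B bmx; rewrite /H ifN //; apply: contraNneq bmx => ->.
  by rewrite -[[set _]%SET]finset.setUid edge_sorted.
have HE w : \prod_(p in sorted_pairs n.+1) H (edge p) (Num.sqrt n.+1%:R * W w p.1 p.2) =
    sgn1 (Num.sqrt n.+1%:R * W w ord0 ord0).
  rewrite (bigD1 (ord0, ord0)) ?inE //= big1 ?mulr1 => [|p /andP[pD p0]].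
    by rewrite /H /edge /= finset.setUid eqxx.
  rewrite /H ifN //; apply: contra p0 => /eqP e0.
  apply/eqP/edge_inj => //; first by rewrite inE.
  by rewrite e0 /edge finset.setUid.
have FE w := scaled_mxE hW x w.
split.
  by move: i; under eq_fun do rewrite -det_pair_mx -FE HE.
transitivity (\int[P]_w (F w)%:E)%E => //; move: e.
under eq_integral do rewrite -det_pair_mx -FE HE.
move=> ->; congr (_%:E).
rewrite -(quad_weight_sgn1_mean htail).
rewrite -(dexp_marked (quad_weight_sum htail) (quad_weight_mean hcent htail)
   (quad_weight_var hcent hvar htail)).
transitivity (dexp (fun B => quad_weight mu (H B)) (fun f => \det (edge_mx (node R) x f))).
  apply: eq_dexp => f; rewrite -det_pair_mx.
  by congr (\det _); apply/matrixP => i' j'; rewrite !mxE.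
by apply: eq_dexpw => B a; rewrite /H; case: eqP.
Qed.

End wigner_marked.

(** * Logarithmic potential of the semicircle law *)

Section chebyshev.
Variable R : realType.
Local Notation leb := (@lebesgue_measure R).

(** The second component is the next polynomial, the recursion having order two. The first is the
    Chebyshev polynomial [T_n (x / 2)], adapted to [-2, 2]. *)
Fixpoint cheb_pair (n : nat) : {poly R} * {poly R} :=
  if n is n'.+1 then
    let: (p, q) := cheb_pair n' in (q, 'X * q - p)
  else (1, 2^-1 *: 'X).

Definition cheb n := (cheb_pair n).1.

Lemma cheb_cos n (t : R) : (cheb n).[2 * cos t] = cos (n%:R * t).
Proof.
suff [-> _] : (cheb_pair n).1.[2 * cos t] = cos (n%:R * t) /\
  (cheb_pair n).2.[2 * cos t] = cos (n.+1%:R * t) by [].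
elim: n => [|n].
  by rewrite /= hornerC mul0r cos0 hornerZ hornerX mulKf // mul1r.
rewrite /=; case: (cheb_pair n) => p q /= [IH1 IH2]; split => //.
rewrite hornerD hornerN hornerM hornerX IH1 IH2.
have -> : n.+2%:R * t = n.+1%:R * t + t by rewrite -[n.+2%:R]natr1; ring.
have -> : n%:R * t = n.+1%:R * t - t by rewrite -[n.+1%:R]natr1; ring.
rewrite cosB cosD; ring.
Qed.

Definition sin_prim (j : R) (t : R) : R := if j == 0 then t else j^-1 * sin (j * t).

Lemma is_derive_sin_prim j t : is_derive t (1 : R) (sin_prim j) (cos (j * t)).
Proof.
rewrite /sin_prim; have [->|j0] := eqVneq j 0.
  by rewrite mul0r cos0; exact: is_derive_id.
have dj : is_derive t (1 : R) (fun t : R => j * t) j.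
  by apply: (is_derive_eq (is_deriveZ j (is_derive_id t 1))); rewrite /GRing.scale /= mulr1.
have ds : is_derive t (1 : R) (sin \o (fun t : R => j * t)) (cos (j * t) * j).
  exact: is_derive1_comp.
apply: (is_derive_eq (is_deriveZ j^-1 ds)).
by rewrite /GRing.scale /= mulrCA mulVf // mulr1.
Qed.

Lemma sin_natmul_pi n : sin (n%:R * pi) = 0 :> R.
Proof.
elim: n => [|n IH]; first by rewrite mul0r sin0.
by rewrite -natr1 mulrDl mul1r sinDpi IH oppr0.
Qed.

(** A primitive obtained from [4 sin^2 t cos (k t) = 2 cos (k t) - cos ((k + 2) t) - cos ((k - 2)
    t)]. The frequencies [k] and [k - 2] may vanish, whence the case at 0 in [sin_prim]. *)
Definition cheb_prim (k : nat) (t : R) : R :=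
  2 * sin_prim k%:R t - sin_prim (k%:R + 2) t - sin_prim (k%:R - 2) t.

Lemma is_derive_cheb_prim k t : is_derive t (1 : R) (cheb_prim k)
  (cos (k%:R * t) * (2 * sin t) * (2 * sin t)).
Proof.
have -> : cheb_prim k = (2 : R) \*: sin_prim k%:R - sin_prim (k%:R + 2) - sin_prim (k%:R - 2).
  by apply/funext.
have h1 := is_derive_sin_prim k%:R t.
have h2 := is_derive_sin_prim (k%:R + 2) t.
have h3 := is_derive_sin_prim (k%:R - 2) t.
apply: is_derive_eq; rewrite /GRing.scale /=.
have -> : (k%:R + 2) * t = k%:R * t + (t + t) by ring.
have -> : (k%:R - 2) * t = k%:R * t - (t + t) by ring.
rewrite cosB !cosD sinD.
have := cos2Dsin2 t; rewrite !expr2 => e.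
have -> : cos t * cos t = 1 - sin t * sin t by rewrite -e addrK.
ring.
Qed.

Lemma integral_cos_sin2 k :
  (\int[leb]_(t in `[0%R, pi]) (cos (k%:R * t) * (2 * sin t) * (2 * sin t))%:E =
   (pi * (2 * (k == 0%N)%:R - (k == 2%N)%:R))%:E)%E.
Proof.
have dp t := is_derive_cheb_prim k t.
have ct : continuous (cheb_prim k).
  by move=> t; apply: differentiable_continuous; apply/derivable1_diffP; case: (dp t).
rewrite (@continuous_FTC2 _ _ (cheb_prim k)) ?pi_gt0 //.
- rewrite -EFinB; congr (_%:E).
  have -> : cheb_prim k 0 = 0.
    by rewrite /cheb_prim /sin_prim !mulr0 sin0 !mulr0 !if_same mulr0 !subr0.
  rewrite subr0 /cheb_prim /sin_prim.
  have sinz j : sin ((k%:R + j%:R) * pi) = 0 :> R by rewrite -natrD sin_natmul_pi.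
  rewrite sinz sin_natmul_pi !mulr0.
  have -> : (k%:R + 2 == 0 :> R) = false by rewrite gt_eqF // ltr_wpDl.
  have -> : (k%:R - 2 == 0 :> R) = (k == 2%N) by rewrite subr_eq0 eqr_nat.
  have -> : sin ((k%:R - 2) * pi) = 0 :> R.
    have -> : (k%:R - 2) * pi = k%:R * pi - pi *+ 2 :> R by rewrite mulr2n; ring.
    by rewrite -sinD2pi subrK sin_natmul_pi.
  rewrite pnatr_eq0 mulr0 subr0; case: k {dp ct sinz} => [|[|[|k]]] /=; ring.
- apply: continuous_subspaceT => t.
  apply: differentiable_continuous; apply/derivable1_diffP.
  have dj : is_derive t (1 : R) (fun t : R => k%:R * t) k%:R.
    by apply: (is_derive_eq (is_deriveZ k%:R (is_derive_id t 1))); rewrite /GRing.scale /= mulr1.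
  have dc : is_derive t (1 : R) (cos \o (fun t : R => k%:R * t)) (- sin (k%:R * t) * k%:R).
    exact: is_derive1_comp.
  have d2 : is_derive t (1 : R) ((2 : R) \*: sin) (2 *: cos t) by exact: is_deriveZ.
  by have [] := is_deriveM (is_deriveM dc d2) d2.
- split=> [t _||]; first by case: (dp t).
  + exact/cvg_at_right_filter/ct.
  + exact/cvg_at_left_filter/ct.
- by move=> t _; rewrite derive1E; case: (dp t).
Qed.

Lemma sqrt_semicircle (t : R) : 0 <= t <= pi -> Num.sqrt (4 - (2 * cos t) ^+ 2) = 2 * sin t.
Proof.
move=> tpi; have s0 := sin_ge0_pi tpi.
have -> : 4 - (2 * cos t) ^+ 2 = (2 * sin t) ^+ 2.
  by rewrite !exprMn cos2sin2; ring.
by rewrite sqrtr_sqr ger0_norm // mulr_ge0.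
Qed.

Lemma continuous_sqrt_semicircle : continuous (fun x : R => Num.sqrt (4 - x ^+ 2)).
Proof.
move=> x; apply: (@continuous_comp _ _ _ (fun x : R => 4 - x ^+ 2) (@Num.sqrt R)).
  by apply: continuousB; [exact: cst_continuous|exact: exprn_continuous].
exact: sqrt_continuous.
Qed.

(** Under [x = 2 cos t] the weight and the differential combine into [4 sin^2 t]; only degrees 0 and
    2 survive. *)
Lemma integral_cheb k :
  (\int[leb]_(x in `[(-2)%R, 2%R]) ((cheb k).[x] * Num.sqrt (4 - x ^+ 2))%:E =
   (pi * (2 * (k == 0%N)%:R - (k == 2%N)%:R))%:E)%E.
Proof.
pose F : R -> R := (2 : R) \*: (@cos R).
have dF t : is_derive t (1 : R) F (- (2 * sin t)).
  by apply: (is_derive_eq (is_deriveZ 2 (is_derive_cos t))); rewrite /GRing.scale /= mulrN.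
have F'E : F^`()%classic = (fun t => - (2 * sin t)).
  by apply/funext => t; rewrite derive1E; case: (dF t).
have cF t : {for t, continuous F}.
  by apply: differentiable_continuous; apply/derivable1_diffP; case: (dF t).
have cF' t : {for t, continuous F^`()%classic}.
  rewrite F'E; apply: differentiable_continuous; apply/derivable1_diffP.
  by have [] := is_deriveN (is_deriveZ 2 (is_derive_sin t)).
have F0 : F 0 = 2 by rewrite /F /= cos0 /GRing.scale /= mulr1.
have Fpi : F pi = - 2 by rewrite /F /= cospi /GRing.scale /= mulrN1.
have -> : `[(- 2), 2]%classic = `[F pi, F 0]%classic :> set R by rewrite F0 Fpi.
rewrite (@integration_by_substitution_decreasing _ F) ?pi_ge0 //.
- rewrite -integral_cos_sin2; apply: eq_integral => t; rewrite inE /= in_itv /= => tpi.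
  congr (_%:E); rewrite F'E !fctE /= opprK.
  have -> : F t = 2 * cos t by [].
  by rewrite cheb_cos sqrt_semicircle.
- move=> s t; rewrite !in_itv /= => sp tp st.
  rewrite -[F s]/(2 * cos s) -[F t]/(2 * cos t) ltr_pM2l //.
  by rewrite ltr_cos.
- by move=> t _; exact: cF'.
- by apply: cvgP; exact/cvg_at_right_filter/cF'.
- by apply: cvgP; exact/cvg_at_left_filter/cF'.
- split=> [t _||]; first by case: (dF t).
  + exact/cvg_at_right_filter/cF.
  + exact/cvg_at_left_filter/cF.
- apply: continuous_subspaceT => x; apply: continuousM; last exact: continuous_sqrt_semicircle.
  exact: continuous_horner.
Qed.

End chebyshev.

(** * Chebyshev expansion of a regularized logarithm *)

Section log_series.
Variable R : realType.

(** Partial sum of the expansion of [- ln |1 - r e^(i al)|] in powers of [r]. *)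
Definition log_poly (al : R) (n : nat) : {poly R} :=
  \sum_(k < n) (cos (k.+1%:R * al) / k.+1%:R) *: 'X^(k.+1).

(* The square of |1 - r e^(i al)|. *)
Definition cfactor (al r : R) : R := 1 - 2 * r * cos al + r ^+ 2.

Lemma cfactor_ge al r : 0 <= r -> (1 - r) ^+ 2 <= cfactor al r.
Proof.
move=> r0; have := ler_wpM2l r0 (cos_le1 al); rewrite /cfactor; nra.
Qed.

Lemma cfactor_gt0 al r : 0 <= r < 1 -> 0 < cfactor al r.
Proof.
move=> /andP[r0 r1]; rewrite (lt_le_trans _ (cfactor_ge al r0)) // exprn_gt0 //.
by rewrite subr_gt0.
Qed.

Lemma log_poly_deriv al n t : (log_poly al n)^`().[t] = \sum_(k < n) cos (k.+1%:R * al) * t ^+ k.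
Proof.
rewrite /log_poly raddf_sum horner_sum; apply: eq_bigr => k _.
rewrite /= derivZ derivXn hornerZ hornerMn hornerXn /= -[t ^+ k *+ _]mulr_natl mulrA divfK //.
Qed.

(** The cosine sum is the real part of a geometric sum; the right side is its exact remainder after
    [n] terms. *)
Lemma cos_sum_identity al n t :
  (t - cos al) + cfactor al t * (\sum_(k < n) cos (k.+1%:R * al) * t ^+ k) =
  t ^+ n * (t * cos (n%:R * al) - cos (n.+1%:R * al)).
Proof.
rewrite /cfactor; elim: n => [|n IH].
  rewrite big_ord0 mulr0 addr0 expr0 mul0r cos0.
  by rewrite !mul1r mulr1.
rewrite big_ord_recr /= mulrDr addrA IH [t ^+ n.+1]exprS.
have -> : n.+2%:R * al = n.+1%:R * al + al by rewrite -[n.+2%:R]natr1; ring.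
have -> : n%:R * al = n.+1%:R * al - al by rewrite -[n.+1%:R]natr1; ring.
rewrite cosB cosD.
ring.
Qed.

(** The difference vanishes at [r = 0] and its derivative is the remainder above divided by
    [cfactor]; the mean value theorem concludes. *)
Lemma ln_cfactor_approx al r n : 0 <= r < 1 ->
  `|ln (cfactor al r) / 2 + (log_poly al n).[r]| <= 2 * r ^+ n / (1 - r) ^+ 2.
Proof.
move=> r01; have [r0 r1] := andP r01.
pose D t := ln (cfactor al t) / 2 + (log_poly al n).[t].
pose dD t := (t - cos al) / cfactor al t + \sum_(k < n) cos (k.+1%:R * al) * t ^+ k.
have c0 t : 0 <= t <= r -> 0 < cfactor al t.
  by move=> /andP[t0 tr]; rewrite cfactor_gt0 // t0 (le_lt_trans tr).
have der t : 0 <= t <= r -> is_derive t (1 : R) D (dD t).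
  move=> tr.
  have dc : is_derive t (1 : R) (cfactor al) (2 * (t - cos al)).
    have -> : cfactor al = cst 1 - ((2 * cos al) \*: id) + id ^+ 2.
      apply/funext => u; rewrite /cfactor.
      rewrite -[RHS]/(1 - (2 * cos al) * u + u ^+ 2); ring.
    apply: is_derive_eq; rewrite /GRing.scale /= expr1; ring.
  have dl : is_derive t (1 : R) (@ln R \o cfactor al) ((cfactor al t)^-1 * (2 * (t - cos al))).
    apply: is_derive1_comp; exact: is_derive1_ln (c0 _ tr).
  have -> : D = (2^-1 : R) \*: (@ln R \o cfactor al) + horner (log_poly al n).
    by apply/funext => u; rewrite /D [_ / 2]mulrC.
  apply: is_derive_eq; rewrite log_poly_deriv /dD /GRing.scale /=.
  by congr (_ + _); field; rewrite gt_eqF // c0.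
have D0 : D 0 = 0.
  rewrite /D /cfactor mulr0 mul0r subr0 expr2 mul0r addr0 ln1 mul0r add0r.
  rewrite /log_poly horner_sum big1 // => k _.
  by rewrite hornerZ hornerXn exprS mul0r mulr0.
have [|c] := @MVT_segment R D dD 0 r r0 _ (is_derive_continuous_segment der).
  by move=> t; rewrite in_itv /= => /andP[/ltW ? /ltW ?]; apply: der; apply/andP.
rewrite in_itv /= => cr; rewrite D0 !subr0 -/(D r) => ->.
have [cc0 ccr] := andP cr.
have cp := c0 c cr.
have -> : dD c = c ^+ n * (c * cos (n%:R * al) - cos (n.+1%:R * al)) / cfactor al c.
  by rewrite -cos_sum_identity /dD; set S := \sum_(_ < _) _; field; rewrite gt_eqF.
rewrite normrM (ger0_norm r0) normrM normfV (gtr0_norm cp) normrM normrX (ger0_norm cc0).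
have h1 : c ^+ n <= r ^+ n by rewrite lerXn2r.
have h2 : `|c * cos (n%:R * al) - cos (n.+1%:R * al)| <= 2.
  rewrite (le_trans (ler_normB _ _)) // normrM (ger0_norm cc0).
  have := cos_max (n%:R * al); have := cos_max (n.+1%:R * al).
  have := normr_ge0 (cos (n%:R * al)); nra.
have h3 : (cfactor al c)^-1 <= ((1 - r) ^+ 2)^-1.
  rewrite lef_pV2 ?posrE ?exprn_gt0 ?subr_gt0 // (le_trans _ (cfactor_ge al cc0)) //.
  rewrite lerXn2r ?nnegrE ?subr_ge0 ?(ltW r1) ?(le_trans ccr (ltW r1)) //.
  by rewrite lerD2l lerN2.
have h4 : c ^+ n * `|c * cos (n%:R * al) - cos (n.+1%:R * al)| / cfactor al c <=
   2 * r ^+ n / (1 - r) ^+ 2.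
  apply: ler_pM => //; first by rewrite mulr_ge0 // exprn_ge0.
  - by rewrite invr_ge0 ltW.
  - by rewrite mulrC; apply: ler_pM => //; rewrite exprn_ge0.
rewrite (le_trans _ h4) // ler_piMr ?(ltW r1) //.
by rewrite mulr_ge0 ?invr_ge0 ?(ltW cp) // mulr_ge0 // exprn_ge0.
Qed.

(** The product of the squared moduli of [1 - r e^(i(th + ph))] and [1 - r e^(i(th - ph))], where
    [c = cos ph] and [x = 2 cos th]. At [r = 1] it is [(x - 2 c)^2], so half its logarithm
    regularizes [ln |x - E|] for [E = 2 c]. *)
Definition kernel (r c x : R) : R :=
  (1 - r ^+ 2) ^+ 2 - 2 * r * (1 + r ^+ 2) * c * x + r ^+ 2 * x ^+ 2 + 4 * r ^+ 2 * c ^+ 2.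

Lemma kernelE (r th ph : R) :
  kernel r (cos ph) (2 * cos th) = cfactor (th + ph) r * cfactor (th - ph) r.
Proof.
rewrite /kernel /cfactor cosD cosB.
have e1 := cos2Dsin2 th; have e2 := cos2Dsin2 ph.
have -> : (1 - 2 * r * (cos th * cos ph - sin th * sin ph) + r ^+ 2) *
  (1 - 2 * r * (cos th * cos ph + sin th * sin ph) + r ^+ 2) =
  (1 + r ^+ 2) ^+ 2 - 4 * r * (1 + r ^+ 2) * (cos th * cos ph)
   + 4 * r ^+ 2 * (cos th ^+ 2 * cos ph ^+ 2 - sin th ^+ 2 * sin ph ^+ 2) by ring.
rewrite (sin2cos2 th) (sin2cos2 ph); ring.
Qed.

Definition cheb_approx (r ph : R) (n : nat) : {poly R} :=
  \sum_(k < n) (- (2 * r ^+ k.+1 * cos (k.+1%:R * ph) / k.+1%:R)) *: cheb R k.+1.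

Lemma ln_kernel_approx r ph x n : 0 <= r < 1 -> -2 <= x <= 2 ->
  `|ln (kernel r (cos ph) x) / 2 - (cheb_approx r ph n).[x]| <= 4 / (1 - r) ^+ 2 * r ^+ n.
Proof.
move=> r01 /andP[x1 x2].
pose th := acos (x / 2).
have xE : x = 2 * cos th.
  rewrite acosK; first by field.
  by rewrite in_itv /=; apply/andP; split; lra.
rewrite xE kernelE lnM ?posrE ?cfactor_gt0 //.
have -> : (cheb_approx r ph n).[2 * cos th] =
   - ((log_poly (th + ph) n).[r] + (log_poly (th - ph) n).[r]).
  rewrite /cheb_approx /log_poly !horner_sum -big_split /= -sumrN.
  apply: eq_bigr => k _; rewrite !hornerZ !hornerXn cheb_cos mulrDr mulrBr cosB cosD.
  ring.
have h1 := ln_cfactor_approx (th + ph) n r01.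
have h2 := ln_cfactor_approx (th - ph) n r01.
have -> : (ln (cfactor (th + ph) r) + ln (cfactor (th - ph) r)) / 2 -
  - ((log_poly (th + ph) n).[r] + (log_poly (th - ph) n).[r]) =
  (ln (cfactor (th + ph) r) / 2 + (log_poly (th + ph) n).[r]) +
  (ln (cfactor (th - ph) r) / 2 + (log_poly (th - ph) n).[r]) by ring.
rewrite (le_trans (ler_normD _ _)) // (le_trans (lerD h1 h2)) //.
by rewrite le_eqVlt; apply/orP; left; apply/eqP; ring.
Qed.

Lemma kernel_gt0 r ph x : 0 <= r < 1 -> -2 <= x <= 2 -> 0 < kernel r (cos ph) x.
Proof.
move=> r01 /andP[x1 x2].
have -> : x = 2 * cos (acos (x / 2)).
  rewrite acosK; first by field.
  by rewrite in_itv /=; apply/andP; split; lra.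
by rewrite kernelE mulr_gt0 // cfactor_gt0.
Qed.

End log_series.

Section semicircle_integral.
Variable R : realType.
Local Notation leb := (@lebesgue_measure R).
Local Notation D := (`[(- 2 : R), 2]%classic).
Local Notation sc x := (Num.sqrt (4 - x ^+ 2)).

Lemma integrable_continuous_sc (f : R -> R) : {within D, continuous f} ->
  leb.-integrable D (fun x => (f x * sc x)%:E).
Proof.
move=> cf; apply: continuous_compact_integrable; first exact: segment_compact.
move=> x; apply: (@continuousM _ (subspace D) f (fun x => sc x) x); first exact: cf.
exact: (continuous_subspaceT (@continuous_sqrt_semicircle R)).
Qed.

Lemma integrable_sc : leb.-integrable D (fun x => (sc x)%:E).
Proof.
apply: continuous_compact_integrable; first exact: segment_compact.
exact: (continuous_subspaceT (@continuous_sqrt_semicircle R)).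
Qed.

Lemma integral_sc : (\int[leb]_(x in D) (sc x)%:E = (2 * pi)%:E)%E.
Proof.
have := integral_cheb R 0; rewrite /= mulr1 subr0 => e.
rewrite [X in _ = X%:E]mulrC -e; apply: eq_integral => x _.
by rewrite hornerC mul1r.
Qed.

Lemma continuous_ln_kernel r ph : 0 <= r < 1 ->
  {within D, continuous (fun x => ln (kernel r (cos ph) x) / 2)}.
Proof.
move=> r01; apply: continuous_in_subspaceT => x; rewrite inE /= in_itv /= => xD.
apply: (@continuousM R R (fun x => ln (kernel r (cos ph) x)) (fun=> 2^-1) x); last exact: cst_continuous.
apply: (@continuous_comp _ _ _ (kernel r (cos ph)) (@ln R)); last first.
  by apply: continuous_ln; exact: kernel_gt0.
have -> : kernel r (cos ph) = horner (((1 - r ^+ 2) ^+ 2)%:P -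
   (2 * r * (1 + r ^+ 2) * cos ph) *: 'X + r ^+ 2 *: 'X^2 + (4 * r ^+ 2 * cos ph ^+ 2)%:P).
  apply/funext => y; rewrite /kernel !(hornerD, hornerN, hornerC, hornerZ, hornerX, hornerXn); ring.
exact: continuous_horner.
Qed.

(** There is no term of degree 0, so only degree 2 contributes; the truncation at [n + 2] ensures
    that it is present. *)
Lemma integral_cheb_approx r ph n :
  (\int[leb]_(x in D) ((cheb_approx r ph n.+2).[x] * sc x)%:E = (pi * r ^+ 2 * cos (2 * ph))%:E)%E.
Proof.
pose a (k : nat) := - (2 * r ^+ k.+1 * cos (k.+1%:R * ph) / k.+1%:R).
have ci k : leb.-integrable D (fun x => ((cheb R k).[x] * sc x)%:E).
  apply: integrable_continuous_sc; apply: continuous_subspaceT; exact: continuous_horner.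
transitivity (\int[leb]_(x in D) (\sum_(k < n.+2) (a k)%:E * ((cheb R k.+1).[x] * sc x)%:E))%E.
  apply: eq_integral => x _; rewrite /cheb_approx horner_sum mulr_suml -sumEFin.
  by apply: eq_bigr => k _; rewrite hornerZ -EFinM mulrA.
rewrite integral_sum // => [|k]; last exact: integrableZl.
rewrite (eq_bigr (fun k : 'I_n.+2 => (a k * (pi * - (k == 1%N :> nat)%:R))%:E)) => [|k _]; last first.
  by rewrite integralZl // integral_cheb -EFinM /= mulr0 sub0r.
rewrite sumEFin; congr (_%:E).
rewrite !big_ord_recl /= big1 => [|k _]; last by rewrite oppr0 !mulr0.
by rewrite /a /bump /=; field.
Qed.

Lemma eq_of_geometric_bound (a b C r : R) : 0 <= r < 1 ->
  (forall n, `|a - b| <= C * r ^+ n) -> a = b.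
Proof.
move=> /andP[r0 r1] H; apply/eqP; rewrite -subr_eq0 -normr_le0.
have c0 : (C * r ^+ n) @[n --> \oo] --> C * 0.
  by apply: cvgMr; apply: cvg_expr; rewrite ger0_norm.
rewrite mulr0 in c0; apply: (cvgr_to_ge c0); exact: nearW.
Qed.

(** The truncation error is uniform on [-2, 2] and decays like [r^n], while the integral of the
    truncated series does not depend on [n]. *)
Lemma integral_ln_kernel r ph : 0 <= r < 1 ->
  (\int[leb]_(x in D) (ln (kernel r (cos ph) x) / 2 * sc x)%:E =
   (pi * r ^+ 2 * cos (2 * ph))%:E)%E.
Proof.
move=> r01; have [r0 r1] := andP r01.
pose K x := ln (kernel r (cos ph) x) / 2.
have iK : leb.-integrable D (fun x => (K x * sc x)%:E).
  exact/integrable_continuous_sc/continuous_ln_kernel.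
have fK : (\int[leb]_(x in D) (K x * sc x)%:E)%E \is a fin_num by apply: integrable_fin_num.
rewrite -(fineK fK); congr (_%:E).
apply: (@eq_of_geometric_bound _ _ (4 / (1 - r) ^+ 2 * (2 * pi)) r r01) => n.
have ip : leb.-integrable D (fun x => ((cheb_approx r ph n.+2).[x] * sc x)%:E).
  by apply: integrable_continuous_sc; apply: continuous_subspaceT; exact: continuous_horner.
have is_ : leb.-integrable D (fun x => (sc x)%:E).
  exact: integrable_sc.
rewrite -lee_fin -abse_EFin EFinB fineK // -(integral_cheb_approx r ph n).
rewrite -integralB //; apply: le_trans (le_abse_integral _ _ _) _ => //.
  apply: emeasurable_funB; [by case/integrableP: iK|by case/integrableP: ip].
apply: (@le_trans _ _ (\int[leb]_(x in D) ((4 / (1 - r) ^+ 2 * r ^+ n)%:E * (sc x)%:E))%E).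
  apply: ge0_le_integral => //.
  - apply: measurableT_comp => //.
    apply: emeasurable_funB; [by case/integrableP: iK|by case/integrableP: ip].
  - by apply: measurable_funeM; case/integrableP: is_.
  - move=> x xD0; have xD : -2 <= x <= 2 by move: xD0; rewrite /= in_itv.
    rewrite -EFinB -EFinM lee_fin -mulrBl normrM [`|sc x|]ger0_norm ?sqrtr_ge0 //.
    rewrite ler_wpM2r ?sqrtr_ge0 // (le_trans (ln_kernel_approx _ _ r01 xD)) //.
    rewrite ler_wpM2l ?divr_ge0 ?sqr_ge0 // ler_wiXn2l ?(ltW r1) //.
    by rewrite -addn2 leq_addr.
rewrite integralZl // integral_sc -EFinM lee_fin le_eqVlt; apply/orP; left; apply/eqP.
ring.
Qed.

End semicircle_integral.

Section potential.
Variable R : realType.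
Local Notation leb := (@lebesgue_measure R).
Local Notation D := (`[(- 2 : R), 2]%classic).
Local Notation sc x := (Num.sqrt (4 - x ^+ 2)).

Lemma integral_rho_sc (g : R -> R) (v : R) : measurable_fun setT g ->
  (\int[leb]_(x in D) (g x * sc x)%:E = v%:E)%E ->
  leb.-integrable D (fun x => (g x * sc x)%:E) ->
  (\int[leb]_x (g x * rho_sc x)%:E = (v / (2 * pi))%:E)%E.
Proof.
move=> mg e ig.
transitivity (\int[leb]_(x in D) ((2 * pi)^-1%:E * (g x * sc x)%:E))%E.
  rewrite [RHS]integral_mkcond; apply: eq_integral => x _.
  rewrite /restrict /rho_sc indicE; case: (_ \in _); last by rewrite !mulr0.
  by rewrite mulr1 -EFinM; congr (_%:E); ring.
by rewrite integralZl // e -EFinM mulrC.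
Qed.

Lemma measurable_ln_dist (E : R) : measurable_fun setT (fun x : R => ln `|x - E|).
Proof.
apply: (measurableT_comp (@measurable_ln R)) => //; apply: measurableT_comp => //.
exact: measurable_funB.
Qed.

(** With [r = 1 / a] and [cos ph] the sign of [E], the kernel on [-2, 2] is the perfect square
    [(r (x - E))^2]: the regularization is exact up to the constant [ln r]. *)
Lemma potential_outside (E a : R) : 1 < a -> `|E| = a + a^-1 ->
  (\int[leb]_x (ln `|x - E| * rho_sc x)%:E = (ln a + (2 * a ^+ 2)^-1)%:E)%E.
Proof.
move=> a1 Ea; have a0 : 0 < a by apply: lt_trans a1.
pose r := a^-1.
have r01 : 0 <= r < 1 by rewrite /r invr_ge0 ltW //= invf_lt1.
have [r0 r1] := andP r01.
have rE : r * `|E| = 1 + r ^+ 2.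
  by rewrite Ea /r mulrDr mulVf ?gt_eqF // expr2.
have [ph [c1 c2 cE]] : exists ph, [/\ cos ph ^+ 2 = 1, cos (2 * ph) = 1 & cos ph * `|E| = E :> R].
  have [E0|E0] := leP 0 E.
    by exists 0; rewrite mulr0 cos0 expr1n mul1r ger0_norm.
  exists pi; rewrite cospi sqrrN expr1n mulN1r ltr0_norm // opprK; split => //.
  by rewrite -[2 * pi]add0r [2 * pi]mulr_natl cosD2pi cos0.
have xlt x : -2 <= x <= 2 -> 0 < 1 - r * cos ph * x + r ^+ 2.
  move=> /andP[x1 x2]; have xn : `|x| <= 2 by rewrite ler_norml x1.
  have h : r * cos ph * x <= r * 2.
    rewrite (le_trans (ler_norm _)) // !normrM (ger0_norm r0).
    have -> : `|cos ph| = 1 by apply/eqP; rewrite -sqr_norm_eq1 // c1.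
    by rewrite mulr1 ler_wpM2l.
  have : 0 < (1 - r) ^+ 2 by rewrite exprn_gt0 // subr_gt0.
  nra.
have kE x : -2 <= x <= 2 -> ln (kernel r (cos ph) x) / 2 = ln r + ln `|x - E|.
  move=> xD; have p := xlt x xD.
  have -> : kernel r (cos ph) x = (1 - r * cos ph * x + r ^+ 2) ^+ 2.
    by rewrite /kernel; ring: c1.
  rewrite lnXn // -[ln _ *+ 2]mulr_natr mulfK //.
  rewrite -lnM ?posrE ?invr_gt0 //; last first.
    rewrite normr_gt0 subr_eq0; apply/eqP => xE; move: p.
    suff -> : 1 - r * cos ph * x + r ^+ 2 = 0 by rewrite ltxx.
    by rewrite xE -[in LHS]cE mulrA [r * cos ph * cos ph]mulrAC; rewrite -!mulrA; ring: c1 rE.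
  have e1 : `|cos ph| = 1 by apply/eqP; rewrite -sqr_norm_eq1 // c1.
  have <- : `|cos ph * (r * (x - E))| = r * `|x - E|.
    by rewrite !normrM e1 mul1r (ger0_norm r0).
  have -> : cos ph * (r * (x - E)) = - (1 - r * cos ph * x + r ^+ 2).
    by rewrite -[X in x - X]cE; ring: c1 rE.
  by rewrite normrN gtr0_norm.
have i1 := @integrable_continuous_sc R _ (@continuous_ln_kernel R r ph r01).
have i2 : leb.-integrable D (fun x => (ln r)%:E * (sc x)%:E)%E.
  by apply: integrableZl => //; exact: integrable_sc.
have eq x : x \in D -> (ln `|x - E| * sc x)%:E =
   ((ln (kernel r (cos ph) x) / 2 * sc x)%:E - (ln r)%:E * (sc x)%:E)%E.
  rewrite inE /= in_itv /= => xD.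
  by rewrite kE // -EFinD; congr (_%:E); ring.
rewrite (@integral_rho_sc _ (pi * r ^+ 2 - ln r * (2 * pi))).
- congr (_%:E); rewrite /r lnV ?posrE //; have := pi_gt0 R.
  by move: (pi : R) => q q0; field; rewrite !gt_eqF.
- exact: measurable_ln_dist.
- transitivity (\int[leb]_(x in D) ((ln (kernel r (cos ph) x) / 2 * sc x)%:E -
      (ln r)%:E * (sc x)%:E))%E; first by apply: eq_integral => x xD; exact: eq.
  rewrite integralB // integral_ln_kernel // c2 mulr1.
  by rewrite integralZl // ?integral_sc //; exact: integrable_sc.
- apply: (@eq_integrable _ _ _ leb D _ (fun x => (ln (kernel r (cos ph) x) / 2 * sc x)%:E -
      (ln r)%:E * (sc x)%:E)%E) => //; first by move=> x xD; rewrite eq.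
  exact: integrableB.
Qed.

(** A lower bound uniform in [r], for dominated convergence as [r] tends to 1; its logarithm is
    integrable. *)
Lemma kernel_ge (r c x : R) : 2^-1 <= r <= 1 -> `|c| <= 1 -> `|x| <= 2 ->
  (x - 2 * c) ^+ 2 / 4 <= kernel r c x.
Proof.
move=> /andP[r2 r1] c1 x2.
have cx : c * x <= 2.
  rewrite (le_trans (ler_norm _)) // normrM -[leRHS]mul1r.
  by apply: ler_pM.
have -> : kernel r c x = r ^+ 2 * (x - 2 * c) ^+ 2 + (1 - r) ^+ 2 * ((1 + r) ^+ 2 - 2 * r * (c * x)).
  by rewrite /kernel; ring.
have h1 : 0 <= (1 + r) ^+ 2 - 2 * r * (c * x).
  have : 0 <= (1 - r) ^+ 2 by exact: sqr_ge0.
  have : r * (c * x) <= r * 2 by rewrite ler_wpM2l //; lra.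
  nra.
have h2 : 4^-1 <= r ^+ 2.
  have -> : 4^-1 = 2^-1 ^+ 2 :> R by field.
  by rewrite lerXn2r ?nnegrE ?invr_ge0 //; lra.
rewrite -[leLHS]addr0; apply: lerD; last by rewrite mulr_ge0 ?sqr_ge0.
by rewrite mulrC ler_wpM2r ?sqr_ge0.
Qed.

(** 17 = 1 + 8 + 4 + 4, one bound per term. It serves to make integrands nonnegative by subtracting
    them from a constant. *)
Lemma kernel_le (r c x : R) : 0 <= r <= 1 -> `|c| <= 1 -> `|x| <= 2 ->
  kernel r c x <= 17.
Proof.
move=> /andP[r0 r1] c1 x2; rewrite /kernel.
have r2 : r ^+ 2 <= 1 by rewrite exprn_ile1.
have r20 : 0 <= r ^+ 2 by exact: sqr_ge0.
have cx : - (c * x) <= 2.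
  rewrite (le_trans (ler_norm _)) // normrN normrM -[leRHS]mul1r.
  by apply: ler_pM.
have h1 : (1 - r ^+ 2) ^+ 2 <= 1 by rewrite exprn_ile1 // ?subr_ge0 // gerBl.
have h2 : r ^+ 2 * x ^+ 2 <= 4.
  rewrite -[leRHS]mul1r; apply: ler_pM => //; first exact: sqr_ge0.
  by rewrite -(real_normK (num_real x)) (_ : 4 = 2 ^+ 2) ?lerXn2r ?nnegrE //; ring.
have h3 : 4 * r ^+ 2 * c ^+ 2 <= 4.
  have c2 : c ^+ 2 <= 1 by rewrite -(real_normK (num_real c)) exprn_ile1.
  have : r ^+ 2 * c ^+ 2 <= 1 * 1 by apply: ler_pM => //; exact: sqr_ge0.
  lra.
have h4 : 2 * r * (1 + r ^+ 2) * - (c * x) <= 4 * 2.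
  have h5 : 0 <= 2 * r * (1 + r ^+ 2) by rewrite !mulr_ge0 // addr_ge0.
  have h6 : 2 * r * (1 + r ^+ 2) <= 4 by nra.
  apply: (@le_trans _ _ (2 * r * (1 + r ^+ 2) * 2)); first by rewrite ler_wpM2l.
  by rewrite ler_wpM2r.
have -> : (1 - r ^+ 2) ^+ 2 - 2 * r * (1 + r ^+ 2) * c * x + r ^+ 2 * x ^+ 2 + 4 * r ^+ 2 * c ^+ 2 =
  (1 - r ^+ 2) ^+ 2 + 2 * r * (1 + r ^+ 2) * - (c * x) + r ^+ 2 * x ^+ 2 + 4 * r ^+ 2 * c ^+ 2.
  by ring.
lra.
Qed.

(** The formula for [r < 1] passes to the limit [r = 1], where the kernel is [(x - E)^2]. Fatou's
    lemma makes the limit integrable, and the limit then serves to dominate the sequence. *)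
Lemma potential_inside (E : R) : `|E| <= 2 ->
  (\int[leb]_x (ln `|x - E| * rho_sc x)%:E = (E ^+ 2 / 4 - 2^-1)%:E)%E.
Proof.
move=> E2.
pose ph := acos (E / 2).
have cE : 2 * cos ph = E.
  rewrite acosK; first by field.
  move: E2; rewrite ler_norml in_itv /= => /andP[h1 h2]; apply/andP; split; lra.
(* At [E] the kernels tend to 0 and their logarithms diverge, whereas [ln 0] is 0 by convention; the
   point is removed. *)
pose D' := D `\ E.
have mD' : measurable D' by apply: measurableD => //; exact: measurable_set1.
have D'D : D' `<=` D by move=> x [].
have D'x (x : R) : D' x -> -2 <= x <= 2 /\ x != E.
  by move=> [/=]; rewrite in_itv /= => xD xE; split => //; apply/eqP.
pose rn (n : nat) : R := 1 - n.+2%:R^-1.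
have rn2 n : 2^-1 <= rn n.
  rewrite /rn; have : n.+2%:R^-1 <= 2^-1 :> R by rewrite lef_pV2 ?posrE // ler_nat.
  by move: (n.+2%:R^-1 : R) => z; lra.
have rn1 n : rn n < 1 by rewrite gtrBl invr_gt0.
have rn01 n : 0 <= rn n < 1 by rewrite rn1 andbT (le_trans _ (rn2 n)).
have rn21 n : 2^-1 <= rn n <= 1 by rewrite rn2 ltW.
have c1 : `|cos ph| <= 1 by exact: cos_max.
have rncvg : rn n @[n --> \oo] --> (1 : R).
  rewrite -[X in _ --> X]subr0; apply: cvgB; first exact: cvg_cst.
  have := @cvg_harmonic R; rewrite -(cvg_shiftn 1) /=.
  by under eq_fun do rewrite addn1.
pose M : R := ln 17 / 2.
pose K n (x : R) := ln (kernel (rn n) (cos ph) x) / 2.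
pose g_ n (x : R) : \bar R := ((M - K n x) * sc x)%:E.
pose g (x : R) : \bar R := ((M - ln `|x - E|) * sc x)%:E.
have xn (x : R) : -2 <= x <= 2 -> `|x| <= 2 by rewrite ler_norml.
have g0 n (x : R) : D' x -> (0 <= g_ n x)%E.
  move=> /D'x[xD _]; rewrite lee_fin mulr_ge0 ?sqrtr_ge0 // subr_ge0 ler_wpM2r //.
  rewrite ler_ln ?posrE ?kernel_gt0 //; apply: kernel_le => //; last exact: xn.
  by have /andP[-> /ltW] := rn01 n.
have g_E n : g_ n = (fun x => M%:E * (sc x)%:E - (K n x * sc x)%:E)%E.
  by apply/funext => x; rewrite /g_ mulrBl EFinB EFinM.
have iMsc : leb.-integrable D (fun x => M%:E * (sc x)%:E)%E.
  by apply: integrableZl => //; exact: integrable_sc.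
have iK n : leb.-integrable D (fun x => (K n x * sc x)%:E).
  by apply: integrable_continuous_sc; exact: continuous_ln_kernel.
have igD n : leb.-integrable D (g_ n) by rewrite g_E; exact: integrableB.
have IgD n : (\int[leb]_(x in D) g_ n x = (M * (2 * pi) - pi * rn n ^+ 2 * cos (2 * ph))%:E)%E.
  rewrite g_E integralB // integralZl ?integral_sc ?integral_ln_kernel //.
  exact: integrable_sc.
have ig n : leb.-integrable D' (g_ n) by apply: integrableS (igD n).
have mg_ n : measurable_fun D' (g_ n) by case/integrableP: (ig n).
have Ig n : (\int[leb]_(x in D') g_ n x = (M * (2 * pi) - pi * rn n ^+ 2 * cos (2 * ph))%:E)%E.
  by rewrite integral_setD1.
have msc : measurable_fun setT (fun x : R => sc x).
  exact: continuous_measurable_fun (@continuous_sqrt_semicircle R).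
have mg : measurable_fun setT g.
  apply/measurable_EFinP; apply: measurable_funM => //; apply: measurable_funB => //.
  exact: measurable_ln_dist.
have mgD' : measurable_fun D' g by exact: measurable_funS mg.
have g_cvg (x : R) : D' x -> g_ n x @[n --> \oo] --> g x.
  move=> /D'x[xD xE]; apply: cvg_EFin; first by exact: nearW.
  apply: cvgMl; apply: cvgB; first exact: cvg_cst.
  have -> : ln `|x - E| = ln ((x - E) ^+ 2) / 2.
    rewrite -(real_normK (num_real (x - E))) lnXn ?normr_gt0 ?subr_eq0 //.
    by rewrite -[ln _ *+ 2]mulr_natr mulfK.
  apply: cvgMl.
  have cl : {for (x - E) ^+ 2, continuous (@ln R)}.
    by apply: continuous_ln; rewrite exprn_even_gt0 //= subr_eq0.
  apply: (@cvg_comp _ _ _ (fun n => kernel (rn n) (cos ph) x) (@ln R)); last exact: cl.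
  have -> : (x - E) ^+ 2 = kernel 1 (cos ph) x by rewrite -cE /kernel; ring.
  rewrite /kernel; have r2 : rn n ^+ 2 @[n --> \oo] --> (1 ^+ 2 : R).
    by rewrite !expr2; under eq_fun do rewrite expr2; exact: cvgM.
  have one : (1 : R) @[n --> \oo] --> (1 : R) by exact: cvg_cst.
  apply: cvgD; first apply: cvgD; first apply: cvgB.
  - rewrite expr2; under eq_fun do rewrite expr2.
    by apply: cvgM; apply: cvgB.
  - do 2 apply: cvgMl; apply: cvgM; first exact: cvgMr.
    exact: cvgD.
  - exact: cvgMl.
  - by apply: cvgMl; exact: cvgMr.
have g_ge0 (x : R) : D' x -> (0 <= g x)%E.
  move=> xD; apply: (cvge_to_ge (g_cvg x xD)); apply: nearW => n; exact: g0.
pose v : R := M * (2 * pi) - pi * cos (2 * ph).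
have Igcvg : (\int[leb]_(x in D') g_ n x)%E @[n --> \oo] --> v%:E.
  under eq_fun do rewrite Ig.
  apply: cvg_EFin; first exact: nearW.
  apply: cvgB; first exact: cvg_cst.
  apply: cvgMl; rewrite -[X in _ --> X]mulr1; apply: cvgMr.
  rewrite -(mulr1 (1 : R)); under eq_fun do rewrite expr2; exact: cvgM.
have iG : leb.-integrable D' g.
  apply/integrableP; split => //.
  have -> : (\int[leb]_(x in D') `|g x| = \int[leb]_(x in D') limn_einf (fun n => g_ n x))%E.
    apply: eq_integral => x; rewrite inE => xD; rewrite gee0_abs ?g_ge0 //.
    by have [-> _] := cvg_limn_einf_sup (g_cvg x xD).
  apply: le_lt_trans (fatou leb mD' mg_ g0) _.
  by have [-> _] := cvg_limn_einf_sup Igcvg; rewrite ltry.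
have isc : leb.-integrable D' (fun x => (sc x)%:E) by apply: integrableS (integrable_sc R).
(* Since the kernel is at least [(x - E)^2 / 4], the sequence is dominated by [g] plus [ln 2] times
   the semicircle weight. *)
have Ilim : (\int[leb]_(x in D') g_ n x)%E @[n --> \oo] --> (\int[leb]_(x in D') g x)%E.
  have [|||_ _ Il] := @dominated_convergence _ _ _ leb D' mD' g_ g
   (fun x => g x + (ln 2)%:E * (sc x)%:E)%E mg_ mgD'; last exact: Il.
  - exact/aeW.
  - by apply: integrableD => //; exact: integrableZl.
  - apply/aeW => x n xD; rewrite gee0_abs ?g0 // -EFinM -EFinD lee_fin -mulrDl.
    rewrite ler_wpM2r ?sqrtr_ge0 // -addrA lerD2l.
    have [xI xE] := D'x x xD.
    have p1 : 0 < `|x - E| by rewrite normr_gt0 subr_eq0.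
    have : ln ((x - E) ^+ 2 / 4) / 2 <= K n x.
      rewrite ler_wpM2r // ler_ln ?posrE ?kernel_gt0 ?divr_gt0 ?exprn_even_gt0 //= ?subr_eq0 //.
      by rewrite -cE; apply: kernel_ge => //; exact: xn.
    have -> : (x - E) ^+ 2 / 4 = (`|x - E| / 2) ^+ 2.
      by rewrite expr_div_n real_normK ?num_real //; congr (_ / _); ring.
    rewrite lnXn ?divr_gt0 // -[ln _ *+ 2]mulr_natr mulfK // ln_div ?posrE //.
    lra.
have vE : (\int[leb]_(x in D') g x = v%:E)%E.
  exact: (cvg_unique _ Ilim Igcvg).
have eqg (x : R) : x \in D' -> (ln `|x - E| * sc x)%:E = (M%:E * (sc x)%:E - g x)%E.
  by move=> _; rewrite -EFinM -EFinB; congr (_%:E); ring.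
have iD' : leb.-integrable D' (fun x => (ln `|x - E| * sc x)%:E).
  apply: (@eq_integrable _ _ _ leb D' _ (fun x => M%:E * (sc x)%:E - g x)%E) => //.
    by move=> x xD; rewrite eqg.
  by apply: integrableB => //; exact: integrableZl.
have IscD' : (\int[leb]_(x in D') (sc x)%:E = (2 * pi)%:E)%E.
  rewrite integral_setD1 ?integral_sc //; by apply/measurable_EFinP; exact: measurable_funS msc.
have mls : measurable_fun setT (fun x : R => (ln `|x - E| * sc x)%:E).
  by apply/measurable_EFinP; apply: measurable_funM => //; exact: measurable_ln_dist.
have IlD' : (\int[leb]_(x in D') (ln `|x - E| * sc x)%:E = (pi * cos (2 * ph))%:E)%E.
  transitivity (\int[leb]_(x in D') (M%:E * (sc x)%:E - g x))%E.
    by apply: eq_integral => x xD; exact: eqg.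
  rewrite integralB //; last exact: integrableZl.
  by rewrite integralZl // IscD' vE -EFinM -EFinB; congr (_%:E); rewrite /v; ring.
have IlD : (\int[leb]_(x in D) (ln `|x - E| * sc x)%:E = (pi * cos (2 * ph))%:E)%E.
  by rewrite -IlD' integral_setD1 //; exact: measurable_funS mls.
rewrite (integral_rho_sc (v := pi * cos (2 * ph))) //.
- congr (_%:E); rewrite -cE.
  have -> : cos (2 * ph) = 2 * cos ph ^+ 2 - 1.
    have -> : 2 * ph = ph + ph by ring.
    rewrite cosD -!expr2 sin2cos2; ring.
  have := pi_gt0 R; move: (pi : R) => q q0; field; by rewrite gt_eqF.
- exact: measurable_ln_dist.
- apply/integrableP; split; first exact: measurable_funS mls.
  rewrite -(@integral_setD1 _ _ E) //.
    by case/integrableP: iD'.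
  by apply: measurableT_comp => //; exact: measurable_funS mls.
Qed.

End potential.

(** * The limit *)

Section second_moment_bound.
Variables (R : realType) (A : finType) (w node : A -> R).
Hypotheses (w0 : \sum_a w a = 1) (w1 : \sum_a w a * node a = 0)
  (w2 : \sum_a w a * node a ^+ 2 = 1).
Let m4 := \sum_a w a * node a ^+ 4.
Variable x : R.
Hypothesis mean_det_sqr_ge0 : forall n, 0 <= mean_det_sqr w node x n.

Let nz n : (n`!%:R : R) != 0.
Proof. by rewrite pnatr_eq0 -lt0n fact_gt0. Qed.

Let fS n : ((n.+1)`!%:R : R) = n.+1%:R * n`!%:R.
Proof. by rewrite factS natrM. Qed.

Lemma mean_det_sqr0 : mean_det_sqr w node x 0 = 1.
Proof.
rewrite /mean_det_sqr -[RHS](dexp_cst (w := fun _ : {set 'I_0} => w) 1) //.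
by apply: eq_dexp => f; rewrite det_mx00 expr1n.
Qed.

(** Division by [k!] turns the factors [n] and [n (n - 1)] of the recursions into shifts.
    Nonnegativity is assumed in the section because signed weights do not provide it. *)
Lemma mean_det_sqr_le (r : R) n : 0 < r < 1 ->
  mean_det_sqr w node x n * r ^+ n <= n`!%:R * expR (x ^+ 2 * (r / (1 + r)) +
     (r / (1 - r ^+ 2) + 2 / (1 - r) + `|m4 - 3|) * r).
Proof.
move=> r01.
pose f k := mean_det_sqr w node x k / k`!%:R.
pose p k := mean_det_minor w node x k.+1 / k`!%:R.
pose q k := mean_minor_minor w node x k.+2 / k`!%:R.
pose h k := mean_offdiag_sqr w node x k.+2 / k`!%:R.
have f_ge0 k : 0 <= f k by rewrite divr_ge0.
have pE k : p k = - x * f k - shift_seq p k.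
  rewrite /p /f mean_det_minor_rec //; case: k => [|k] /=; first by rewrite fact0; field.
  by rewrite fS; field; rewrite nz /= ?nat1r -?natrD !pnatr_eq0.
have qE k : q k = x ^+ 2 * f k + 2 * x * shift_seq p k + shift_seq f k + shift_seq (shift_seq q) k.
  rewrite /q /p /f mean_minor_minor_rec //; case: k => [|[|k]] /=; rewrite ?fact0 ?fS ?fact0; first by field.
    by field.
  by field; rewrite nz /= ?nat1r -?natrD !pnatr_eq0.
have hE k : h k = f k + shift_seq f k + shift_seq (shift_seq h) k.
  rewrite /h /f mean_offdiag_sqr_rec //; case: k => [|[|k]] /=; rewrite ?fact0 ?fS ?fact0; first by field.
    by field.
  by field; rewrite nz /= ?nat1r -?natrD !pnatr_eq0.
have fE k : pseries_diffs f k = q k + 2 * h k - f k + (m4 - 3) * shift_seq f k.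
  rewrite /pseries_diffs /q /h /f mean_det_sqr_rec // mean_minor_minor_rec // mean_offdiag_sqr_rec //= -/m4 fS.
  case: k => [|[|k]] /=; rewrite ?fact0 ?fS ?fact0; first by field.
    by field.
  by field; rewrite nz ?nat1r -?natrD !pnatr_eq0.
have f0 : f 0%N = 1 by rewrite /f mean_det_sqr0 fact0 divr1.
rewrite [leRHS]mulrC -ler_pdivrMr ?ltr0n ?fact_gt0 // mulrAC.
by have := coefficient_bound f_ge0 pE qE hE fE n f0 r01.
Qed.

End second_moment_bound.

Section mean_abs.
Context d (T : measurableType d) (R : realType) (P : probability T R).

(** Cauchy-Schwarz, by integrating [2 u |Z| <= Z^2 + u^2] with [u] the mean of [|Z|]. *)
Lemma mean_abs_sqr_le (Z : T -> R) : P.-integrable setT (EFin \o Z) ->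
  P.-integrable setT (EFin \o (fun w => Z w ^+ 2)) ->
  (\int[P]_w `|Z w|) ^+ 2 <= \int[P]_w (Z w ^+ 2).
Proof.
move=> i1 i2; set u := \int[P]_w `|Z w|.
have i1' : P.-integrable setT (EFin \o (fun w => `|Z w|)) by exact: integrable_norm.
have i3 : P.-integrable setT (EFin \o (fun w => 2 * u * `|Z w|)).
  exact: (integrableZl measurableT (2 * u) i1').
have ic : P.-integrable setT (EFin \o cst (u ^+ 2)) by exact: finite_measure_integrable_cst.
have P1 : fine (P setT) = 1 by rewrite probability_setT.
have H : 2 * u * u <= \int[P]_w (Z w ^+ 2) + u ^+ 2.
  have -> : u ^+ 2 = \int[P]_w cst (u ^+ 2) w by rewrite Rintegral_cst // P1 mulr1.
  rewrite -RintegralD // {2}/u -RintegralZl //.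
  apply: le_Rintegral => //; first exact: (integrableD measurableT i2 ic).
  move=> w _ /=; rewrite -[Z w ^+ 2]real_normK ?num_real //.
  have := sqr_ge0 (`|Z w| - u); rewrite sqrrB mulr_natl; lra.
rewrite expr2 in H *; lra.
Qed.

Lemma mean_abs_mul_le (Z s : T -> R) : P.-integrable setT (EFin \o Z) ->
  P.-integrable setT (EFin \o (fun w => Z w * s w)) -> (forall w, `|s w| <= 1) ->
  `|\int[P]_w (Z w * s w)| <= \int[P]_w `|Z w|.
Proof.
move=> i1 i2 s1; rewrite (le_trans (le_normr_Rintegral _ _)) //.
apply: le_Rintegral => //; try exact: integrable_norm.
by move=> w _ /=; rewrite normrM ler_piMr.
Qed.

End mean_abs.

(** For the last bound, the sign test has mean [kap K_n + gamma K_(n+1)] with [|gamma| <= 1]; the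
    second term is itself at most [u], whence the factor 2. *)
Lemma wigner_mean_abs_det d (T : measurableType d) (R : realType) (P : probability T R)
    (mu : probability R R) n (W : T -> 'M[R]_n.+1) (x : R) :
  centered mu -> unit_variance mu -> subexponential_tails mu -> is_wigner mu P W ->
  exists u : R, [/\
    (\int[P]_w `|\det (Num.sqrt n.+1%:R *: W w - x%:M)|%:E)%E = u%:E,
    u ^+ 2 <= mean_det_sqr (quad_weight mu (cst 1)) (node R) x n.+1,
    `|mean_det (quad_weight mu (cst 1)) (node R) x n.+1| <= u &
    mean mu (fun y => `|y|) * `|mean_det (quad_weight mu (cst 1)) (node R) x n| <= 2 * u].
Proof.
move=> hcent hvar htail hW; pose Z w := \det (Num.sqrt n.+1%:R *: W w - x%:M).
have [i1 e1] := wigner_det_mean htail hW x.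
have [i2 e2] := wigner_det_sqr_mean htail hW x.
have [i3 e3] := wigner_det_sgn_mean hcent hvar htail hW x.
have k1 : `|mean_det (quad_weight mu (cst 1)) (node R) x n.+1| <= \int[P]_w `|Z w|.
  by have := le_normr_Rintegral measurableT i1; rewrite {1}/Rintegral e1.
have k2 : `|mean mu (fun y => `|y|) * mean_det (quad_weight mu (cst 1)) (node R) x n +
    (\sum_a quad_weight mu (@sgn1 R) a) * mean_det (quad_weight mu (cst 1)) (node R) x n.+1| <= \int[P]_w `|Z w|.
  have := mean_abs_mul_le i1 i3; rewrite {1}/Rintegral e3; apply => w.
  exact: (bounded1_sgn1 R).2.
exists (\int[P]_w `|Z w|); split=> //.
- by rewrite fineK //; apply: integrable_fin_num => //; exact: integrable_norm.
- by have := mean_abs_sqr_le i1 i2; rewrite {2}/Rintegral e2.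
- rewrite -[X in X * _]gtr0_norm ?(mean_abs_gt0 hcent hvar htail) // -normrM.
  rewrite -[X in `|X|](addrK ((\sum_a quad_weight mu (@sgn1 R) a) * mean_det (quad_weight mu (cst 1)) (node R) x n.+1)).
  rewrite (le_trans (ler_normB _ _)) // mulr_natl mulr2n lerD // normrM.
  by rewrite (le_trans _ k1) // ler_piMl // quad_weight_sgn1_sum.
Qed.

(** * Lower bounds on the mean absolute determinant *)

Section lower_bounds.
Variables (R : realType) (E kap u : R) (n : nat) (kk : R^nat).
Local Notation N := (n.+1%:R : R).
Local Notation x := (Num.sqrt N * E).
Hypotheses (kap0 : 0 < kap) (kk0 : kk 0%N = 1)
  (kkS : forall k, kk k.+1 = - x * kk k - k%:R * kk k.-1)
  (kkN : `|kk n.+1| <= u) (kkn : kap * `|kk n| <= 2 * u).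

(** The means follow the Hermite recursion at [- x]; the factor [s ^+ k] moves the argument to
    [|x|], since the bounds on [He] ask for a positive one, and changes no modulus. *)
Let s : R := if 0 <= x then -1 else 1.
Let He k := s ^+ k * kk k.

Let sx : s * (- x) = `|x|.
Proof.
rewrite /s; have [x0|x0] := leP 0 x; first by rewrite mulN1r opprK ger0_norm.
by rewrite mul1r ltr0_norm.
Qed.

Let ss : s * s = 1.
Proof. by rewrite /s; case: ifP => _; rewrite ?mulrNN mulr1. Qed.

Let sN k : `|s ^+ k| = 1.
Proof. by rewrite normrX /s; case: ifP => _; rewrite ?normrN normr1 expr1n. Qed.

Let HeN k : `|He k| = `|kk k|. Proof. by rewrite normrM sN mul1r. Qed.

Let He0 : He 0%N = 1. Proof. by rewrite /He kk0 mul1r. Qed.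

Let HeS k : He k.+1 = `|x| * He k - k%:R * He k.-1.
Proof.
rewrite /He kkS -sx exprS.
case: k => [|k] /=; first by rewrite !mul0r !subr0; ring.
have -> : s ^+ k = s * s * s ^+ k by rewrite ss mul1r.
rewrite exprS; ring.
Qed.

Let N0 : 0 < N. Proof. by rewrite ltr0n. Qed.
Let sN0 : 0 < Num.sqrt N. Proof. by rewrite sqrtr_gt0. Qed.

Let D := (1 + `|E| / 2) * (1 + 4 / kap ^+ 2).

Let D0 : 0 < D.
Proof.
by rewrite mulr_gt0 // ltr_wpDr // divr_ge0 // sqr_ge0.
Qed.

Let u0 : 0 <= u. Proof. exact: le_trans kkN. Qed.

Let turan_u : turan `|x| He n <= D * N * u ^+ 2.
Proof.
have le1 : `| `|x| | <= `|E| * Num.sqrt N.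
  by rewrite normr_id normrM mulrC [`|Num.sqrt N|]gtr0_norm.
rewrite (le_trans (turan_le He (normr_ge0 E) le1)) // /D -!mulrA ler_wpM2l //.
have h1 : He n.+1 ^+ 2 <= u ^+ 2.
  by rewrite -[He _ ^+ 2]real_normK ?num_real // HeN ler_sqr ?nnegrE.
have h2 : He n ^+ 2 <= 4 / kap ^+ 2 * u ^+ 2.
  rewrite -[He _ ^+ 2]real_normK ?num_real // HeN mulrAC ler_pdivlMr ?exprn_gt0 //.
  have -> : 4 * u ^+ 2 = (2 * u) ^+ 2 by ring.
  rewrite -exprMn ler_sqr ?nnegrE ?mulr_ge0 //; last exact: ltW.
  by rewrite mulrC.
have h3 : u ^+ 2 <= N * u ^+ 2 by rewrite ler_peMl ?sqr_ge0 // ler1n.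
have h4 : N * He n ^+ 2 <= N * (4 / kap ^+ 2 * u ^+ 2) by rewrite ler_wpM2l // ltW.
rewrite mulrDl mul1r; have -> : 4 / kap ^+ 2 * (N * u ^+ 2) = N * (4 / kap ^+ 2 * u ^+ 2) by ring.
lra.
Qed.

(** The term [k = 0] of the Turan sum already gives [n! <= D * N * u^2]. Positivity makes [ln u]
    meaningful. *)
Lemma mean_abs_det_gt0 : 0 < u.
Proof.
have := le_trans (turan_ge He0 HeS (leq0n n)) turan_u.
rewrite fact0 divr1 He0 expr1n mulr1 lt0r u0 andbT; apply: contraTneq => ->.
by rewrite expr0n mulr0 -ltNge ltr0n fact_gt0.
Qed.

Lemma ln_mean_abs_det_ge_inside : `|E| < 2 ->
  N * (E ^+ 2 / 2 - 1) - 3 * ln N - (3 + ln D) <= 2 * ln u - N * ln N.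
Proof.
move=> E2; have up := mean_abs_det_gt0.
move: D0 turan_u; generalize D => D' D0' turan_u'.
have x2 : x ^+ 2 = N * E ^+ 2 by rewrite exprMn sqr_sqrtr ?ler0n.
have E4 : E ^+ 2 < 4.
  rewrite -[E ^+ 2]real_normK ?num_real // (_ : 4 = 2 ^+ 2) ?ltr_sqr ?nnegrE //; ring.
(* The largest [k] with [4 k <= x^2], the range of the bound on [He k]; [|E| < 2] keeps it at most
   [n]. Rounding costs at most 2 in [2 k]. *)
pose k := Num.truncn (N * E ^+ 2 / 4).
have k_itv : k%:R <= N * E ^+ 2 / 4 < k%:R + 1.
  rewrite natr1; apply: Num.Theory.truncn_itv.
  by rewrite divr_ge0 // mulr_ge0 ?sqr_ge0 // ltW.
have kn : (k <= n)%N.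
  rewrite -ltnS -(ltr_nat R) (le_lt_trans (andP k_itv).1) //.
  rewrite ltr_pdivrMr // ltr_pM2l //.
have lnn : ln N * N - N <= ln (n`!%:R : R) + ln N.
  have [h _] := ln_fact_bounds R n.
  have -> : ln (n`!%:R : R) + ln N = ln ((n.+1)`!%:R : R).
    by rewrite factS natrM lnM ?posrE ?ltr0n ?fact_gt0 // addrC.
  by move: h; rewrite mulrC.
(* Logarithm of [n! / k! * k^k * e^k] with the upper Stirling bound for [k!]: the two factors [e^k]
   combine into [2 k], and [ln k + 1] is lost. *)
have main : ln (n`!%:R : R) + (2 * k%:R - ln N - 1) <= ln D' + ln N + 2 * ln u.
  have -> : ln D' + ln N + 2 * ln u = ln (D' * N * u ^+ 2).
    have u2 : 0 < u ^+ 2 by rewrite exprn_gt0.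
    by rewrite [in RHS]lnM ?posrE ?mulr_gt0 // [in RHS]lnM ?posrE // lnXn // mulr_natl.
  have lnN : 0 <= ln N by rewrite ln_ge0 // ler1n.
  case k0: k => [|k'].
    have := le_trans (turan_ge He0 HeS (leq0n n)) turan_u'.
    rewrite fact0 divr1 He0 expr1n mulr1 => h.
    have : ln (n`!%:R : R) <= ln (D' * N * u ^+ 2).
      by rewrite ler_ln ?posrE ?ltr0n ?fact_gt0 // !mulr_gt0 // ?exprn_gt0.
    lra.
  have kx : 4 * k%:R <= `|x| ^+ 2.
    rewrite real_normK ?num_real // x2 mulrC -ler_pdivlMr //; exact: (andP k_itv).1.
  have kp : (0 < k)%N by rewrite k0.
  have kp' : 0 < (k%:R : R) by rewrite ltr0n.
  have x0 : 0 < `|x|.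
    rewrite lt0r normr_ge0 andbT; apply: contraTneq kx => ->.
    by rewrite expr0n -ltNge mulr_gt0.
  have h1 := hermite_sq_ge He0 HeS x0 kp kx.
  have h2 := le_trans (turan_ge He0 HeS kn) turan_u'.
  have kf : 0 < (k`!%:R : R) by rewrite ltr0n fact_gt0.
  have nf : 0 < (n`!%:R : R) by rewrite ltr0n fact_gt0.
  have h3 : n`!%:R / k`!%:R * (k%:R ^+ k * expR k%:R) <= D' * N * u ^+ 2.
    rewrite (le_trans _ h2) // ler_wpM2l // divr_ge0 // ltW //.
  have {h3} : ln (n`!%:R / k`!%:R * (k%:R ^+ k * expR k%:R)) <= ln (D' * N * u ^+ 2).
    rewrite ler_ln ?posrE // !mulr_gt0 ?exprn_gt0 ?invr_gt0 ?expR_gt0 //.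
  rewrite lnM ?posrE ?mulr_gt0 ?exprn_gt0 ?invr_gt0 ?expR_gt0 //.
  rewrite ln_div ?posrE // lnM ?posrE ?exprn_gt0 ?expR_gt0 // expRK lnXn //.
  rewrite k0 in kp' kn *; have [_ h] := ln_fact_bounds R k'.
  have : ln (k'.+1%:R : R) <= ln N by rewrite ler_ln ?posrE // ler_nat ltnW.
  move: h; rewrite -[ln _ *+ _]mulr_natl => h lkN.
  set X := ln (k'.+1%:R : R) in h lkN *; set Y := ln ((k'.+1)`!%:R : R) in h *.
  lra.
move: (andP k_itv).2 => kb.
lra.
Qed.

(** At [|E| = a + 1 / a] the larger root at rank [N] is exactly [sqrt N * a], so the Hermite bound
    reads [(sqrt N a)^N * expR (N / (2 a^2))] and no error term remains. *)
Lemma ln_mean_abs_det_ge_outside (a : R) : 1 <= a -> `|E| = a + a^-1 ->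
  N * (2 * ln a + (a ^+ 2)^-1) <= 2 * ln u - N * ln N.
Proof.
move=> a1 Ea; have up := mean_abs_det_gt0.
have a0 : 0 < a by rewrite (lt_le_trans _ a1).
have sq : Num.sqrt N ^+ 2 = N by rewrite sqr_sqrtr.
have aV : a^-1 <= a by rewrite (le_trans _ a1) // invf_le1.
have x0 : 0 < `|x|.
  by rewrite normrM gtr0_norm // mulr_gt0 // Ea addr_gt0 ?invr_gt0.
have absx : `|x| = Num.sqrt N * (a + a^-1) by rewrite normrM Ea gtr0_norm.
have x4 : `|x| ^+ 2 - 4 * N = N * (a - a^-1) ^+ 2.
  rewrite absx exprMn sq; field; rewrite gt_eqF //.
have kx : 4 * N <= `|x| ^+ 2.
  by rewrite -subr_ge0 x4 mulr_ge0 ?sqr_ge0.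
have rt : hermite_root `|x| n.+1 = Num.sqrt N * a.
  rewrite /hermite_root x4 absx sqrtrM ?ltW // sqrtr_sqr [`|a - _|]ger0_norm ?subr_ge0 //.
  by field; rewrite gt_eqF.
have ra : 0 < Num.sqrt N * a by rewrite mulr_gt0.
have := hermite_ge He0 HeS x0 kx; rewrite rt => h.
have {h} h : (Num.sqrt N * a) ^+ n.+1 * expR ((N / (Num.sqrt N * a)) ^+ 2 / 2) <= u.
  by rewrite (le_trans h) // (le_trans (ler_norm _)) // HeN.
have : ln ((Num.sqrt N * a) ^+ n.+1 * expR ((N / (Num.sqrt N * a)) ^+ 2 / 2)) <= ln u.
  by rewrite ler_ln ?posrE // mulr_gt0 ?expR_gt0 ?exprn_gt0.
rewrite lnM ?posrE ?exprn_gt0 ?expR_gt0 // expRK lnXn // lnM ?posrE //.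
have -> : (N / (Num.sqrt N * a)) ^+ 2 / 2 = N / (2 * a ^+ 2).
  rewrite exprMn exprVn exprMn sq; field; rewrite gt_eqF //=.
have ls : ln N = 2 * ln (Num.sqrt N).
  by rewrite -{1}sq lnXn // mulr_natl.
rewrite -[_ *+ _]mulr_natl ls => {}h.
have -> : N * (2 * ln a + (a ^+ 2)^-1) = 2 * (N * ln a + N / (2 * a ^+ 2)).
  by field; rewrite gt_eqF.
move: (N / _) h => z h; lra.
Qed.

End lower_bounds.

Lemma ln_mean_abs_det_le (R : realType) (E u C r : R) (n : nat) :
  0 < u -> 0 < r ->
  u ^+ 2 * r ^+ n.+1 <= (n.+1)`!%:R * expR (n.+1%:R * E ^+ 2 * (r / (1 + r)) + C) ->
  2 * ln u - n.+1%:R * ln n.+1%:R <=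
    n.+1%:R * (E ^+ 2 * (r / (1 + r)) - ln r - 1) + ln n.+1%:R + (1 + C).
Proof.
move=> u0 r0 h.
have f0 : 0 < ((n.+1)`!%:R : R) by rewrite ltr0n fact_gt0.
have : ln (u ^+ 2 * r ^+ n.+1) <=
    ln ((n.+1)`!%:R * expR (n.+1%:R * E ^+ 2 * (r / (1 + r)) + C)).
  by rewrite ler_ln ?posrE ?mulr_gt0 ?exprn_gt0 ?expR_gt0.
rewrite !lnM ?posrE ?exprn_gt0 ?expR_gt0 // expRK !lnXn // -![ln _ *+ _]mulr_natl.
have [_ h2] := ln_fact_bounds R n.
move: (r / (1 + r)) => z; lra.
Qed.

Section limits.
Variable R : realType.

Lemma near_ln_le (C e : R) : 0 < e ->
  \forall n \near \oo, C + 3 * ln (n.+1%:R : R) <= e * n.+1%:R.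
Proof.
move=> e0; pose s := (6 + `|C|) / e + 1.
near=> n.
have N0 : 0 < (n.+1%:R : R) by rewrite ltr0n.
have sq : Num.sqrt (n.+1%:R : R) ^+ 2 = n.+1%:R by rewrite sqr_sqrtr ?ltW.
set t := Num.sqrt _ in sq; have t0 : 0 < t by rewrite sqrtr_gt0.
have st : s <= t.
  rewrite -[s]ger0_norm; last by rewrite addr_ge0 // divr_ge0 // ltW.
  rewrite -sqrtr_sqr ler_wsqrtr //.
  have : s ^+ 2 <= n%:R by near: n; exact: nbhs_infty_ger.
  by move=> /le_trans; apply; rewrite ler_nat.
have ln1 : ln (n.+1%:R : R) <= 2 * t.
  rewrite -sq lnXn // -[ln t *+ _]mulr_natl ler_wpM2l //.
  by have := ln_sublinear t0; move/ltW.
have t1 : 1 <= t by rewrite (le_trans _ st) // lerDr divr_ge0 // ltW.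
have Ct : C <= `|C| * t by rewrite (le_trans (ler_norm C)) // ler_peMr.
have est : (6 + `|C|) <= e * t.
  by rewrite -ler_pdivrMl // mulrC (le_trans _ st) // lerDl.
have : (6 + `|C|) * t <= e * n.+1%:R by rewrite -sq expr2 mulrA ler_wpM2r // ltW.
lra.
Unshelve. all: by end_near. Qed.

End limits.

(** At [|E| = 2] the regimes meet: the upper bound comes from [r] close to 1, the lower one from
    [a = 1], a double root. *)
Lemma potential_cases (R : realType) (E : R) : exists phi : R,
  [/\ (\int[@lebesgue_measure R]_x (ln `|x - E| * rho_sc x)%:E)%E = phi%:E,
      forall e, 0 < e -> exists2 r, 0 < r < 1 &
        E ^+ 2 * (r / (1 + r)) - ln r - 1 <= 2 * phi + e
    & `|E| < 2 /\ 2 * phi = E ^+ 2 / 2 - 1 \/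
      exists a, [/\ 1 <= a, `|E| = a + a^-1 & 2 * phi = 2 * ln a + (a ^+ 2)^-1]].
Proof.
have upper (phi e : R) : E ^+ 2 / 2 - 1 <= 2 * phi -> 0 < e -> exists2 r, 0 < r < 1 &
    E ^+ 2 * (r / (1 + r)) - ln r - 1 <= 2 * phi + e.
  (* Here [r / (1 + r) <= 1 / 2], and [- ln r] is exactly the tolerance. *)
  move=> phiE e0; exists (expR (- e)).
    by rewrite expR_gt0 expR_lt1 oppr_lt0 e0.
  rewrite expRK; set r := expR _.
  have r0 : 0 < r by exact: expR_gt0.
  have r1 : r < 1 by rewrite expR_lt1 oppr_lt0.
  have : E ^+ 2 * (r / (1 + r)) <= E ^+ 2 * 2^-1.
    rewrite ler_wpM2l ?sqr_ge0 // ler_pdivrMr ?addr_gt0 //; lra.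
  lra.
have E2 : E ^+ 2 = `|E| ^+ 2 by rewrite real_normK ?num_real.
have [E_lt2|E_ge2] := ltP `|E| 2.
  exists (E ^+ 2 / 4 - 2^-1); split; first exact/potential_inside/ltW.
    by move=> e; apply: upper; lra.
  by left; split=> //; lra.
pose a := (`|E| + Num.sqrt (E ^+ 2 - 4)) / 2.
have D0 : 0 <= E ^+ 2 - 4.
  rewrite E2 subr_ge0 (_ : 4 = 2 ^+ 2) ?ler_sqr ?nnegrE //; ring.
have sqD := sqr_sqrtr D0.
have sD := sqrtr_ge0 (E ^+ 2 - 4).
have a1 : 1 <= a by rewrite /a; lra.
have a0 : 0 < a by rewrite (lt_le_trans _ a1).
have Ea : `|E| = a + a^-1.
  apply: (mulIf (lt0r_neq0 a0)); rewrite mulrDl mulVf ?gt_eqF // /a.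
  rewrite E2 in sqD *; lra.
have phi_a : 2 * (ln a + (2 * a ^+ 2)^-1) = 2 * ln a + (a ^+ 2)^-1.
  by field; rewrite gt_eqF.
have [a_gt1|a_le1] := ltP 1 a.
  exists (ln a + (2 * a ^+ 2)^-1); split; first exact: potential_outside.
    (* The minimizer of the rate, at which the bound holds without tolerance. *)
    move=> e e0; exists ((a ^+ 2)^-1).
      by rewrite invr_gt0 exprn_gt0 // invf_lt1 ?exprn_gt0 // expr_gt1 // ltW.
    rewrite phi_a lnV ?posrE ?exprn_gt0 // lnXn // -[ln a *+ _]mulr_natl.
    have -> : E ^+ 2 * ((a ^+ 2)^-1 / (1 + (a ^+ 2)^-1)) = 1 + (a ^+ 2)^-1.
      rewrite E2 Ea; field; rewrite gt_eqF //= gt_eqF // addr_gt0 // exprn_gt0 //.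
    lra.
  by right; exists a.
have {a_le1} a_1 : a = 1 by apply/le_anti; rewrite a_le1 a1.
exists 2^-1; have E_2 : `|E| = 2 by rewrite Ea a_1; lra.
split.
- by rewrite potential_inside ?E_2 // E2 E_2; congr EFin; lra.
- by move=> e; apply: upper; rewrite E2 E_2; lra.
- right; exists 1; rewrite ln1 E_2; split=> //; rewrite ?invr1; lra.
Qed.

(* [lne] is the logarithm with values in \bar R (lne 0 = -oo).  On the
   right-hand side [ln] takes the value 0 at 0, which only matters on the
   Lebesgue-null set {E}. *)
Theorem corollary1p3 (R : realType) (mu : probability R R)
    (hcent : centered mu) (hvar : unit_variance mu)
    (htail : subexponential_tails mu)
    (d : nat -> measure_display) (Omega : forall N : nat, measurableType (d N))
    (P : forall N : nat, probability (Omega N) R)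
    (W : forall N : nat, Omega N -> 'M[R]_N)
    (hW : forall N : nat, is_wigner mu (P N) (W N))
    (E : R) :
  ((N%:R^-1)%:E * lne 'E_(P N)[fun w => `|\det (W N w - E%:M)|%R])%E
    @[N --> \oo] -->
  (\int[@lebesgue_measure R]_x (ln `|x - E| * rho_sc x)%:E)%E.
Proof.
have [phi [-> upper lower]] := potential_cases E.
have w0 := quad_weight_sum htail; have w1 := quad_weight_mean hcent htail.
have w2 := quad_weight_var hcent hvar htail.
pose x n : R := Num.sqrt n.+1%:R * E.
pose kap := mean mu (fun y => `|y|).
have kap0 : 0 < kap := mean_abs_gt0 hcent hvar htail.
pose spec n u := [/\
  (\int[P n.+1]_w `|\det (Num.sqrt n.+1%:R *: W n.+1 w - (x n)%:M)|%:E)%E = u%:E,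
    u ^+ 2 <= mean_det_sqr (quad_weight mu (cst 1)) (node R) (x n) n.+1,
    `|mean_det (quad_weight mu (cst 1)) (node R) (x n) n.+1| <= u &
    kap * `|mean_det (quad_weight mu (cst 1)) (node R) (x n) n| <= 2 * u].
have /choice[u uP] : forall n, exists u, spec n u.
  by move=> n; exact: wigner_mean_abs_det.
have mean_det0 n : mean_det (quad_weight mu (cst 1)) (node R) (x n) 0 = 1.
  rewrite /mean_det -[RHS](dexp_cst (w := fun _ : {set 'I_0} => quad_weight mu (cst 1)) 1) //.
  by apply: eq_dexp => f; rewrite det_mx00.
have u0 n : 0 < u n.
  have [_ _ h1 h2] := uP n.
  exact: (mean_abs_det_gt0 kap0 (mean_det0 n) (mean_det_rec w0 w1 w2 (x n)) h1 h2).
(* [det (W - E) = N^(-N/2) det (sqrt N W - x)], so [l n] is twice the logarithm of the mean absolute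
   determinant of [W - E]. *)
pose l n := 2 * ln (u n) - n.+1%:R * ln n.+1%:R.
have lE n : ((n.+1%:R^-1)%:E * lne 'E_(P n.+1)[fun w => `|\det (W n.+1 w - E%:M)|%R])%E =
    (l n / (2 * n.+1%:R))%:E.
  have [uE _ _ _] := uP n.
  have N0 : 0 < (n.+1%:R : R) by rewrite ltr0n.
  have s0 : 0 < Num.sqrt (n.+1%:R : R) by rewrite sqrtr_gt0.
  have detE w : `|\det (W n.+1 w - E%:M)| =
      (Num.sqrt n.+1%:R ^+ n.+1)^-1 * `|\det (Num.sqrt n.+1%:R *: W n.+1 w - (x n)%:M)|.
    have -> : Num.sqrt n.+1%:R *: W n.+1 w - (x n)%:M = Num.sqrt n.+1%:R *: (W n.+1 w - E%:M).
      by rewrite scalerBr scale_scalar_mx.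
    rewrite detZ normrM normrX (gtr0_norm s0) mulKf // gt_eqF // exprn_gt0 //.
  have -> : ('E_(P n.+1)[fun w => `|\det (W n.+1 w - E%:M)|%R] =
      ((Num.sqrt n.+1%:R ^+ n.+1)^-1 * u n)%R%:E)%E.
    rewrite unlock; under eq_integral do rewrite detE EFinM.
    have [i1 _] := wigner_det_mean htail (hW n.+1) (x n).
    rewrite integralZl //; first by rewrite uE.
    exact: integrable_norm.
  have sN0 : 0 < Num.sqrt (n.+1%:R : R) ^+ n.+1 by rewrite exprn_gt0.
  rewrite lne_EFin ?mulr_gt0 ?invr_gt0 // -EFinM; congr EFin.
  rewrite lnM ?posrE ?invr_gt0 // lnV ?posrE // lnXn // -[ln _ *+ _]mulr_natl /l.
  have -> : ln (n.+1%:R : R) = 2 * ln (Num.sqrt n.+1%:R).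
    by rewrite -{1}(sqr_sqrtr (ltW N0)) lnXn // mulr_natl.
  by field; rewrite nat1r gt_eqF.
rewrite -cvg_shiftS; under eq_fun do rewrite lE.
apply: cvg_EFin; first by near=> n.
have [C low] : exists C : R, forall n,
    n.+1%:R * (2 * phi) - (C + 3 * ln n.+1%:R) <= l n.
  case: lower => [[E2 ->]|[a [a1 Ea ->]]].
    exists (3 + ln ((1 + `|E| / 2) * (1 + 4 / kap ^+ 2))) => n; have [_ _ h1 h2] := uP n.
    have := ln_mean_abs_det_ge_inside kap0 (mean_det0 n) (mean_det_rec w0 w1 w2 (x n)) h1 h2 E2.
    by rewrite /l; lra.
  exists 0 => n; have [_ _ h1 h2] := uP n.
  have := ln_mean_abs_det_ge_outside kap0 (mean_det0 n) (mean_det_rec w0 w1 w2 (x n)) h1 h2 a1 Ea.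
  have : 0 <= ln (n.+1%:R : R) by rewrite ln_ge0 // ler1n.
  by rewrite /l; lra.
(* The signed sum equals the integral of a square, for the Wigner matrix of size [k]; the shift
   [x n] stays fixed while [k] varies, as in the recursion. *)
have mean_det_sqr_ge0 n k : 0 <= mean_det_sqr (quad_weight mu (cst 1)) (node R) (x n) k.
  have [_ e] := wigner_det_sqr_mean htail (hW k) (x n).
  rewrite -lee_fin -e; apply: integral_ge0 => w _.
  by rewrite lee_fin sqr_ge0.
apply/cvgrPdist_le => e e0.
have [r r01 hr] := upper e e0; have [r0 r1] := andP r01.
pose Cr := 1 + (r / (1 - r ^+ 2) + 2 / (1 - r) +
  `|\sum_a quad_weight mu (cst 1) a * node R a ^+ 4 - 3|) * r.
near=> n.
have N0 : 0 < (n.+1%:R : R) by rewrite ltr0n.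
have up : l n <= n.+1%:R * (2 * phi + e) + (ln n.+1%:R + Cr).
  have [_ h _ _] := uP n.
  have h1 := mean_det_sqr_le w0 w1 w2 (mean_det_sqr_ge0 n) n.+1 r01.
  have h2 : u n ^+ 2 * r ^+ n.+1 <= mean_det_sqr (quad_weight mu (cst 1)) (node R) (x n) n.+1 * r ^+ n.+1.
    by rewrite ler_wpM2r // exprn_ge0 // ltW.
  have := @ln_mean_abs_det_le R E (u n) (Cr - 1) r n (u0 n) r0.
  have -> : n.+1%:R * E ^+ 2 * (r / (1 + r)) = x n ^+ 2 * (r / (1 + r)).
    by rewrite exprMn sqr_sqrtr // ltW.
  have -> : Cr - 1 = (r / (1 - r ^+ 2) + 2 / (1 - r) +
      `|\sum_a quad_weight mu (cst 1) a * node R a ^+ 4 - 3|) * r by rewrite /Cr addrC addKr.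
  move=> /(_ (le_trans h2 h1)); rewrite -/(l n) -/Cr.
  have : n.+1%:R * (E ^+ 2 * (r / (1 + r)) - ln r - 1) <= n.+1%:R * (2 * phi + e).
    by rewrite ler_wpM2l // ltW.
  move: (n.+1%:R * _) (n.+1%:R * _) => y z; lra.
have ln0 : 0 <= ln (n.+1%:R : R) by rewrite ln_ge0 // ler1n.
(* The distance is measured after division by [2 N]: a slack [e N] is spent on the choice of [r] and
   another on the logarithms, together [2 e N]. *)
have near1 : C + 3 * ln (n.+1%:R : R) <= e * n.+1%:R by near: n; exact: near_ln_le.
have near2 : Cr + 3 * ln (n.+1%:R : R) <= e * n.+1%:R by near: n; exact: near_ln_le.
have lown := low n.
rewrite ler_norml; apply/andP; split.
  rewrite lerNl opprB lerBlDl ler_pdivrMr ?mulr_gt0 //; lra.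
rewrite lerBlDl -lerBlDr ler_pdivlMr ?mulr_gt0 //; lra.
Unshelve. all: by end_near. Qed.
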